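(* With $S(\rho|\sigma)=S_{13}(z;\rho|\sigma)$ and $H_c(z,q)$ as defined in the context, the following twenty-two identities of formal (Laurent) series hold: $$\begin{aligned} H_{(10,0,0)}(z,q)&=S((1,1,1)|(1,1,1)),\\ H_{(9,1,0)}(z,q)&=S((0,1,1)|(1,1,1)),\\ H_{(9,0,1)}(z,q)&=S((1,1,1)|(0,1,1))-q(1-z)S((2,1,1)|(1,1,1)),\\ H_{(8,2,0)}(z,q)&=S((0,0,1)|(1,1,1)),\\ H_{(8,1,1)}(z,q)&=S((0,1,1)|(0,1,1))-qS((1,1,1)|(1,1,1)),\\ H_{(8,0,2)}(z,q)&=S((1,1,1)|(0,0,1))-q(1-z)S((2,1,1)|(0,1,1)),\\ H_{(7,3,0)}(z,q)&=S((0,0,0)|(1,1,1)),\\ H_{(7,2,1)}(z,q)&=S((0,0,1)|(0,1,1))-qS((0,1,1)|(1,1,1)),\\ H_{(7,1,2)}(z,q)&=S((0,1,1)|(0,0,1))-qS((1,1,1)|(0,1,1)),\\ H_{(7,0,3)}(z,q)&=S((1,1,1)|(0,0,0))-q(1-z)S((2,1,1)|(0,0,1)),\\ H_{(6,3,1)}(z,q)&=S((0,0,0)|(0,1,1))-qS((0,0,1)|(1,1,1)),\\ H_{(6,2,2)}(z,q)&=S((0,0,1)|(0,0,1))-qS((0,1,1)|(0,1,1)),\\ H_{(6,1,3)}(z,q)&=S((0,1,1)|(0,0,0))-qS((1,1,1)|(0,0,1)),\\ H_{(5,3,2)}(z,q)&=S((0,0,0)|(0,0,1))-qS((0,0,1)|(0,1,1)),\\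 H_{(5,2,3)}(z,q)&=S((0,0,1)|(0,0,0))-qS((0,1,1)|(0,0,1)),\\ H_{(4,3,3)}(z,q)&=S((0,0,0)|(0,0,0))-qS((0,0,1)|(0,0,1)), \end{aligned}$$ $$\begin{aligned} H_{(6,4,0)}(z,q)&=S((-1,0,0)|(1,1,1))-S((0,0,1)|(0,1,1))+qS((0,1,1)|(1,1,1))\\ &\quad+(1-z)S((1,0,0)|(0,1,1))-q(1-z)S((1,0,1)|(1,1,1)), \end{aligned}$$ $$\begin{aligned} H_{(5,5,0)}(z,q)&=S((-2,0,0)|(1,1,1))-S((-1,0,1)|(0,1,1))+qS((-1,1,1)|(1,1,1))\\ &\quad+(1-z/q-z)S((0,0,0)|(0,1,1))-(q-z-qz)S((0,0,1)|(1,1,1))\\ &\quad-q(1-z)z\,S((1,0,0)|(1,1,1))-(1-z)S((1,0,1)|(0,0,1))\\ &\quad+q(1-z)S((1,1,1)|(0,1,1))+(1-z)(1-qz)S((2,0,0)|(0,0,1))\\ &\quad-q(1-z)(1-qz)S((2,0,1)|(0,1,1)), \end{aligned}$$ $$\begin{aligned} H_{(5,4,1)}(z,q)&=S((-1,0,0)|(0,1,1))-qS((-1,0,1)|(1,1,1))-zS((0,0,0)|(1,1,1))\\ &\quad-S((0,0,1)|(0,0,1))+qS((0,1,1)|(0,1,1))+(1-z)S((1,0,0)|(0,0,1))\\ &\quad-q(1-z)S((1,0,1)|(0,1,1)), \end{aligned}$$ $$\begin{aligned} H_{(4,4,2)}(z,q)&=S((-1,0,0)|(0,0,1))-qS((-1,0,1)|(0,1,1))-zS((0,0,0)|(0,1,1))\\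 &\quad-S((0,0,1)|(0,0,0))+qzS((0,0,1)|(1,1,1))+qS((0,1,1)|(0,0,1))\\ &\quad+(1-z)S((1,0,0)|(0,0,0))-qz(1-z)S((1,0,0)|(1,1,1))\\ &\quad-q(1-z)S((1,0,1)|(0,0,1)), \end{aligned}$$ $$\begin{aligned} H_{(5,1,4)}(z,q)&=S((-1,0,1)|(0,0,0))-qS((-1,1,1)|(0,0,1))-S((0,0,0)|(0,0,0))\\ &\quad+(1-z)S((0,0,0)|(0,0,1))-(1-q)S((0,0,1)|(0,0,1))\\ &\quad-q(1-z)S((0,0,1)|(0,1,1))+qS((0,1,1)|(0,1,1))\\ &\quad+(1-z)S((1,0,0)|(0,0,1))-q(1-z)z\,S((1,0,0)|(0,1,1))\\ &\quad-(1-z)S((1,0,1)|(0,0,0))-q(1-z)S((1,0,1)|(0,1,1))\\ &\quad+q^2(1-z)z\,S((1,0,1)|(1,1,1))+(1-z)S((1,1,1)|(0,0,0))\\ &\quad+q(1-z)S((1,1,1)|(0,0,1))+(1-z)(1-qz)S((2,0,0)|(0,0,0))\\ &\quad-q^2z(1-z)(1-qz)S((2,0,0)|(1,1,1))-(1-z)(1-qz)S((2,0,1)|(0,0,0))\\ &\quad-q(1-z)(1-qz)S((2,0,1)|(0,0,1))-q^2z(1-z)S((2,1,1)|(0,0,1)), \end{aligned}$$ $$\begin{aligned} H_{(6,0,4)}(z,q)&=S((0,0,1)|(0,0,0))-qS((0,1,1)|(0,0,1))-S((1,0,0)|(0,0,0))\\ &\quad+(1-qz)S((1,0,0)|(0,0,1))-(1-q)S((1,0,1)|(0,0,1))\\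 &\quad-q(1-qz)S((1,0,1)|(0,1,1))+qS((1,1,1)|(0,1,1))\\ &\quad+(1-qz)S((2,0,0)|(0,0,1))-q^2z(1-qz)S((2,0,0)|(0,1,1))\\ &\quad-(1-qz)S((2,0,1)|(0,0,0))-q(1-qz)S((2,0,1)|(0,1,1))\\ &\quad+q^3z(1-qz)S((2,0,1)|(1,1,1))+S((2,1,1)|(0,0,0))\\ &\quad+q(1-qz)S((2,1,1)|(0,0,1))+(1-qz)(1-q^2z)S((3,0,0)|(0,0,0))\\ &\quad-q^3z(1-qz)(1-q^2z)S((3,0,0)|(1,1,1))-(1-qz)(1-q^2z)S((3,0,1)|(0,0,0))\\ &\quad-q(1-qz)(1-q^2z)S((3,0,1)|(0,0,1))-q^3z(1-qz)S((3,1,1)|(0,0,1)). \end{aligned}$$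
   Context: For an integer $L\ge0$, $(a;q)_L:=(1-a)(1-aq)\cdots(1-aq^{L-1})$ and $(a;q)_\infty:=\lim_{L\to\infty}(a;q)_L$. Cylindric partitions. A profile is a finite list $c=(c_1,\dots,c_r)$ of non-negative integers. A cylindric partition with profile $c$ is a vector $\pi=(\pi^{(1)},\dots,\pi^{(r)})$ of $r$ integer partitions $\pi^{(i)}=(\pi^{(i)}_1\ge\pi^{(i)}_2\ge\cdots)$ (extended by zeros) satisfying, for all $j\ge1$, $\pi^{(i)}_j\ge\pi^{(i+1)}_{j+c_{i+1}}$ for $1\le i\le r-1$, and $\pi^{(r)}_j\ge\pi^{(1)}_{j+c_1}$. Let $\mathcal P_c$ be the set of these, $|\pi|$ the sum of all parts of all $\pi^{(i)}$, and $\max(\pi)$ the largest part occurring in $\pi$ ($0$ if all $\pi^{(i)}$ are empty). Put $$F_c(z,q):=\sum_{\pi\in\mathcal P_c}z^{\max(\pi)}q^{|\pi|},\qquad H_c(z,q):=\frac{(zq;q)_\infty}{(q;q)_\infty}F_c(z,q).$$ Sums. For $\rho=(\rho_1,\rho_2,\rho_3),\ \sigma=(\sigma_1,\sigma_2,\sigma_3)\in\mathbb Z^3$, $$S_{13}(z;\rho|\sigma):=\sum_{\substack{r_1\ge r_2\ge r_3\ge0\\ s_1\ge s_2\ge s_3\ge0}} z^{r_1}\,\frac{q^{\sum_{i=1}^{3}(r_i^2-r_is_i+s_i^2+\rho_ir_i+\sigma_is_i)}}{(q;q)_{r_1-r_2}(q;q)_{r_2-r_3}(q;q)_{s_1-s_2}(q;q)_{s_2-s_3}(q;q)_{r_3}(q;q)_{s_3}(q;q)_{r_3+s_3+1}}.$$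 All series are regarded as formal Laurent series in $q$ with coefficients polynomial in $z$. *)

(* Defs.v *)
From HB Require Import structures.
From mathcomp Require Import all_boot all_order all_algebra.
From mathcomp Require Import finmap all_classical.
From mathcomp Require Import zify ring.

Set Implicit Arguments.
Unset Strict Implicit.
Unset Printing Implicit Defensive.

Import Order.TTheory GRing.Theory Num.Theory.

Local Open Scope classical_set_scope.
Local Open Scope ring_scope.

(* [f n] is the coefficient of q^n in [f]. *)
Record laurent (R : nzRingType) := Laurent {
  lcoef :> int -> R;
  _ : exists a : int, forall n, n < a -> lcoef n = 0 }.

HB.instance Definition _ (R : nzRingType) := gen_eqMixin (laurent R).
HB.instance Definition _ (R : nzRingType) := gen_choiceMixin (laurent R).

Lemma laurentP (R : nzRingType) (f g : laurent R) :
  (forall n, f n = g n) -> f = g.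
Proof.
case: f g => [f hf] [g hg] /= /funext fg.
by case: _ / fg in hg *; congr Laurent; exact: Prop_irrelevance.
Qed.

Definition vanish_below (R : nzRingType) (a : int) (f : int -> R) :=
  forall n, n < a -> f n = 0.

Lemma laurent_bound (R : nzRingType) (f : laurent R) :
  exists a, vanish_below a f.
Proof. by case: f. Qed.

Lemma vanish_belowW (R : nzRingType) (a b : int) (f : int -> R) :
  a <= b -> vanish_below b f -> vanish_below a f.
Proof. by move=> ab hf n na; apply: hf; apply: lt_le_trans na ab. Qed.

Section LaurentZmod.
Variable R : nzRingType.
Implicit Types f g h : laurent R.

Fact lzero_subproof : exists a : int, vanish_below a (fun=> 0 : R).
Proof. by exists 0. Qed.
Definition lzero : laurent R := Laurent lzero_subproof.

Fact lopp_subproof f : exists a : int, vanish_below a (fun n => - f n).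
Proof. by have [a fa] := laurent_bound f; exists a => n /fa ->; rewrite oppr0. Qed.
Definition lopp f : laurent R := Laurent (lopp_subproof f).

Fact ladd_subproof f g : exists a : int, vanish_below a (fun n => f n + g n).
Proof.
have [a fa] := laurent_bound f; have [b gb] := laurent_bound g.
exists (Num.min a b) => n; rewrite lt_min => /andP[na nb].
by rewrite fa // gb // addr0.
Qed.
Definition ladd f g : laurent R := Laurent (ladd_subproof f g).

Fact laddA : associative ladd.
Proof. by move=> f g h; apply: laurentP => n /=; rewrite addrA. Qed.
Fact laddC : commutative ladd.
Proof. by move=> f g; apply: laurentP => n /=; rewrite addrC. Qed.
Fact ladd0 : left_id lzero ladd.
Proof. by move=> f; apply: laurentP => n /=; rewrite add0r. Qed.
Fact laddN : left_inverse lzero lopp ladd.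
Proof. by move=> f; apply: laurentP => n /=; rewrite addNr. Qed.

HB.instance Definition _ := GRing.isZmodule.Build (laurent R)
  laddA laddC ladd0 laddN.

Lemma coefl0 n : (0 : laurent R) n = 0. Proof. by []. Qed.
Lemma coeflD f g n : (f + g) n = f n + g n. Proof. by []. Qed.
Lemma coeflN f n : (- f) n = - f n. Proof. by []. Qed.
Lemma coeflB f g n : (f - g) n = f n - g n. Proof. by []. Qed.
Lemma coefl_sum I (r : seq I) (P : pred I) (F : I -> laurent R) n :
  (\sum_(i <- r | P i) F i) n = \sum_(i <- r | P i) F i n.
Proof. by elim/big_rec2: _ => // i x y _ <-. Qed.

End LaurentZmod.

Section LaurentRing.
Variable R : comNzRingType.
Implicit Types f g h : laurent R.

Definition lmul_coef (f g : int -> R) (n : int) : R :=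
  \sum_(i \in [set: int]) f i * g (n - i).

Lemma lmul_coefE f g (a b : int) (n : nat) :
  vanish_below a f -> vanish_below b g ->
  lmul_coef f g (a + b + n%:Z) =
    \sum_(k < n.+1) f (a + k%:Z) * g (b + (n - k)%N%:Z).
Proof.
move=> fa gb; rewrite /lmul_coef.
pose r := [seq a + k%:Z | k <- iota 0 n.+1].
have ur : uniq r.
  by rewrite map_inj_uniq ?iota_uniq// => x y /addrI [].
rewrite (fsbigE r) //.
  rewrite big_mkcond big_map -(big_mkord predT (fun k => f (a + k%:Z) * g (b + (n - k)%N%:Z))).
  rewrite /index_iota subn0 !big_seq; apply: eq_bigr => k.
  rewrite mem_iota in_setT => kn; congr (_ * g _).
  by lia.
move=> i _ inr; have [ia|ai] := ltP i a; first by rewrite fa ?mul0r.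
rewrite gb ?mulr0//; case: (ltP (a + n%:Z) i) => [|ni]; first lia.
case/negP: inr; apply/mapP; exists (absz (i - a)%R); last lia.
by rewrite mem_iota; lia.
Qed.

Lemma lmul_vanish f g (a b : int) :
  vanish_below a f -> vanish_below b g ->
  vanish_below (a + b) (lmul_coef f g).
Proof.
move=> fa gb n nab; rewrite /lmul_coef fsbig1// => i _.
have [ia|ai] := ltP i a; first by rewrite fa ?mul0r.
by rewrite gb ?mulr0//; lia.
Qed.

Fact lmul_subproof f g : exists a : int, vanish_below a (lmul_coef f g).
Proof.
have [a fa] := laurent_bound f; have [b gb] := laurent_bound g.
by exists (a + b); exact: lmul_vanish.
Qed.
Definition lmul f g : laurent R := Laurent (lmul_subproof f g).

(* The monomial c q^e. *)
Fact lmono_subproof (c : R) (e : int) :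
  exists a : int, vanish_below a (fun n => if n == e then c else 0).
Proof. by exists e => n /lt_eqF ->. Qed.
Definition lmono (c : R) (e : int) : laurent R := Laurent (lmono_subproof c e).

Lemma lmulC : commutative lmul.
Proof.
move=> f g; have [a fa] := laurent_bound f; have [b gb] := laurent_bound g.
apply: laurentP => n; have [nab|abn] := ltP n (a + b).
  by rewrite [LHS](lmul_vanish fa gb)// [RHS](lmul_vanish gb fa)// addrC.
have -> : n = a + b + (absz (n - a - b)%R)%:Z by lia.
set m := absz _; rewrite [LHS](lmul_coefE _ fa gb).
have -> : a + b + m%:Z = b + a + m%:Z by lia.
rewrite [RHS](lmul_coefE _ gb fa) (reindex_inj rev_ord_inj) /=.
apply: eq_bigr => k _; rewrite mulrC; congr (g _ * f _);
  by have := ltn_ord k; lia.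
Qed.

(* Associativity is inherited from polynomials by truncation. *)
Let trunc f (a : int) (n : nat) : {poly R} := \poly_(k < n.+1) f (a + k%:Z).

Let coef_trunc_mul f g a b n m : vanish_below a f -> vanish_below b g ->
  (m <= n)%N -> (trunc f a n * trunc g b n)`_m = lmul f g (a + b + m%:Z).
Proof.
move=> fa gb mn; rewrite [RHS](lmul_coefE _ fa gb) coefM.
apply: eq_bigr => k _; rewrite !coef_poly.
by have := ltn_ord k; do !case: ifP => //; lia.
Qed.

Let coef_mul_trunc (p p' s : {poly R}) n :
  (forall m, (m <= n)%N -> p`_m = p'`_m) -> (p * s)`_n = (p' * s)`_n.
Proof.
move=> pp; rewrite !coefM; apply: eq_bigr => k _; rewrite pp//.
by have := ltn_ord k; lia.
Qed.

Lemma lmulA : associative lmul.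
Proof.
move=> f g h; have [a fa] := laurent_bound f; have [b gb] := laurent_bound g.
have [c hc] := laurent_bound h; apply: laurentP => n.
have fgab : vanish_below (a + b) (lmul f g) := lmul_vanish fa gb.
have ghbc : vanish_below (b + c) (lmul g h) := lmul_vanish gb hc.
have [nabc|abcn] := ltP n (a + b + c).
  by rewrite [LHS](lmul_vanish fa ghbc) ?addrA// [RHS](lmul_vanish fgab hc).
have -> : n = a + (b + c) + (absz (n - a - b - c)%R)%:Z by lia.
set m := absz _; rewrite -[LHS](coef_trunc_mul fa ghbc (leqnn m)).
rewrite addrA -[RHS](coef_trunc_mul fgab hc (leqnn m)).
transitivity (trunc f a m * trunc g b m * trunc h c m)`_m.
  rewrite -mulrA (mulrC (trunc f a m)) (mulrC (trunc f a m)).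
  apply: coef_mul_trunc => k km.
  by rewrite (coef_trunc_mul gb hc km) coef_poly ifT.
apply: coef_mul_trunc => k km.
by rewrite (coef_trunc_mul fa gb km) coef_poly ifT.
Qed.

Lemma lmulDl : left_distributive lmul +%R.
Proof.
move=> f g h; have [a fa] := laurent_bound f; have [b gb] := laurent_bound g.
have [c hc] := laurent_bound h; pose d := Num.min a b.
have fd : vanish_below d f by apply: vanish_belowW fa; rewrite ge_min lexx.
have gd : vanish_below d g.
  by apply: vanish_belowW gb; rewrite ge_min lexx orbT.
have fgd : vanish_below d (f + g).
  by move=> n nd; rewrite coeflD fd// gd// addr0.
apply: laurentP => n; rewrite coeflD; have [nd|dn] := ltP n (d + c).
  rewrite [LHS](lmul_vanish fgd hc)// [lmul f h n](lmul_vanish fd hc)//.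
  by rewrite [lmul g h n](lmul_vanish gd hc)// addr0.
have -> : n = d + c + (absz (n - d - c)%R)%:Z by lia.
rewrite [LHS](lmul_coefE _ fgd hc) [lmul f h _](lmul_coefE _ fd hc).
rewrite [lmul g h _](lmul_coefE _ gd hc) -big_split /=.
by apply: eq_bigr => k _; rewrite mulrDl.
Qed.

Lemma lmonoM c e f n : lmul (lmono c e) f n = c * f (n - e).
Proof.
rewrite /= /lmul_coef (fsbigE [:: e])//=.
  by rewrite big_cons big_nil in_setT eqxx addr0.
by move=> i _; rewrite inE => /negPf ->; rewrite mul0r.
Qed.

Lemma lmul1 : left_id (lmono 1 0) lmul.
Proof. by move=> f; apply: laurentP => n; rewrite lmonoM mul1r subr0. Qed.

Lemma lone_neq0 : lmono 1 0 != 0.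
Proof.
apply/eqP => /(congr1 (fun f : laurent R => f 0)) /=.
by move/eqP; rewrite /lcoef /= oner_eq0.
Qed.

HB.instance Definition _ := GRing.Zmodule_isComNzRing.Build (laurent R)
  lmulA lmulC lmul1 lmulDl lone_neq0.

Lemma coeflM f g n : (f * g) n = \sum_(i \in [set: int]) f i * g (n - i).
Proof. by []. Qed.
Lemma coefl1 n : (1 : laurent R) n = (n == 0)%:R.
Proof. by rewrite [LHS]/=; case: eqP. Qed.

Definition lunit : pred (laurent R) := fun f => `[< exists g, g * f = 1 >].

Definition linv f : laurent R := if lunit f then xget 0 [set g | g * f = 1] else f.

Fact lmulV : {in lunit, left_inverse 1 linv *%R}.
Proof.
by move=> f fU; rewrite /linv ifT//; have /asboolP/xgetPex := fU; apply.
Qed.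
Fact lunitP f g : g * f = 1 -> lunit f.
Proof. by move=> gf; apply/asboolP; exists g. Qed.
Fact linv_out : {in [predC lunit], linv =1 id}.
Proof. by move=> f /negPf fU; rewrite /linv [lunit f]fU. Qed.

HB.instance Definition _ := GRing.ComNzRing_hasMulInverse.Build (laurent R)
  lmulV lunitP linv_out.

End LaurentRing.

Section LaurentUnits.
Variable R : comNzRingType.
Implicit Types f g h : laurent R.

Lemma coeflMn0 f g (n : nat) : vanish_below 0 f -> vanish_below 0 g ->
  (f * g) n%:Z = \sum_(k < n.+1) f k%:Z * g (n - k)%N%:Z.
Proof.
move=> f0 g0; rewrite -[n%:Z]add0r -[0 in LHS]addr0.
rewrite [LHS](lmul_coefE _ f0 g0).
by apply: eq_bigr => k _; rewrite !add0r.
Qed.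

Lemma vanish_belowM f g a b : vanish_below a f -> vanish_below b g ->
  vanish_below (a + b) (f * g).
Proof. exact: lmul_vanish. Qed.

Lemma vanish_below1 : vanish_below 0 (1 : laurent R).
Proof. by move=> n n0; rewrite coefl1 lt_eqF. Qed.

Lemma vanish_belowX f (n : nat) :
  vanish_below 1 f -> vanish_below n%:Z (f ^+ n).
Proof.
move=> f1; elim: n => [|n IH]; first exact: vanish_below1.
by rewrite exprS -addn1 PoszD addrC; exact: vanish_belowM.
Qed.

Lemma linv_coef0 f : vanish_below 0 f -> f 0 = 1 ->
  exists2 g : laurent R, vanish_below 0 g & f * g = 1.
Proof.
move=> f0 f01; pose h := 1 - f.
have h1 : vanish_below 1 h.
  move=> n n1; rewrite coeflB coefl1; have [->|n0] := eqVneq n 0.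
    by rewrite f01 subrr.
  by rewrite f0 ?subr0//; lia.
have hX k n : n < k%:Z -> (h ^+ k) n = 0 by exact: vanish_belowX.
pose gc (n : int) : R := if 0 <= n then \sum_(k < `|n|%N.+1) (h ^+ k) n else 0.
have gs : exists a : int, forall n, n < a -> gc n = 0.
  by exists 0 => n n0; rewrite /gc leNgt n0.
pose g : laurent R := Laurent gs.
have gE (m N : nat) : (m < N)%N -> g m%:Z = (\sum_(k < N) h ^+ k) m%:Z.
  move=> mN; rewrite coefl_sum /= /gc /=.
  rewrite -!(big_mkord predT (fun k => (h ^+ k) m%:Z)) (big_cat_nat (n := m.+1) _ mN) //=.
  rewrite [X in _ = _ + X]big1_seq ?addr0// => k /=.
  by rewrite mem_index_iota => mk; apply: hX; lia.
have g0 : vanish_below 0 g by move=> n n0; rewrite /= /gc leNgt n0.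
exists g => //.
apply: laurentP => n; have [n0|] := ltP n 0.
  by rewrite (vanish_below1 n0) (vanish_belowM f0 g0).
case: n => // n _; pose s := \sum_(k < n.+1) h ^+ k.
have s0 : vanish_below 0 s.
  move=> m m0; rewrite coefl_sum big1// => k _; apply: hX; lia.
have -> : (f * g) n%:Z = (f * s) n%:Z.
  rewrite !coeflMn0//; apply: eq_bigr => k _; rewrite (@gE _ n.+1)//.
  by rewrite ltnS leq_subr.
have -> : f * s = 1 - h ^+ n.+1 by rewrite -[in RHS](expr1n _ n.+1) subrXX
  /h opprB addrC subrK; congr (_ * _); apply: eq_bigr => k _;
  rewrite expr1n mul1r.
by rewrite coeflB hX ?subr0// ltz_nat.
Qed.

Lemma lunit_coef0 f : vanish_below 0 f -> f 0 = 1 -> f \is a GRing.unit.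
Proof.
by move=> f0 /(linv_coef0 f0)[g _ fg]; apply/unitrPr; exists g.
Qed.

Lemma vanish_belowV f : vanish_below 0 f -> f 0 = 1 -> vanish_below 0 (f^-1)%R.
Proof.
move=> f0 f1; have fU := lunit_coef0 f0 f1.
have [g g0 fg] := linv_coef0 f0 f1.
by have -> : (f^-1)%R = g by apply: (mulrI fU); rewrite divrr.
Qed.

Lemma coefl0M f g : vanish_below 0 f -> vanish_below 0 g ->
  (f * g) 0 = f 0 * g 0.
Proof. by move=> f0 g0; rewrite (coeflMn0 0) // big_ord1. Qed.

End LaurentUnits.

Section LaurentTopology.
Variable R : nzRingType.

(* Convergence in the q-adic topology: u L is congruent to l modulo q^(n+1)
   for L large. *)
Definition lcvg (u : nat -> laurent R) (l : laurent R) : Prop :=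
  forall n : int, \forall L \near \oo, forall m : int, m <= n -> u L m = l m.

Definition llim (u : nat -> laurent R) : laurent R := xget 0 [set l | lcvg u l].

(* l is the sum of the family (f i) for i in A: each power of q occurs, along
   with the lower ones, in finitely many terms only, and coefficients add up. *)
Definition is_lsum (I : choiceType) (A : set I) (f : I -> laurent R)
    (l : laurent R) : Prop :=
  forall n : int,
    finite_set [set i | A i /\ exists2 m : int, m <= n & f i m != 0] /\
    l n = \sum_(i \in A) f i n.

Definition lsum (I : choiceType) (A : set I) (f : I -> laurent R) : laurent R :=
  xget 0 [set l | is_lsum A f l].

Lemma lcvg_lim u l : lcvg u l -> llim u = l.
Proof.
move=> ul; apply: xget_unique => // l' ul'; apply: laurentP => n.
have [L [+ +]] : exists L, (forall m, m <= n -> u L m = l m) /\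
    (forall m, m <= n -> u L m = l' m).
  have [N _ hN] := ul n; have [N' _ hN'] := ul' n.
  by exists (maxn N N'); split; [apply: hN|apply: hN'] => /=; lia.
by move=> /(_ n (lexx n)) <- /(_ n (lexx n)) <-.
Qed.

Lemma is_lsum_lsum (I : choiceType) (A : set I) f l :
  is_lsum A f l -> lsum A f = l.
Proof.
move=> fl; apply: xget_unique => // l' fl'; apply: laurentP => n.
by rewrite (fl n).2 (fl' n).2.
Qed.

End LaurentTopology.

(* A family that is q-adically summable and uniformly bounded below has a sum,
   so that [lsum] does not return its default value. *)
Lemma summable_lsum (R : nzRingType) (I : choiceType) (A : set I)
    (f : I -> laurent R) (a : int) :
  (forall n : int,
    finite_set [set i | A i /\ exists2 m : int, m <= n & f i m != 0]) ->
  (forall i, A i -> vanish_below a (f i)) ->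
  is_lsum A f (lsum A f).
Proof.
move=> fin fa; apply: xgetPex.
have sa : exists a : int, forall n, n < a -> \sum_(i \in A) f i n = 0.
  by exists a => n na; apply: fsbig1 => i Ai; exact: fa.
by exists (Laurent sa) => n; split => //; exact: fin.
Qed.

(* Series in q whose coefficients are polynomials in z over int. *)
Definition q : laurent {poly int} := lmono 1 1.

Definition z : laurent {poly int} := lmono 'X 0.

Definition qpoch (a : laurent {poly int}) (L : nat) : laurent {poly int} :=
  \prod_(0 <= i < L) (1 - a * q ^+ i).

Definition qpoch_inf (a : laurent {poly int}) : laurent {poly int} :=
  llim (qpoch a).

(* An integer partition is the list of its nonzero parts; [part p j] is its
   (j+1)-st part, extended by zeros. *)
Definition is_partition (p : seq nat) : bool := sorted geq p && (0%N \notin p).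

Definition part (p : seq nat) (j : nat) : nat := nth 0%N p j.

(* Cyclically, the successor of index r - 1 is 0 ([ordS]). *)
Definition cylindric (r : nat) (c : r.-tuple nat) : set (r.-tuple (seq nat)) :=
  [set pi | (forall i : 'I_r, is_partition (tnth pi i)) /\
    forall (i : 'I_r) (j : nat),
      (part (tnth pi (ordS i)) (j + tnth c (ordS i)) <= part (tnth pi i) j)%N].

Definition weight (r : nat) (pi : r.-tuple (seq nat)) : nat :=
  (\sum_(i < r) \sum_(x <- tnth pi i) x)%N.

Definition maxpart (r : nat) (pi : r.-tuple (seq nat)) : nat :=
  (\max_(i < r) \max_(x <- tnth pi i) x)%N.

Definition Fc (r : nat) (c : r.-tuple nat) : laurent {poly int} :=
  lsum (cylindric c) (fun pi => z ^+ maxpart pi * q ^+ weight pi).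

Definition Hc (r : nat) (c : r.-tuple nat) : laurent {poly int} :=
  qpoch_inf (z * q) / qpoch_inf q * Fc c.

Definition S13_index : set (nat * nat * nat * nat * nat * nat) :=
  [set t | let: (r1, r2, r3, s1, s2, s3) := t in
    [&& r1 >= r2, r2 >= r3, s1 >= s2 & s2 >= s3]%N].

Definition S13_exponent (rho sigma : int * int * int)
    (t : nat * nat * nat * nat * nat * nat) : int :=
  let: (rho1, rho2, rho3) := rho in
  let: (sigma1, sigma2, sigma3) := sigma in
  let: (r1, r2, r3, s1, s2, s3) := t in
  let e (rho_i sigma_i : int) (r s : nat) : int :=
    r%:Z ^+ 2 - r%:Z * s%:Z + s%:Z ^+ 2 + rho_i * r%:Z + sigma_i * s%:Z in
  e rho1 sigma1 r1 s1 + e rho2 sigma2 r2 s2 + e rho3 sigma3 r3 s3.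

Definition S13_term (rho sigma : int * int * int)
    (t : nat * nat * nat * nat * nat * nat) : laurent {poly int} :=
  let: (r1, r2, r3, s1, s2, s3) := t in
  z ^+ r1 * q ^ S13_exponent rho sigma t /
    (qpoch q (r1 - r2) * qpoch q (r2 - r3) *
     qpoch q (s1 - s2) * qpoch q (s2 - s3) *
     qpoch q r3 * qpoch q s3 * qpoch q (r3 + s3 + 1)).

Definition S13 (rho sigma : int * int * int) : laurent {poly int} :=
  lsum S13_index (S13_term rho sigma).

(* The limits, inverses and sums in the definitions above exist. *)
Section QPochhammer.
Implicit Type a : laurent {poly int}.

Lemma vanish_below_q : vanish_below 1 q.
Proof. by move=> n n1 /=; rewrite lt_eqF. Qed.

Lemma vanish_below_qpoch a L : vanish_below 0 a -> vanish_below 0 (qpoch a L).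
Proof.
move=> a0; rewrite /qpoch; elim/big_rec: _ => [|i f _ f0].
  exact: vanish_below1.
have aq0 : vanish_below 0 (a * q ^+ i).
  rewrite -[0]addr0; apply: vanish_belowM => //.
  by apply: vanish_belowW (vanish_belowX (n := i) vanish_below_q).
rewrite -[0]addr0; apply: vanish_belowM => // n n0.
by rewrite coeflB vanish_below1// aq0// subr0.
Qed.

Lemma qpochS a L : qpoch a L.+1 = qpoch a L - qpoch a L * (a * q ^+ L).
Proof. by rewrite /qpoch big_nat_recr //= mulrBr mulr1. Qed.

Lemma coefl_qpochS a L n : vanish_below 0 a -> n < L%:Z ->
  qpoch a L.+1 n = qpoch a L n.
Proof.
move=> a0 nL; rewrite qpochS coeflB.
have aqL := vanish_belowM a0 (vanish_belowX (n := L) vanish_below_q).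
have := vanish_belowM (vanish_below_qpoch L a0) aqL.
by move=> ->; rewrite ?subr0 ?add0r.
Qed.

Lemma lcvg_qpoch a : vanish_below 0 a -> lcvg (qpoch a) (qpoch_inf a).
Proof.
move=> a0; apply: xgetPex.
have stable (L N : nat) n : n < N%:Z -> (N <= L)%N -> qpoch a L n = qpoch a N n.
  move=> nN; elim: L => [|L IH]; first by rewrite leqn0 => /eqP ->.
  rewrite leq_eqVlt => /orP[/eqP <-//|NL].
  by rewrite coefl_qpochS ?IH//; lia.
have ls : exists b : int, forall n, n < b -> qpoch a `|n|%N.+1 n = 0.
  by exists 0 => n n0; apply: vanish_below_qpoch.
exists (Laurent ls) => n; exists `|n|%N.+1 => // L /= nL m mn.
have [m0|m0] := ltP m 0; first by rewrite !vanish_below_qpoch.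
apply: stable; lia.
Qed.

Lemma coefl0_qpoch a L : vanish_below 1 a -> qpoch a L 0 = 1.
Proof.
move=> a1; elim: L => [|L IH]; first by rewrite /qpoch big_geq// coefl1.
rewrite qpochS coeflB [X in X - _]IH.
have aL : vanish_below 1 (a * q ^+ L).
  apply: (vanish_belowW (b := 1 + L%:Z)); first by rewrite lerDl.
  exact: (vanish_belowM a1 (vanish_belowX (n := L) vanish_below_q)).
have := vanish_belowM (vanish_below_qpoch L (vanish_belowW ler01 a1)) aL.
by move=> ->//; rewrite subr0.
Qed.

Lemma qpoch_unit L : qpoch q L \is a GRing.unit.
Proof.
apply: lunit_coef0; last exact: coefl0_qpoch vanish_below_q.
exact: vanish_below_qpoch (vanish_belowW ler01 vanish_below_q).
Qed.

Lemma qpoch_inf_unit : qpoch_inf q \is a GRing.unit.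
Proof.
have q0 := vanish_belowW ler01 vanish_below_q.
apply: lunit_coef0 => [n n0|].
  have [N _ /(_ N (leqnn N) n (lexx n)) <-] := lcvg_qpoch q0 n.
  exact: vanish_below_qpoch.
have [N _ /(_ N (leqnn N) 0 (lexx 0)) <-] := lcvg_qpoch q0 0.
exact: coefl0_qpoch vanish_below_q.
Qed.

Lemma q_unit : q \is a GRing.unit.
Proof.
apply/unitrPr; exists (lmono 1 (- 1)); apply: laurentP => n.
by rewrite lmonoM mul1r coefl1 /=; case: eqP; case: eqP => //; lia.
Qed.

End QPochhammer.

Lemma vanish_below_zM (r : nat) (b : int) (f : laurent {poly int}) :
  vanish_below b f -> vanish_below b (z ^+ r * f).
Proof.
move=> fb; elim: r => [|r IH]; first by rewrite expr0 mul1r.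
by rewrite exprS -mulrA => n nb; rewrite lmonoM subr0 IH// mulr0.
Qed.

Lemma Fc_summable (r : nat) (c : r.-tuple nat) :
  is_lsum (cylindric c) (fun pi => z ^+ maxpart pi * q ^+ weight pi) (Fc c).
Proof.
have low pi : vanish_below (weight pi)%:Z (z ^+ @maxpart r pi * q ^+ weight pi).
  exact: vanish_below_zM (vanish_belowX vanish_below_q).
apply: (@summable_lsum _ _ _ _ 0) => [n|pi _]; last exact: vanish_belowW (low pi).
pose N := `|n|%N.+1.
pose g (u : {ffun 'I_r -> N.-bseq 'I_N}) : r.-tuple (seq nat) :=
  [tuple map (@nat_of_ord N) (u i) | i < r].
apply: (@sub_finite_set _ _ (g @` setT)); last exact/finite_image/finite_finset.
move=> pi [[pip _] [m mn pim]].
have wn : (weight pi < N)%N.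
  by rewrite ltnNge; apply: contra pim => Nw; apply/eqP/low; lia.
have parts i : (\sum_(x <- tnth pi i) x < N)%N.
  by apply: leq_ltn_trans wn; rewrite /weight (bigD1 i)//= leq_addr.
have szs i : (size (map (@inord `|n|%N) (tnth pi i)) <= N)%N.
  rewrite size_map; apply: leq_trans (ltnW (parts i)).
  have /andP[_ p0] := pip i; rewrite -sum1_size big_seq [leqRHS]big_seq.
  by apply: leq_sum => x xp; rewrite lt0n; apply: contraNneq p0 => <-.
exists [ffun i => Bseq (szs i)] => //; apply: eq_from_tnth => i.
rewrite tnth_mktuple ffunE /= -map_comp map_id_in// => x xp /=.
rewrite inordK//; apply: leq_ltn_trans (parts i).
by rewrite (big_rem x)//= leq_addr.
Qed.

Lemma vanish_below_expz (e : int) : vanish_below e (q ^ e).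
Proof.
suff -> : q ^ e = lmono 1 e by move=> n ne /=; rewrite lt_eqF.
have qn (n : nat) : q ^+ n = lmono 1 n%:Z.
  elim: n => // n IH; rewrite exprS IH; apply: laurentP => m.
  by rewrite lmonoM mul1r /=; congr (if _ then _ else _); lia.
case: e => n; first exact: qn.
rewrite NegzE -exprnN; apply: (mulrI (unitrX n.+1 q_unit)).
rewrite divrr ?unitrX ?q_unit// qn; apply: laurentP => m.
rewrite coefl1 [RHS]lmonoM mul1r /=.
by have -> : (m - n.+1%:Z == - n.+1%:Z) = (m == 0); [lia|case: eqP].
Qed.

Lemma S13_exponent_ge rho sigma : exists C : int,
  forall r1 r2 r3 s1 s2 s3 : nat,
    (r1 + r2 + r3 + s1 + s2 + s3)%N%:Z <=
    S13_exponent rho sigma (r1, r2, r3, s1, s2, s3) + C.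
Proof.
case: rho sigma => [[x1 x2] x3] [[y1 y2] y3].
have pair (x y : int) : exists C : int, forall r s : nat,
    r%:Z + s%:Z <= r%:Z ^+ 2 - r%:Z * s%:Z + s%:Z ^+ 2 + x * r%:Z + y * s%:Z + C.
  exists ((x - 1) ^+ 2 + (y - 1) ^+ 2) => r s.
  rewrite -subr_ge0 -(pmulr_rge0 _ (ltr0n int 2)).
  set A := r%:Z; set B := s%:Z.
  have -> : 2%:R * (A ^+ 2 - A * B + B ^+ 2 + x * A + y * B
      + ((x - 1) ^+ 2 + (y - 1) ^+ 2) - (A + B)) =
    (A - B) ^+ 2 + (A + (x - 1)) ^+ 2 + (B + (y - 1)) ^+ 2
    + (x - 1) ^+ 2 + (y - 1) ^+ 2 by ring.
  by rewrite !addr_ge0// sqr_ge0.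
have [C1 h1] := pair x1 y1; have [C2 h2] := pair x2 y2.
have [C3 h3] := pair x3 y3; exists (C1 + C2 + C3) => r1 r2 r3 s1 s2 s3 /=.
by have := h1 r1 s1; have := h2 r2 s2; have := h3 r3 s3; lia.
Qed.

Lemma S13_summable rho sigma :
  is_lsum S13_index (S13_term rho sigma) (S13 rho sigma).
Proof.
have [C hC] := S13_exponent_ge rho sigma.
have low t : vanish_below (S13_exponent rho sigma t) (S13_term rho sigma t).
  case: t => [[[[[r1 r2] r3] s1] s2] s3]; rewrite /S13_term.
  apply: (@vanish_belowW _ _ (S13_exponent rho sigma (r1, r2, r3, s1, s2, s3) + 0)).
    by rewrite addr0.
  apply: vanish_belowM.
    exact: vanish_below_zM (@vanish_below_expz _).
  have q0 := vanish_belowW ler01 vanish_below_q.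
  have [+ +] : let d := qpoch q (r1 - r2) * qpoch q (r2 - r3) *
      qpoch q (s1 - s2) * qpoch q (s2 - s3) * qpoch q r3 * qpoch q s3 *
      qpoch q (r3 + s3 + 1) in vanish_below 0 d /\ d 0 = 1.
    have M (u v : laurent {poly int}) : vanish_below 0 u /\ u 0 = 1 ->
        vanish_below 0 v /\ v 0 = 1 ->
        vanish_below 0 (u * v) /\ (u * v) 0 = 1.
      move=> [u0 u1] [v0 v1]; rewrite coefl0M// u1 v1 mulr1; split => //.
      by have := @vanish_belowM _ u v 0 0 u0 v0; rewrite addr0.
    have Q n : vanish_below 0 (qpoch q n) /\ qpoch q n 0 = 1.
      split; first exact: vanish_below_qpoch.
      exact: coefl0_qpoch vanish_below_q.
    exact: (M _ _ (M _ _ (M _ _ (M _ _ (M _ _ (M _ _ (Q _) (Q _)) (Q _)) (Q _))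
      (Q _)) (Q _)) (Q _)).
  exact: vanish_belowV.
apply: (@summable_lsum _ _ _ _ (- C)) => [n|t _]; last first.
  apply: vanish_belowW (low t).
  case: t => [[[[[r1 r2] r3] s1] s2] s3]; rewrite -subr_ge0 opprK.
  exact: le_trans (hC r1 r2 r3 s1 s2 s3).
pose N := `|(n + C)%R|%N.+1.
pose g (u : 'I_N * 'I_N * 'I_N * 'I_N * 'I_N * 'I_N) :
    nat * nat * nat * nat * nat * nat :=
  let: (r1, r2, r3, s1, s2, s3) := u in
  (r1 : nat, r2 : nat, r3 : nat, s1 : nat, s2 : nat, s3 : nat).
apply: (@sub_finite_set _ _ (g @` setT)); last exact/finite_image/finite_finset.
move=> t [_ [m mn tm]].
have en : S13_exponent rho sigma t <= n.
  by rewrite leNgt; apply: contra tm => nt; apply/eqP/low/(le_lt_trans mn).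
case: t en {tm} => [[[[[r1 r2] r3] s1] s2] s3] en.
have bd := hC r1 r2 r3 s1 s2 s3.
exists (inord r1, inord r2, inord r3, inord s1, inord s2, inord s3) => //=.
by rewrite !inordK//; lia.
Qed.

(* Main.v *)
From HB Require Import structures.
Require Import Defs.
From mathcomp Require Import all_boot all_order all_algebra.
From mathcomp Require Import finmap all_classical.
From mathcomp Require Import zify ring.

(* Removing the largest parts of a cylindric partition gives the recurrence of
   Corteel and Welsh, an inclusion-exclusion over the nonempty sets J of rows
   with nonzero profile entry.  For H_c it reads
     H_c(z) = sum_J (-1)^(|J|-1) (zq; q)_(|J|-1) H_(c(J))(z q^|J|),
   and, H being invariant under rotation of the profile, this is a closed system
   for the twenty-two profiles of the theorem.  Comparing coefficients of z, then
   of q, its solution is determined by the coefficients of z^0, all equal to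
   1/(q; q)_oo; for the sums this value is an iterated q-Vandermonde summation.

   It remains that the right-hand sides solve the same system.  Multiplying the
   summand of S13 by 1 - q^(r_i - r_(i+1)), where r_4 = 0 and the last factor is
   completed by 1 - q^(r_3 + s_3 + 1), cancels factors of the denominator; a shift
   of the summation indices then gives a linear relation between the sums
   S13(rho | sigma), and similarly for the s_i.  Ten of the twenty-two equations
   hold identically after substitution of the right-hand sides, and each of the
   others is an explicit combination, with coefficients polynomial in z, q and
   1/q, of such relations and of other equations with z replaced by z q^n (for two
   of the equations, after multiplication by 1 - z or 1 - zq).  The lists cert_*
   give these combinations; they were found by linear algebra. *)

Set Implicit Arguments.
Unset Strict Implicit.
Unset Printing Implicit Defensive.

Import Order.TTheory GRing.Theory Num.Theory.

Local Open Scope ring_scope.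

(** * q-adic summation *)

(** The profiles are all triples of sum 10 up to rotation: there are 66 triples, no nontrivial
    rotation fixes one since 3 does not divide 10, and c(J) has the same sum as c. Infinite sums are
    known only through [is_lsum], so each manipulation of a series is a statement about [is_lsum]
    followed by uniqueness. The obstacle on the side of the sums is that z -> z/q is not an
    operation on series in q with coefficients polynomial in z, whereas two certificates use an
    equation at z/q or z/q^2. On S13 the substitution merely changes rho_1 by an integer, so the
    work is done with formal combinations of symbols S13(rho | sigma), where it makes sense for
    every integer power of q; an equation counts as established when all its shifts hold. Equality
    of combinations is tested by collecting symbols as though the sums were independent, which is
    sufficient. Finally 1 - z is not invertible but regular, so an equation can be recovered from
    its product with 1 - z. *)

Section Summation.
Variables (R : comNzRingType) (I : choiceType).
Implicit Types (A : set I) (f g : I -> laurent R) (l : laurent R).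

Lemma vanish_below_sum (s : seq I) (P : pred I) f a :
  (forall i, i \in s -> P i -> vanish_below a (f i)) ->
  vanish_below a (\sum_(i <- s | P i) f i).
Proof.
move=> fa n na; rewrite coefl_sum big_seq_cond big1// => i /andP[si Pi].
exact: fa.
Qed.

Lemma vanish_belowD (a : int) (u v : laurent R) :
  vanish_below a u -> vanish_below a v -> vanish_below a (u + v).
Proof. by move=> ua va n na; rewrite coeflD ua// va// addr0. Qed.

Lemma vanish_belowN (a : int) (u : laurent R) :
  vanish_below a u -> vanish_below a (- u).
Proof. by move=> ua n na; rewrite coeflN ua// oppr0. Qed.

Lemma vanish_belowB (a : int) (u v : laurent R) :
  vanish_below a u -> vanish_below a v -> vanish_below a (u - v).
Proof. by move=> ua va; apply: vanish_belowD => //; apply: vanish_belowN. Qed.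

(** Turns the coefficientwise definition into approximation by finite partial sums modulo q^n;
    closure properties then reduce to choosing a suitable finite list of indices. *)
Lemma is_lsumP A f l : is_lsum A f l <->
  forall n : int, exists s : seq I, [/\ uniq s, forall i, i \in s -> A i,
    forall i, A i -> i \notin s -> vanish_below n (f i) &
    vanish_below n (l - \sum_(i <- s) f i)].
Proof.
split=> [fl n|fl n].
  have [/finite_seqP[s Es] _] := fl n.
  have sE i : (i \in undup s) = `[< A i /\ exists2 m, m <= n & f i m != 0 >].
    rewrite mem_undup; apply/idP/asboolP => [si|Ai].
      by have : [set` s]%classic i by []; rewrite -Es.
    by have : [set` s]%classic i by rewrite -Es.
  have fs i : A i -> i \notin undup s -> vanish_below n (f i).
    move=> Ai; rewrite sE => /asboolPn nAi m mn; apply/eqP/negPn/negP => fim.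
    by apply: nAi; split => //; exists m => //; apply: ltW.
  exists (undup s); split => //; first exact: undup_uniq.
    by move=> i; rewrite sE => /asboolP[].
  move=> m mn; rewrite coeflB coefl_sum; apply/eqP; rewrite subr_eq0; apply/eqP.
  rewrite (fl m).2 (fsbigE (undup s)) ?undup_uniq//.
  - rewrite big_mkcond big_seq [RHS]big_seq; apply: eq_bigr => i.
    by rewrite sE => /asboolP[Ai _]; rewrite mem_set.
  - by move=> i /=; rewrite sE => /asboolP[].
  - by move=> i Ai si; apply: fs.
(* [vanish_below] is strict whereas [is_lsum] speaks of the powers up to and including n, hence
   precision n + 1. *)
have [s [us sA fs ls]] := fl (n + 1); split.
  apply: (@sub_finite_set _ _ [set` s]%classic); last exact: finite_seq.
  move=> i /= [Ai [m mn]]; apply: contraR => si.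
  by rewrite (fs i Ai si)//; lia.
have := ls n; rewrite coeflB coefl_sum => /(_ _)/eqP; rewrite subr_eq0 => lE.
rewrite (eqP (lE _)); last lia.
rewrite (fsbigE s)//; first 1 last.
- by move=> i Ai si; rewrite (fs i Ai si)//; lia.
rewrite [RHS]big_mkcond big_seq [RHS]big_seq; apply: eq_bigr => i si.
by rewrite mem_set//; apply: sA.
Qed.

Lemma is_lsum_unique A f l l' : is_lsum A f l -> is_lsum A f l' -> l = l'.
Proof. by move=> fl fl'; apply: laurentP => n; rewrite (fl n).2 (fl' n).2. Qed.

Lemma eq_is_lsum A f g l : (forall i, A i -> f i = g i) ->
  is_lsum A f l -> is_lsum A g l.
Proof.
move=> fg /is_lsumP fl; apply/is_lsumP => n; have [s [us sA fs ls]] := fl n.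
exists s; split => //; first by move=> i Ai; rewrite -fg//; apply: fs.
move=> m mn; rewrite -(ls m mn) !coeflB !coefl_sum; congr (_ - _).
by rewrite big_seq [RHS]big_seq; apply: eq_bigr => i /sA/fg->.
Qed.

Lemma is_lsumD A f g l k : is_lsum A f l -> is_lsum A g k ->
  is_lsum A (fun i => f i + g i) (l + k).
Proof.
move=> /is_lsumP fl /is_lsumP gk; apply/is_lsumP => n.
have [s [us sA fs ls]] := fl n; have [t [ut tA gt kt]] := gk n.
pose r := undup (s ++ t).
have rE i : (i \in r) = (i \in s) || (i \in t) by rewrite mem_undup mem_cat.
(* Enlarging a sufficient list [u] only adds terms that vanish below n, so both partial sums may be
   taken over the common list [r]. *)
have rsum (h : I -> laurent R) (u : seq I) : uniq u ->
    {subset u <= r} -> (forall i, A i -> i \notin u -> vanish_below n (h i)) ->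
    vanish_below n (\sum_(i <- r) h i - \sum_(i <- u) h i).
  move=> uu ur hu.
  have -> : \sum_(i <- u) h i = \sum_(i <- r | i \in u) h i.
    rewrite -[RHS]big_filter; apply: perm_big; apply: uniq_perm => //.
      by rewrite filter_uniq// undup_uniq.
    by move=> i; rewrite mem_filter; case: (boolP (i \in u)) => // /ur->.
  rewrite (bigID (mem u)) [X in X - _]addrC addrK.
  apply: vanish_below_sum => i; rewrite rE => /orP ri iu; apply: hu => //.
  by case: ri; [exact: sA|exact: tA].
exists r; split; first exact: undup_uniq.
- by move=> i; rewrite rE => /orP[]; [exact: sA|exact: tA].
- move=> i Ai; rewrite rE negb_or => /andP[si ti].
  by apply: vanish_belowD; [exact: fs|exact: gt].
- rewrite big_split.
  have -> : l + k - (\sum_(i <- r) f i + \sum_(i <- r) g i) =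
    (l - \sum_(i <- s) f i) + (k - \sum_(i <- t) g i)
    - (\sum_(i <- r) f i - \sum_(i <- s) f i)
    - (\sum_(i <- r) g i - \sum_(i <- t) g i).
    by ring.
  apply: vanish_belowB; last by apply: rsum => // i it; rewrite rE it orbT.
  apply: vanish_belowB; last by apply: rsum => // i is_; rewrite rE is_.
  exact: vanish_belowD.
Qed.

Lemma is_lsum0 A : is_lsum A (fun=> 0 : laurent R) 0.
Proof.
apply/is_lsumP => n; exists [::]; split => // i _.
by rewrite big_nil subrr.
Qed.

Lemma is_lsum_restrict A B f l : (forall i, B i -> A i) ->
  (forall i, A i -> ~ B i -> f i = 0) -> is_lsum A f l -> is_lsum B f l.
Proof.
move=> BA f0 /is_lsumP fl; apply/is_lsumP => n; have [s [us sA fs ls]] := fl n.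
exists [seq i <- s | `[< B i >]]; split.
- exact: filter_uniq.
- by move=> i; rewrite mem_filter => /andP[/asboolP].
- move=> i Bi; rewrite mem_filter negb_and => /orP[/asboolPn//|si].
  by apply: fs => //; apply: BA.
- suff -> : \sum_(i <- [seq i <- s | `[< B i >]]) f i = \sum_(i <- s) f i by [].
  rewrite big_filter big_mkcond big_seq [RHS]big_seq.
  by apply: eq_bigr => i /sA Ai; case: asboolP => // /(f0 _ Ai) ->.
Qed.

End Summation.

(** Reindexing along an injection whose image may miss indices carrying a zero term. Shifts of the
    indices of S13 and the addition of parts to a cylindric partition both take this form. *)
Lemma is_lsum_image (R : comNzRingType) (I J : choiceType) (A : set I)
    (B : set J) (f : I -> laurent R) (g : J -> laurent R) (h : J -> I) l :
  (forall j, B j -> A (h j)) ->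
  (forall j j', B j -> B j' -> h j = h j' -> j = j') ->
  (forall j, B j -> f (h j) = g j) ->
  (forall i, A i -> (forall j, B j -> h j <> i) -> f i = 0) ->
  is_lsum B g l -> is_lsum A f l.
Proof.
move=> BA hI fg f0 /is_lsumP gl; apply/is_lsumP => n.
have [s [us sB gs ls]] := gl n; exists (map h s); split.
- rewrite map_inj_in_uniq// => i j /sB Bi /sB Bj.
  exact: hI.
- by move=> i /mapP[j /sB Bj ->]; apply: BA.
- move=> i Ai hi; case: (pselect (exists2 j, B j & h j = i)) => [[j Bj hj]|nj].
    rewrite -hj fg//; apply: gs => //; apply: contra hi => js.
    by rewrite -hj map_f.
  by rewrite f0// => j Bj hj; apply: nj; exists j.
- suff -> : \sum_(i <- map h s) f i = \sum_(j <- s) g j by [].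
  by rewrite big_map big_seq [RHS]big_seq; apply: eq_bigr => j /sB/fg.
Qed.

Lemma is_lsum_fibers (R : comNzRingType) (I J : choiceType) (A : set I)
    (B : set J) (f : I -> laurent R) (p : I -> J) (fib : J -> seq I) l :
  (forall i, A i -> B (p i)) -> (forall j, uniq (fib j)) ->
  (forall i j, B j -> i \in fib j <-> A i /\ p i = j) ->
  is_lsum A f l -> is_lsum B (fun j => \sum_(i <- fib j) f i) l.
Proof.
move=> AB ufib fibP /is_lsumP fl; apply/is_lsumP => n.
have [s [us sA fs ls]] := fl n; exists (undup (map p s)); split.
- exact: undup_uniq.
- by move=> j; rewrite mem_undup => /mapP[i /sA/AB Bi ->].
- move=> j Bj; rewrite mem_undup => js; apply: vanish_below_sum => i.
  move=> /fibP-/(_ Bj)[Ai pij] _; apply: fs => //; apply: contra js => si.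
  by rewrite -pij map_f.
- set S := \sum_(j <- _) _.
  have SE : vanish_below n (S - \sum_(i <- s) f i).
    have -> : \sum_(i <- s) f i =
        \sum_(j <- undup (map p s)) \sum_(i <- s | p i == j) f i.
      rewrite (exchange_big_dep xpredT)//=.
      rewrite big_seq [RHS]big_seq; apply: eq_bigr => i si.
      rewrite (big_rem (p i)) ?mem_undup ?map_f//= eqxx.
      rewrite big1_seq ?addr0// => j /andP[/eqP<-].
      by rewrite mem_rem_uniq ?undup_uniq// !inE eqxx.
    rewrite /S -sumrB; apply: vanish_below_sum => j.
    rewrite mem_undup => /mapP[i0 /sA/AB Bj j_def] _; rewrite -j_def in Bj.
    (* The part of the fibre inside [s] cancels; the other indices of the fibre carry terms that
       vanish below n. *)
    rewrite (bigID (mem s)).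
    have -> : \sum_(i <- s | p i == j) f i = \sum_(i <- fib j | i \in s) f i.
      rewrite -[LHS]big_filter -[RHS]big_filter; apply: perm_big.
      apply: uniq_perm; rewrite ?filter_uniq// => i; rewrite !mem_filter.
      case: (boolP (i \in s)) => [si|]; rewrite ?andbF//= andbT.
      apply/eqP/idP => [pij|/fibP-/(_ Bj)[]//].
      by apply/fibP => //; split => //; apply: sA.
    rewrite [X in X - _]addrC addrK; apply: vanish_below_sum => i.
    by move=> /fibP-/(_ Bj)[Ai _]; apply: fs.
  have -> : l - S = (l - \sum_(i <- s) f i) - (S - \sum_(i <- s) f i).
    by rewrite opprB addrA subrK.
  exact: vanish_belowB.
Qed.

Lemma is_lsum_sum_seq (R : comNzRingType) (T : choiceType) (A : set T)
    (I : Type) (s : seq I) (P : pred I) (f : I -> T -> laurent R) l :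
  (forall i, P i -> is_lsum A (f i) (l i)) ->
  is_lsum A (fun t => \sum_(i <- s | P i) f i t) (\sum_(i <- s | P i) l i).
Proof.
move=> fl; elim: s => [|i s IH].
  rewrite big_nil; apply: eq_is_lsum (is_lsum0 _ _) => t _.
  by rewrite big_nil.
rewrite big_cons; case: (boolP (P i)) => Pi.
  apply: eq_is_lsum (is_lsumD (fl i Pi) IH) => t _.
  by rewrite big_cons Pi.
apply: eq_is_lsum IH => t _; by rewrite big_cons (negPf Pi).
Qed.

(** * Coefficients of z and the substitution z -> zq *)

(** Continuity at 0 for the q-adic topology; for additive maps this suffices to commute with
    infinite sums. *)
Definition lcontinuous (R R' : nzRingType) (L : laurent R -> laurent R') :=
  forall n : int, exists n' : int, forall f : laurent R,
    vanish_below n' f -> vanish_below n (L f).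

Lemma is_lsum_map (R R' : comNzRingType) (I : choiceType) (A : set I)
    (L : laurent R -> laurent R') f l :
  zmod_morphism L -> lcontinuous L -> is_lsum A f l ->
  is_lsum A (fun i => L (f i)) (L l).
Proof.
move=> LB Lc /is_lsumP fl; apply/is_lsumP => n; have [n' Ln] := Lc n.
have [s [us sA fs ls]] := fl n'; exists s; split => //.
  by move=> i Ai si; apply/Ln/fs.
have L0 : L 0 = 0 by rewrite -(subrr 0) LB subrr.
have LD : {morph L : x y / x + y}.
  by move=> x y; rewrite -{1}[y]opprK LB -{1}[- y]sub0r LB L0 sub0r opprK.
by rewrite -(big_morph L LD L0) -LB; apply: Ln.
Qed.

Lemma lcontinuous_mul (R : comNzRingType) (c : laurent R) :
  lcontinuous ( *%R c).
Proof.
move=> n; have [a ca] := laurent_bound c; exists (n - a) => f fna.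
by rewrite -(subrK a n) addrC; apply: vanish_belowM.
Qed.

Lemma is_lsumM (R : comNzRingType) (I : choiceType) (A : set I) (c : laurent R)
    f l : is_lsum A f l -> is_lsum A (fun i => c * f i) (c * l).
Proof.
apply: is_lsum_map; last exact: lcontinuous_mul.
by move=> u v; rewrite mulrBr.
Qed.

Lemma is_lsumB (R : comNzRingType) (I : choiceType) (A : set I)
    (f g : I -> laurent R) l k : is_lsum A f l -> is_lsum A g k ->
  is_lsum A (fun i => f i - g i) (l - k).
Proof.
move=> fl /(@is_lsumM _ _ _ (-1)) gk; rewrite -mulN1r.
apply: eq_is_lsum (is_lsumD fl gk) => i _; by rewrite mulN1r.
Qed.

Lemma lmonoD (R : comNzRingType) (c d : R) e : lmono (c + d) e = lmono c e + lmono d e.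
Proof.
by apply: laurentP => n; rewrite coeflD /=; case: eqP; rewrite ?addr0.
Qed.

Lemma lmonoMM (R : comNzRingType) (c d : R) e e' :
  lmono c e * lmono d e' = lmono (c * d) (e + e').
Proof.
apply: laurentP => n; rewrite [LHS]lmonoM /= subr_eq [e' + e]addrC.
by case: eqP; rewrite ?mulr0.
Qed.

Lemma lmonoX (R : comNzRingType) (c : R) e n :
  lmono c e ^+ n = lmono (c ^+ n) (e * n%:Z).
Proof.
elim: n => [|n IH]; first by rewrite mulr0 !expr0.
by rewrite !exprS IH lmonoMM; congr lmono; lia.
Qed.

Section ZCoefficient.
Variable R : comNzRingType.
Implicit Types f g : laurent {poly R}.

Fact zcoef_subproof k f : exists a : int, vanish_below a (fun n => (f n)`_k).
Proof.
by have [a fa] := laurent_bound f; exists a => n /fa ->; rewrite coef0.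
Qed.
Definition zcoef k f : laurent R := Laurent (zcoef_subproof k f).

Lemma zcoefE k f n : zcoef k f n = (f n)`_k. Proof. by []. Qed.

Fact zcoef_is_zmod_morphism k : zmod_morphism (zcoef k).
Proof.
by move=> f g; apply: laurentP => n; rewrite zcoefE !coeflB coefB.
Qed.
HB.instance Definition _ k := GRing.isZmodMorphism.Build
  (laurent {poly R}) (laurent R) (zcoef k) (zcoef_is_zmod_morphism k).

Lemma zcoefB k f g : zcoef k (f - g) = zcoef k f - zcoef k g.
Proof. exact: raddfB. Qed.

Lemma zcoefD k f g : zcoef k (f + g) = zcoef k f + zcoef k g.
Proof. exact: raddfD. Qed.

Lemma zcoef_sum k (I : Type) (r : seq I) (P : pred I) (F : I -> laurent {poly R}) :
  zcoef k (\sum_(i <- r | P i) F i) = \sum_(i <- r | P i) zcoef k (F i).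
Proof. exact: raddf_sum. Qed.

Lemma zcoefP f g : (forall k, zcoef k f = zcoef k g) -> f = g.
Proof.
move=> fg; apply: laurentP => n; apply/polyP => k.
by have /(congr1 (fun l : laurent R => l n)) := fg k; rewrite !zcoefE.
Qed.

Lemma vanish_below_zcoef k f a :
  vanish_below a f -> vanish_below a (zcoef k f).
Proof. by move=> fa n na; rewrite zcoefE fa// coef0. Qed.

Lemma zcoef_continuous k : lcontinuous (zcoef k).
Proof. by move=> n; exists n => f; exact: vanish_below_zcoef. Qed.

Lemma zcoefM k f g :
  zcoef k (f * g) = \sum_(i < k.+1) zcoef i f * zcoef (k - i) g.
Proof.
have [a fa] := laurent_bound f; have [b gb] := laurent_bound g.
apply: laurentP => n; rewrite zcoefE coefl_sum.
have [nab|abn] := ltP n (a + b).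
  rewrite (vanish_belowM fa gb)// coef0 big1// => i _.
  by apply: vanish_belowM nab; apply: vanish_below_zcoef.
have -> : n = a + b + (absz (n - a - b)%R)%:Z by lia.
set m := absz _; rewrite [(f * g) _](lmul_coefE m fa gb) coef_sum.
transitivity (\sum_(i < k.+1) \sum_(j < m.+1)
    zcoef i f (a + j%:Z) * zcoef (k - i) g (b + (m - j)%N%:Z)).
  by rewrite exchange_big /=; apply: eq_bigr => j _; rewrite coefM.
apply: eq_bigr => i _; symmetry.
exact: (lmul_coefE m (vanish_below_zcoef i fa) (vanish_below_zcoef (k - i) gb)).
Qed.

Lemma zcoef_lmono k (c : {poly R}) e : zcoef k (lmono c e) = lmono c`_k e.
Proof.
by apply: laurentP => n; rewrite zcoefE /=; case: eqP; rewrite ?coef0.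
Qed.

(** The coefficient of q^n in f(zq) collects, for each k, the coefficient of z^k q^(n-k) in f. It is
    a polynomial in z because f vanishes below some [a], which forces k <= n - a; for z/q this bound
    is lost. *)
Fact zshift_subproof f : exists g, forall k,
  zcoef k g = lmono 1 k%:Z * zcoef k f.
Proof.
have [a fa] := laurent_bound f.
pose h (n : int) := \poly_(k < `|n - a|%N.+1) (f (n - k%:Z))`_k.
have ha : exists a : int, vanish_below a h.
  exists a => n na; apply/polyP => k; rewrite coef_poly coef0.
  by case: ifP => // _; rewrite fa ?coef0//; lia.
exists (Laurent ha) => k; apply: laurentP => n; rewrite lmonoM mul1r !zcoefE /=.
rewrite coef_poly; case: ifP => // kn; rewrite fa ?coef0//; lia.
Qed.

(* The substitution z -> zq. *)
Definition zshift f : laurent {poly R} := projT1 (cid (zshift_subproof f)).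

Lemma zcoef_zshift k f : zcoef k (zshift f) = lmono 1 k%:Z * zcoef k f.
Proof. exact: projT2 (cid (zshift_subproof f)) k. Qed.

Fact zshift_is_zmod_morphism : zmod_morphism zshift.
Proof.
by move=> f g; apply: zcoefP => k; rewrite zcoefB !zcoef_zshift zcoefB mulrBr.
Qed.
HB.instance Definition _ := GRing.isZmodMorphism.Build
  (laurent {poly R}) (laurent {poly R}) zshift zshift_is_zmod_morphism.

Fact zshift_is_monoid_morphism : monoid_morphism zshift.
Proof.
split; last first.
  move=> f g; apply: zcoefP => k; rewrite zcoef_zshift !zcoefM mulr_sumr.
  apply: eq_bigr => i _; rewrite !zcoef_zshift mulrACA; congr (_ * _).
  by rewrite lmonoMM mulr1; congr lmono; have := ltn_ord i; lia.
apply: zcoefP => k; rewrite zcoef_zshift zcoef_lmono coef1.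
rewrite lmonoMM mul1r addr0; case: k => //= k.
by apply: laurentP => n /=; case: eqP; case: eqP.
Qed.
HB.instance Definition _ := GRing.isMonoidMorphism.Build
  (laurent {poly R}) (laurent {poly R}) zshift zshift_is_monoid_morphism.

Lemma zshiftM f g : zshift (f * g) = zshift f * zshift g.
Proof. exact: rmorphM. Qed.

Lemma vanish_below_zshift f a : vanish_below a f -> vanish_below a (zshift f).
Proof.
move=> fa n na; apply/polyP => k; rewrite -zcoefE zcoef_zshift lmonoM zcoefE.
by rewrite fa ?coef0 ?mulr0//; lia.
Qed.

Lemma zshift_continuous : lcontinuous zshift.
Proof. by move=> n; exists n => f; exact: vanish_below_zshift. Qed.

Lemma zcoef_iter_zshift k m f :
  zcoef k (iter m zshift f) = lmono 1 (m * k)%N%:Z * zcoef k f.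
Proof.
elim: m => [|m IH]; first by rewrite mul0n mul1r.
by rewrite iterS zcoef_zshift IH mulrA lmonoMM mulr1 -PoszD.
Qed.

End ZCoefficient.

Arguments zshift {R} f.

Lemma q_expE n : q ^+ n = lmono 1 n%:Z.
Proof. by rewrite lmonoX expr1n mul1r. Qed.

Lemma z_expE n : z ^+ n = lmono 'X^n 0.
Proof. by rewrite lmonoX mul0r. Qed.

Lemma zshift_q : zshift q = q.
Proof.
apply: zcoefP => k; rewrite zcoef_zshift !zcoef_lmono coef1 lmonoMM.
case: k => [|k] /=; first by rewrite mulr1.
by apply: laurentP => n /=; rewrite mulr0; case: eqP; case: eqP.
Qed.

Lemma zshift_z : zshift z = z * q.
Proof.
apply: zcoefP => k; rewrite zcoef_zshift lmonoMM mulr1 !zcoef_lmono coefX.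
rewrite lmonoMM mul1r; case: k => [|[|k]] //=.
  by apply: laurentP => n /=; rewrite if_same; case: eqP.
by apply: laurentP => n /=; case: eqP; case: eqP.
Qed.

Lemma zshift_expz e : zshift (q ^ e) = q ^ e.
Proof.
by case: e => n; rewrite ?NegzE -?exprnN ?rmorphV ?unitrX ?q_unit//= rmorphXn /= zshift_q.
Qed.

Lemma zshift_qpoch L : zshift (qpoch q L) = qpoch q L.
Proof.
rewrite rmorph_prod; apply: eq_bigr => i _.
by rewrite rmorphB rmorph1 rmorphM rmorphXn /= zshift_q.
Qed.

Lemma zcoef0_mulz f : zcoef 0 (z * f) = 0.
Proof. by apply: laurentP => n; rewrite zcoefE [_ n]lmonoM coefXM. Qed.

Lemma zcoefS_mulz k f : zcoef k.+1 (z * f) = zcoef k f.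
Proof.
by apply: laurentP => n; rewrite zcoefE [_ n]lmonoM coefXM subr0.
Qed.

Lemma sum_lmono (I : Type) (s : seq I) (P : pred I) (F : I -> int) e :
  \sum_(i <- s | P i) lmono (F i) e = lmono (\sum_(i <- s | P i) F i) e.
Proof.
elim/big_rec2: _ => [|i x y _ ->]; last by rewrite lmonoD.
by apply: laurentP => n /=; case: eqP.
Qed.

Lemma zcoef_z_q k (m w : nat) :
  zcoef k (z ^+ m * q ^+ w) = lmono (m == k)%:R w%:Z.
Proof. by rewrite z_expE q_expE lmonoMM mulr1 add0r zcoef_lmono coefXn eq_sym. Qed.

(** * Contiguous relations for S13 *)

Lemma qpoch_qS n : qpoch q n.+1 = qpoch q n * (1 - q ^+ n.+1).
Proof. by rewrite qpochS -exprS mulrBr mulr1. Qed.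

Lemma subr1_exprq_unit n : 1 - q ^+ n.+1 \is a GRing.unit.
Proof. by have := qpoch_unit n.+1; rewrite qpoch_qS unitrM => /andP[]. Qed.

Lemma q_expzD (m n : int) : q ^ (m + n) = q ^ m * q ^ n.
Proof. exact: exprzDr q_unit _ _. Qed.

Definition S13_denom (t : nat * nat * nat * nat * nat * nat) :=
  let: (r1, r2, r3, s1, s2, s3) := t in
  qpoch q (r1 - r2) * qpoch q (r2 - r3) * qpoch q (s1 - s2) *
  qpoch q (s2 - s3) * qpoch q r3 * qpoch q s3 * qpoch q (r3 + s3 + 1).

Lemma S13_denom_unit t : S13_denom t \is a GRing.unit.
Proof.
by case: t => [[[[[r1 r2] r3] s1] s2] s3]; rewrite !unitrM !qpoch_unit.
Qed.

Lemma S13_termE rho sigma (r1 r2 r3 s1 s2 s3 : nat) :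
  S13_term rho sigma (r1, r2, r3, s1, s2, s3) =
  z ^+ r1 * q ^ S13_exponent rho sigma (r1, r2, r3, s1, s2, s3) /
    S13_denom (r1, r2, r3, s1, s2, s3).
Proof. by []. Qed.

(** Common frame of the six relations: the index shift [h] matches the combination [f] of summands
    with a multiple of one S13, and outside the image of [h] a factor 1 - q^0 annihilates [f]. *)
Lemma S13_telescope (h : nat * nat * nat * nat * nat * nat -> _)
    (f : nat * nat * nat * nat * nat * nat -> laurent {poly int}) l c rho sigma :
  injective h -> (forall t, S13_index t -> S13_index (h t)) ->
  (forall t, S13_index t -> f (h t) = c * S13_term rho sigma t) ->
  (forall t, S13_index t -> (forall u, S13_index u -> h u <> t) -> f t = 0) ->
  is_lsum S13_index f l -> l = c * S13 rho sigma.
Proof.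
move=> hI hA fh f0 fl; apply: is_lsum_unique fl _.
apply: is_lsum_image hA _ fh f0 (is_lsumM c (S13_summable rho sigma)).
by move=> t u _ _ /hI.
Qed.

Lemma telescope_frac (A : comUnitRingType) (w x d u k e : A) :
  d \is a GRing.unit -> 1 - u \is a GRing.unit ->
  w * x * (k * e) / (d * (1 - u)) - w * x * (k * e * u) / (d * (1 - u)) =
  w * k * (x * e / d).
Proof.
move=> dU uU; rewrite -mulrBl invrM//.
have -> : w * x * (k * e) - w * x * (k * e * u) = w * k * (x * e) * (1 - u).
  by ring.
by rewrite -[LHS]mulrA mulVKr// !mulrA.
Qed.

(** The four terms are the expansion of (1 - u)(1 - v). In the application c is q: it carries the
    constant power of q in v, which no change of rho and sigma supplies. *)
Lemma telescope_frac2 (A : comUnitRingType) (w x d u v k e c e3 e4 : A) :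
  d \is a GRing.unit -> 1 - u \is a GRing.unit -> 1 - v \is a GRing.unit ->
  c * e3 = k * e * v -> c * e4 = k * e * u * v ->
  let d' := d * (1 - u) * (1 - v) in
  w * x * (k * e) / d' - w * x * (k * e * u) / d'
  - c * (w * x * e3 / d') + c * (w * x * e4 / d') = w * k * (x * e / d).
Proof.
move=> dU uU vU e3E e4E d'.
have cE (y : A) : c * (w * x * y / d') = w * x * (c * y) / d' by ring.
rewrite !cE e3E e4E -!mulrBl -mulrDl /d' !invrM ?unitrM ?dU ?uU//.
have -> : w * x * (k * e) - w * x * (k * e * u) - w * x * (k * e * v)
  + w * x * (k * e * u * v) = w * k * (x * e) * (1 - u) * (1 - v) by ring.
by rewrite -[LHS]mulrA mulVKr// -[LHS]mulrA mulVKr// !mulrA.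
Qed.

Lemma telescope_term (w x d d' : laurent {poly int}) (k e e1 e2 : int) n :
  d \is a GRing.unit -> d' = d * (1 - q ^+ n.+1) ->
  e1 = k + e -> e2 = k + e + n.+1%:Z ->
  w * x * q ^ e1 / d' - w * x * q ^ e2 / d' = w * q ^ k * (x * q ^ e / d).
Proof.
move=> dU -> -> ->; rewrite [q ^ (k + e + _)]q_expzD [q ^ (k + e)]q_expzD.
exact: telescope_frac dU (subr1_exprq_unit n).
Qed.

Lemma telescope_term2 (w x d d' : laurent {poly int}) (k e e1 e2 e3 e4 : int)
    m n :
  d \is a GRing.unit -> d' = d * (1 - q ^+ m.+1) * (1 - q ^+ n.+1) ->
  e1 = k + e -> e2 = k + e + m.+1%:Z -> 1 + e3 = k + e + n.+1%:Z ->
  1 + e4 = k + e + m.+1%:Z + n.+1%:Z ->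
  w * x * q ^ e1 / d' - w * x * q ^ e2 / d'
  - q * (w * x * q ^ e3 / d') + q * (w * x * q ^ e4 / d')
  = w * q ^ k * (x * q ^ e / d).
Proof.
move=> dU -> -> -> e3E e4E.
have qD (e0 : int) : q * q ^ e0 = q ^ (1 + e0) by rewrite [RHS]q_expzD.
rewrite [q ^ (k + e + _)]q_expzD [q ^ (k + e)]q_expzD.
apply: telescope_frac2 dU (subr1_exprq_unit m) (subr1_exprq_unit n) _ _.
  by rewrite qD e3E [LHS]q_expzD [q ^ (k + e)]q_expzD.
by rewrite qD e4E [LHS]q_expzD [q ^ (k + e + _)]q_expzD [q ^ (k + e)]q_expzD.
Qed.

Lemma telescope_term1 (x d d' : laurent {poly int}) (k e e1 e2 : int) n :
  d \is a GRing.unit -> d' = d * (1 - q ^+ n.+1) ->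
  e1 = k + e -> e2 = k + e + n.+1%:Z ->
  x * q ^ e1 / d' - x * q ^ e2 / d' = q ^ k * (x * q ^ e / d).
Proof.
move=> dU d'E e1E e2E; have := telescope_term 1 x dU d'E e1E e2E.
by rewrite (mul1r x) (mul1r (q ^ k)).
Qed.

Lemma telescope_term21 (x d d' : laurent {poly int}) (k e e1 e2 e3 e4 : int)
    m n :
  d \is a GRing.unit -> d' = d * (1 - q ^+ m.+1) * (1 - q ^+ n.+1) ->
  e1 = k + e -> e2 = k + e + m.+1%:Z -> 1 + e3 = k + e + n.+1%:Z ->
  1 + e4 = k + e + m.+1%:Z + n.+1%:Z ->
  x * q ^ e1 / d' - x * q ^ e2 / d'
  - q * (x * q ^ e3 / d') + q * (x * q ^ e4 / d') = q ^ k * (x * q ^ e / d).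
Proof.
move=> dU d'E e1E e2E e3E e4E.
have := telescope_term2 1 x dU d'E e1E e2E e3E e4E.
by rewrite (mul1r x) (mul1r (q ^ k)).
Qed.

Lemma zshift_S13_denomV t : zshift (S13_denom t)^-1 = (S13_denom t)^-1.
Proof.
rewrite rmorphV ?S13_denom_unit//=; case: t => [[[[[r1 r2] r3] s1] s2] s3].
by rewrite !rmorphM /= !zshift_qpoch.
Qed.

Lemma zshift_S13_frac w e t :
  zshift (w * q ^ e / S13_denom t) = zshift w * q ^ e / S13_denom t.
Proof. by rewrite zshiftM zshiftM zshift_S13_denomV (zshift_expz e). Qed.

Lemma eq_S13_term rho sigma rho' sigma' t :
  S13_exponent rho sigma t = S13_exponent rho' sigma' t ->
  S13_term rho sigma t = S13_term rho' sigma' t.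
Proof.
by case: t => [[[[[r1 r2] r3] s1] s2] s3] eE; rewrite !S13_termE eE.
Qed.

(** z enters a summand only as z^(r_1), so z -> zq contributes q^(r_1), a unit step of rho_1. This
    is what lets [form_shift] act on symbols. *)
Lemma zshift_S13 (a1 a2 a3 : int) sigma :
  zshift (S13 (a1, a2, a3) sigma) = S13 (a1 + 1, a2, a3) sigma.
Proof.
have := is_lsum_map (@zshift_is_zmod_morphism _) (@zshift_continuous _)
  (S13_summable (a1, a2, a3) sigma).
move/is_lsum_unique; apply; apply: eq_is_lsum (S13_summable _ _) => t _.
case: t sigma => [[[[[r1 r2] r3] s1] s2] s3] [[b1 b2] b3]; rewrite !S13_termE.
rewrite zshift_S13_frac.
have -> : S13_exponent (a1 + 1, a2, a3) (b1, b2, b3) (r1, r2, r3, s1, s2, s3) =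
  r1%:Z + S13_exponent (a1, a2, a3) (b1, b2, b3) (r1, r2, r3, s1, s2, s3).
  by rewrite /S13_exponent; ring.
by rewrite q_expzD -exprnP mulrA rmorphXn /= zshift_z exprMn.
Qed.

(** The factor is 1 - q^(r_1 - r_2). Replacing r_1 by r_1 + 1 then produces z q^(1 + a_1) and, from
    the quadratic form, q^(2 r_1 - s_1); hence the changes of rho_1 and sigma_1 on the right. *)
Lemma S13_r1 (a1 a2 a3 b1 b2 b3 : int) :
  S13 (a1, a2, a3) (b1, b2, b3) - S13 (a1 + 1, a2 - 1, a3) (b1, b2, b3) =
  z * q ^ (1 + a1) * S13 (a1 + 2, a2, a3) (b1 - 1, b2, b3).
Proof.
apply: (@S13_telescope (fun t => let: (r1, r2, r3, s1, s2, s3) := t in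
  (r1.+1, r2, r3, s1, s2, s3))
  (fun t => S13_term (a1, a2, a3) (b1, b2, b3) t
    - S13_term (a1 + 1, a2 - 1, a3) (b1, b2, b3) t)); last first.
- exact: is_lsumB (S13_summable _ _) (S13_summable _ _).
- case=> [[[[[r1 r2] r3] s1] s2] s3] /and4P[r12 r23 s12 s23] nh.
  case: (ltnP r2 r1) => [r21|r21].
    case: (nh (r1.-1, r2, r3, s1, s2, s3)).
      by apply/and4P; split => //; lia.
    by congr (_, _, _, _, _, _); lia.
  have eqv : r1 = r2 by lia.
  apply/eqP; rewrite subr_eq0; apply/eqP/eq_S13_term.
  by rewrite /S13_exponent eqv; ring.
- case=> [[[[[r1 r2] r3] s1] s2] s3] /and4P[r12 r23 s12 s23].
  rewrite !S13_termE exprS.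
  apply: (@telescope_term _ _ _ _ _ _ _ _ (r1 - r2)).
  + exact: S13_denom_unit.
  + rewrite /S13_denom ?subSS subSn// qpoch_qS; ring.
  + by rewrite /S13_exponent; ring.
  + have -> : (r1 - r2).+1%:Z = r1%:Z - r2%:Z + 1 by lia.
    by rewrite /S13_exponent; ring.
- case=> [[[[[r1 r2] r3] s1] s2] s3] /and4P[r12 r23 s12 s23].
  by apply/and4P; split => //; lia.
- by case=> [[[[[r1 r2] r3] s1] s2] s3] [[[[[? ?] ?] ?] ?] ?] [] *; subst.
Qed.

(** The factor is 1 - q^(r_2 - r_3). Both r_1 and r_2 are raised, so that the denominator (q;
    q)_(r_1 - r_2) is untouched. *)
Lemma S13_r2 (a1 a2 a3 b1 b2 b3 : int) :
  S13 (a1, a2, a3) (b1, b2, b3) - S13 (a1, a2 + 1, a3 - 1) (b1, b2, b3) =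
  z * q ^ (2 + a1 + a2) * S13 (a1 + 2, a2 + 2, a3) (b1 - 1, b2 - 1, b3).
Proof.
apply: (@S13_telescope (fun t => let: (r1, r2, r3, s1, s2, s3) := t in
  (r1.+1, r2.+1, r3, s1, s2, s3))
  (fun t => S13_term (a1, a2, a3) (b1, b2, b3) t
    - S13_term (a1, a2 + 1, a3 - 1) (b1, b2, b3) t)); last first.
- exact: is_lsumB (S13_summable _ _) (S13_summable _ _).
- case=> [[[[[r1 r2] r3] s1] s2] s3] /and4P[r12 r23 s12 s23] nh.
  case: (ltnP r3 r2) => [r21|r21].
    case: (nh (r1.-1, r2.-1, r3, s1, s2, s3)).
      by apply/and4P; split => //; lia.
    by congr (_, _, _, _, _, _); lia.
  have eqv : r2 = r3 by lia.
  apply/eqP; rewrite subr_eq0; apply/eqP/eq_S13_term.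
  by rewrite /S13_exponent eqv; ring.
- case=> [[[[[r1 r2] r3] s1] s2] s3] /and4P[r12 r23 s12 s23].
  rewrite !S13_termE exprS.
  apply: (@telescope_term _ _ _ _ _ _ _ _ (r2 - r3)).
  + exact: S13_denom_unit.
  + rewrite /S13_denom ?subSS subSn// qpoch_qS; ring.
  + by rewrite /S13_exponent; ring.
  + have -> : (r2 - r3).+1%:Z = r2%:Z - r3%:Z + 1 by lia.
    by rewrite /S13_exponent; ring.
- case=> [[[[[r1 r2] r3] s1] s2] s3] /and4P[r12 r23 s12 s23].
  by apply/and4P; split => //; lia.
- by case=> [[[[[r1 r2] r3] s1] s2] s3] [[[[[? ?] ?] ?] ?] ?] [] *; subst.
Qed.

(** Raising all three r_i changes the denominators (q; q)_(r_3) and (q; q)_(r_3 + s_3 + 1), so the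
    factor is (1 - q^(r_3))(1 - q^(r_3 + s_3 + 1)), whose expansion gives the four sums on the
    left. *)
Lemma S13_r3 (a1 a2 a3 b1 b2 b3 : int) :
  S13 (a1, a2, a3) (b1, b2, b3) - S13 (a1, a2, a3 + 1) (b1, b2, b3)
  - q * S13 (a1, a2, a3 + 1) (b1, b2, b3 + 1)
  + q * S13 (a1, a2, a3 + 2) (b1, b2, b3 + 1) =
  z * q ^ (3 + a1 + a2 + a3) * S13 (a1 + 2, a2 + 2, a3 + 2) (b1 - 1, b2 - 1, b3 - 1).
Proof.
apply: (@S13_telescope (fun t => let: (r1, r2, r3, s1, s2, s3) := t in
  (r1.+1, r2.+1, r3.+1, s1, s2, s3))
  (fun t => S13_term (a1, a2, a3) (b1, b2, b3) t
    - S13_term (a1, a2, a3 + 1) (b1, b2, b3) t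
    - q * S13_term (a1, a2, a3 + 1) (b1, b2, b3 + 1) t
    + q * S13_term (a1, a2, a3 + 2) (b1, b2, b3 + 1) t)); last first.
- apply: is_lsumD (is_lsumM _ (S13_summable _ _)).
  apply: is_lsumB (is_lsumM _ (S13_summable _ _)).
  exact: is_lsumB (S13_summable _ _) (S13_summable _ _).
- case=> [[[[[r1 r2] r3] s1] s2] s3] /and4P[r12 r23 s12 s23] nh.
  case: (ltnP 0 r3) => [r21|r21].
    case: (nh (r1.-1, r2.-1, r3.-1, s1, s2, s3)).
      by apply/and4P; split => //; lia.
    by congr (_, _, _, _, _, _); lia.
  have eqv : r3 = 0%N by lia.
  have e0 (c1 c2 : int) :
      S13_term (a1, a2, c1) (b1, b2, c2) (r1, r2, r3, s1, s2, s3) =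
      S13_term (a1, a2, c1 + 1) (b1, b2, c2) (r1, r2, r3, s1, s2, s3).
    by apply: eq_S13_term; rewrite /S13_exponent eqv; ring.
  (* At r_3 = 0 only the factor 1 - q^(r_3) vanishes; the four terms cancel in two pairs that differ
     in rho_3. *)
  by rewrite e0 subrr add0r [X in - (q * X)]e0 -addrA addNr.
- case=> [[[[[r1 r2] r3] s1] s2] s3] /and4P[r12 r23 s12 s23].
  rewrite !S13_termE exprS.
  apply: (@telescope_term2 _ _ _ _ _ _ _ _ _ _ r3 (r3 + s3 + 1)).
  + exact: S13_denom_unit.
  + rewrite /S13_denom ?addSn ?addnS ?subSS !qpoch_qS; ring.
  + by rewrite /S13_exponent; ring.
  + by rewrite /S13_exponent; ring.
  + by rewrite /S13_exponent; ring.
  + by rewrite /S13_exponent; ring.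
- case=> [[[[[r1 r2] r3] s1] s2] s3] /and4P[r12 r23 s12 s23].
  by apply/and4P; split => //; lia.
- by case=> [[[[[r1 r2] r3] s1] s2] s3] [[[[[? ?] ?] ?] ?] ?] [] *; subst.
Qed.

(** Mirror image of the relation for r_1, the quadratic form being symmetric; z is absent on the
    right because it records r_1 only. *)
Lemma S13_s1 (a1 a2 a3 b1 b2 b3 : int) :
  S13 (a1, a2, a3) (b1, b2, b3) - S13 (a1, a2, a3) (b1 + 1, b2 - 1, b3) =
  q ^ (1 + b1) * S13 (a1 - 1, a2, a3) (b1 + 2, b2, b3).
Proof.
apply: (@S13_telescope (fun t => let: (r1, r2, r3, s1, s2, s3) := t in
  (r1, r2, r3, s1.+1, s2, s3))
  (fun t => S13_term (a1, a2, a3) (b1, b2, b3) t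
    - S13_term (a1, a2, a3) (b1 + 1, b2 - 1, b3) t)); last first.
- exact: is_lsumB (S13_summable _ _) (S13_summable _ _).
- case=> [[[[[r1 r2] r3] s1] s2] s3] /and4P[r12 r23 s12 s23] nh.
  case: (ltnP s2 s1) => [r21|r21].
    case: (nh (r1, r2, r3, s1.-1, s2, s3)).
      by apply/and4P; split => //; lia.
    by congr (_, _, _, _, _, _); lia.
  have eqv : s1 = s2 by lia.
  apply/eqP; rewrite subr_eq0; apply/eqP/eq_S13_term.
  by rewrite /S13_exponent eqv; ring.
- case=> [[[[[r1 r2] r3] s1] s2] s3] /and4P[r12 r23 s12 s23].
  rewrite !S13_termE.
  apply: (@telescope_term1 _ _ _ _ _ _ _ (s1 - s2)).
  + exact: S13_denom_unit.
  + rewrite /S13_denom ?subSS subSn// qpoch_qS; ring.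
  + by rewrite /S13_exponent; ring.
  + have -> : (s1 - s2).+1%:Z = s1%:Z - s2%:Z + 1 by lia.
    by rewrite /S13_exponent; ring.
- case=> [[[[[r1 r2] r3] s1] s2] s3] /and4P[r12 r23 s12 s23].
  by apply/and4P; split => //; lia.
- by case=> [[[[[r1 r2] r3] s1] s2] s3] [[[[[? ?] ?] ?] ?] ?] [] *; subst.
Qed.

Lemma S13_s2 (a1 a2 a3 b1 b2 b3 : int) :
  S13 (a1, a2, a3) (b1, b2, b3) - S13 (a1, a2, a3) (b1, b2 + 1, b3 - 1) =
  q ^ (2 + b1 + b2) * S13 (a1 - 1, a2 - 1, a3) (b1 + 2, b2 + 2, b3).
Proof.
apply: (@S13_telescope (fun t => let: (r1, r2, r3, s1, s2, s3) := t in
  (r1, r2, r3, s1.+1, s2.+1, s3))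
  (fun t => S13_term (a1, a2, a3) (b1, b2, b3) t
    - S13_term (a1, a2, a3) (b1, b2 + 1, b3 - 1) t)); last first.
- exact: is_lsumB (S13_summable _ _) (S13_summable _ _).
- case=> [[[[[r1 r2] r3] s1] s2] s3] /and4P[r12 r23 s12 s23] nh.
  case: (ltnP s3 s2) => [r21|r21].
    case: (nh (r1, r2, r3, s1.-1, s2.-1, s3)).
      by apply/and4P; split => //; lia.
    by congr (_, _, _, _, _, _); lia.
  have eqv : s2 = s3 by lia.
  apply/eqP; rewrite subr_eq0; apply/eqP/eq_S13_term.
  by rewrite /S13_exponent eqv; ring.
- case=> [[[[[r1 r2] r3] s1] s2] s3] /and4P[r12 r23 s12 s23].
  rewrite !S13_termE.
  apply: (@telescope_term1 _ _ _ _ _ _ _ (s2 - s3)).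
  + exact: S13_denom_unit.
  + rewrite /S13_denom ?subSS subSn// qpoch_qS; ring.
  + by rewrite /S13_exponent; ring.
  + have -> : (s2 - s3).+1%:Z = s2%:Z - s3%:Z + 1 by lia.
    by rewrite /S13_exponent; ring.
- case=> [[[[[r1 r2] r3] s1] s2] s3] /and4P[r12 r23 s12 s23].
  by apply/and4P; split => //; lia.
- by case=> [[[[[r1 r2] r3] s1] s2] s3] [[[[[? ?] ?] ?] ?] ?] [] *; subst.
Qed.

Lemma S13_s3 (a1 a2 a3 b1 b2 b3 : int) :
  S13 (a1, a2, a3) (b1, b2, b3) - S13 (a1, a2, a3) (b1, b2, b3 + 1)
  - q * S13 (a1, a2, a3 + 1) (b1, b2, b3 + 1)
  + q * S13 (a1, a2, a3 + 1) (b1, b2, b3 + 2) =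
  q ^ (3 + b1 + b2 + b3) * S13 (a1 - 1, a2 - 1, a3 - 1) (b1 + 2, b2 + 2, b3 + 2).
Proof.
apply: (@S13_telescope (fun t => let: (r1, r2, r3, s1, s2, s3) := t in
  (r1, r2, r3, s1.+1, s2.+1, s3.+1))
  (fun t => S13_term (a1, a2, a3) (b1, b2, b3) t
    - S13_term (a1, a2, a3) (b1, b2, b3 + 1) t
    - q * S13_term (a1, a2, a3 + 1) (b1, b2, b3 + 1) t
    + q * S13_term (a1, a2, a3 + 1) (b1, b2, b3 + 2) t)); last first.
- apply: is_lsumD (is_lsumM _ (S13_summable _ _)).
  apply: is_lsumB (is_lsumM _ (S13_summable _ _)).
  exact: is_lsumB (S13_summable _ _) (S13_summable _ _).
- case=> [[[[[r1 r2] r3] s1] s2] s3] /and4P[r12 r23 s12 s23] nh.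
  case: (ltnP 0 s3) => [r21|r21].
    case: (nh (r1, r2, r3, s1.-1, s2.-1, s3.-1)).
      by apply/and4P; split => //; lia.
    by congr (_, _, _, _, _, _); lia.
  have eqv : s3 = 0%N by lia.
  have e0 (c1 c2 : int) :
      S13_term (a1, a2, c1) (b1, b2, c2) (r1, r2, r3, s1, s2, s3) =
      S13_term (a1, a2, c1) (b1, b2, c2 + 1) (r1, r2, r3, s1, s2, s3).
    by apply: eq_S13_term; rewrite /S13_exponent eqv; ring.
  by rewrite e0 subrr add0r [X in - (q * X)]e0 -addrA addNr.
- case=> [[[[[r1 r2] r3] s1] s2] s3] /and4P[r12 r23 s12 s23].
  rewrite !S13_termE.
  apply: (@telescope_term21 _ _ _ _ _ _ _ _ _ s3 (r3 + s3 + 1)).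
  + exact: S13_denom_unit.
  + rewrite /S13_denom ?addSn ?addnS ?subSS !qpoch_qS; ring.
  + by rewrite /S13_exponent; ring.
  + by rewrite /S13_exponent; ring.
  + by rewrite /S13_exponent; ring.
  + by rewrite /S13_exponent; ring.
- case=> [[[[[r1 r2] r3] s1] s2] s3] /and4P[r12 r23 s12 s23].
  by apply/and4P; split => //; lia.
- by case=> [[[[[r1 r2] r3] s1] s2] s3] [[[[[? ?] ?] ?] ?] ?] [] *; subst.
Qed.

(** * The Corteel-Welsh recurrence *)

Section Cylindric.
Variable r : nat.
Implicit Types (c : r.-tuple nat) (pi : r.-tuple (seq nat)) (J : {set 'I_r}).

Lemma maxpart_leP pi k :
  reflect (forall i x, x \in tnth pi i -> (x <= k)%N) (maxpart pi <= k)%N.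
Proof.
apply: (iffP (bigmax_leqP _ _ _)) => [mk i x xi|mk i _].
  by apply: leq_trans (mk i isT); apply: leq_bigmax_seq.
by apply/bigmax_leqP_seq => x xi _; apply: mk xi.
Qed.

Lemma partition_part p k : is_partition p ->
  (forall x, x \in p -> (x <= k)%N) <-> (part p 0 <= k)%N.
Proof.
case: p => [|a p] /andP[/= sp _]; first by split.
split=> [pk|ak x]; first by apply: pk; rewrite inE eqxx.
rewrite inE => /predU1P[->//|xp]; apply: leq_trans ak.
by have /allP-/(_ x xp) := order_path_min (rev_trans leq_trans) sp.
Qed.

Lemma part_le p j k : (forall x, x \in p -> (x <= k)%N) -> (part p j <= k)%N.
Proof.
move=> pk; rewrite /part; case: (ltnP j (size p)) => [jp|pj].
  exact/pk/mem_nth.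
by rewrite nth_default.
Qed.

Lemma is_partition_cons p k : (0 < k)%N -> is_partition p ->
  (forall x, x \in p -> (x <= k)%N) -> is_partition (k :: p).
Proof.
move=> k0 /andP[sp p0] pk; rewrite /is_partition inE negb_or p0 andbT.
rewrite (eq_sym 0%N) -lt0n k0 andbT /=.
by case: p sp pk {p0} => //= a p -> /(_ a) ->//; rewrite inE eqxx.
Qed.

Lemma is_partition_behead p : is_partition p -> is_partition (behead p).
Proof.
case: p => //= a p /andP[/= sp]; rewrite inE negb_or => /andP[_ p0].
by rewrite /is_partition p0 (path_sorted sp).
Qed.

(* The profile c(J) of the recurrence of Corteel and Welsh. *)
Definition profile_step c J : r.-tuple nat :=
  [tuple (tnth c i + ((ord_pred i \in J) && (i \notin J))
    - ((i \in J) && (ord_pred i \notin J)))%N | i < r].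

Lemma tnth_profile_step c J i : tnth (profile_step c J) (ordS i) =
  (tnth c (ordS i) + ((i \in J) && (ordS i \notin J))
    - ((ordS i \in J) && (i \notin J)))%N.
Proof. by rewrite tnth_mktuple ordSK. Qed.

(** For J inside the support only positive entries are decreased, so the truncated subtraction in
    [profile_step] is exact. *)
Definition support c : {set 'I_r} := [set i | 0 < tnth c i]%N.

Definition cons_parts k J pi : r.-tuple (seq nat) :=
  [tuple if i \in J then k :: tnth pi i else tnth pi i | i < r].

Definition behead_parts J pi : r.-tuple (seq nat) :=
  [tuple if i \in J then behead (tnth pi i) else tnth pi i | i < r].

Lemma cons_parts_inj k J : injective (cons_parts k J).
Proof.
move=> pi pi' /(congr1 (fun t => tnth t)) e; apply: eq_from_tnth => i.
by have := congr1 (@^~ i) e; rewrite !tnth_mktuple; case: ifP => // _ [].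
Qed.

Lemma weight_cons_parts k J pi :
  weight (cons_parts k J pi) = (#|J| * k + weight pi)%N.
Proof.
rewrite /weight -sum_nat_const [X in (X + _)%N]big_mkcond -big_split /=.
apply: eq_bigr => i _.
by rewrite tnth_mktuple; case: ifP => // _; rewrite big_cons.
Qed.

Lemma maxpart_cons_parts k J pi :
  (maxpart pi <= k)%N -> (maxpart (cons_parts k J pi) <= k)%N.
Proof.
move=> /maxpart_leP pik; apply/maxpart_leP => i x; rewrite tnth_mktuple.
by case: ifP => _; [rewrite inE => /predU1P[->//|]|]; apply: pik.
Qed.

Lemma maxpart_behead_parts k J pi :
  (maxpart pi <= k)%N -> (maxpart (behead_parts J pi) <= k)%N.
Proof.
move=> /maxpart_leP pik; apply/maxpart_leP => i x; rewrite tnth_mktuple.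
by case: ifP => _; [move=> /mem_behead|]; apply: pik.
Qed.

(** A new first part moves the old parts of its row by one position; [profile_step] compensates when
    exactly one of two adjacent rows lies in J. An inequality with a new part on the larger side
    holds because k bounds all parts; with a new part on the smaller side alone it does not occur,
    the profile entry there being positive. *)
Lemma cylindric_cons_parts k J c pi : (0 < k)%N -> J \subset support c ->
  (maxpart pi <= k)%N -> cylindric (profile_step c J) pi ->
  cylindric c (cons_parts k J pi).
Proof.
move=> k0 /fintype.subsetP Jc /maxpart_leP pik [pip cpi]; split=> [i|i j].
  rewrite tnth_mktuple; case: ifP => // _; apply: is_partition_cons => //.
  exact: pik.
rewrite !tnth_mktuple; have := cpi i; rewrite tnth_profile_step.
have := Jc (ordS i); rewrite !inE.
case: (boolP (i \in J)) => iJ; case: (boolP (ordS i \in J)) => SiJ /= cS;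
  rewrite ?addn0 ?subn0 => {}cpi //.
- case: j => [|j]; last exact: cpi.
  by apply: part_le => x; rewrite inE => /predU1P[->//|]; apply: pik.
- case: j => [|j]; first by apply: part_le; apply: pik.
  by have := cpi j; rewrite addn1 addnS addSn.
- have := cpi j; case: (tnth c (ordS i)) (cS isT) => // m _.
  by rewrite addnS subn1.
Qed.

Lemma cylindric_behead_parts J c pi : J \subset support c ->
  cylindric c pi -> cylindric (profile_step c J) (behead_parts J pi).
Proof.
move=> /fintype.subsetP Jc [pip cpi]; split=> [i|i j].
  by rewrite tnth_mktuple; case: ifP => // _; apply: is_partition_behead.
rewrite tnth_profile_step !tnth_mktuple.
have partb p n : part (behead p) n = part p n.+1 by rewrite /part nth_behead.
have := Jc (ordS i); rewrite !inE.
case: (boolP (i \in J)) => iJ; case: (boolP (ordS i \in J)) => SiJ /= cS;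
  rewrite ?addn0 ?subn0 ?partb //.
- exact: cpi i j.+1.
- by have := cpi i j.+1; rewrite addn1 addnS addSn.
- have := cpi i j; case: (tnth c (ordS i)) (cS isT) => // m _.
  by rewrite subn1 addnS.
Qed.

Lemma behead_partsK k J pi : (0 < k)%N ->
  (forall i, i \in J -> part (tnth pi i) 0 = k) ->
  cons_parts k J (behead_parts J pi) = pi.
Proof.
move=> k0 pik; apply: eq_from_tnth => i; rewrite !tnth_mktuple.
case: (boolP (i \in J)) => // iJ; move: (pik _ iJ); rewrite /part.
by case: (tnth pi i) => [k00|x s /= ->//]; rewrite -k00 in k0.
Qed.

Lemma is_lsum_zcoef_Fc c k : is_lsum (cylindric c)
  (fun pi => lmono (maxpart pi == k)%:R (weight pi)%:Z) (zcoef k (Fc c)).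
Proof.
have := is_lsum_map (@zcoef_is_zmod_morphism _ k) (@zcoef_continuous _ k)
  (Fc_summable c).
by apply: eq_is_lsum => pi _; rewrite zcoef_z_q.
Qed.

Lemma is_lsum_zcoef_Fc_le c k : is_lsum (cylindric c)
  (fun pi => lmono (maxpart pi <= k)%N%:R (weight pi)%:Z)
  (\sum_(i < k.+1) zcoef i (Fc c)).
Proof.
have := is_lsum_sum_seq (index_enum 'I_k.+1) (P := xpredT)
  (fun (i : 'I_k.+1) _ => is_lsum_zcoef_Fc c i).
apply: eq_is_lsum => pi _; rewrite sum_lmono; congr lmono.
case: (leqP (maxpart pi) k) => mk.
  rewrite (bigD1 (Ordinal (mk : maxpart pi < k.+1)%N)) //= eqxx big1 ?addr0//.
  by move=> i /eqP ni; case: eqP => // mi; case: ni; apply: val_inj.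
by rewrite big1// => i _; case: eqP => // mi; have := ltn_ord i; lia.
Qed.

(** Prepending k to the rows in J is a bijection from the cylindric partitions of profile c(J) with
    parts at most k onto those of profile c with parts at most k whose rows in J begin with k. Rows
    outside J may begin with k as well, whence the later inclusion-exclusion. *)
Lemma is_lsum_first_parts c J k : (0 < k)%N -> J \subset support c ->
  is_lsum (cylindric c)
    (fun pi => lmono ((maxpart pi <= k)%N &&
      [forall i in J, part (tnth pi i) 0 == k])%:R (weight pi)%:Z)
    (lmono 1 (#|J| * k)%N%:Z *
      \sum_(i < k.+1) zcoef i (Fc (profile_step c J))).
Proof.
move=> k0 Jc; pose B pi := cylindric (profile_step c J) pi /\ (maxpart pi <= k)%N.
have := is_lsumM (lmono 1 (#|J| * k)%N%:Z)
  (is_lsum_zcoef_Fc_le (profile_step c J) k).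
move=> /(is_lsum_restrict (B := B)) BG.
apply: (is_lsum_image (h := cons_parts k J) (B := B)) (BG _ _).
- by move=> pi [cpi pik]; apply: cylindric_cons_parts.
- by move=> pi pi' _ _; apply: cons_parts_inj.
- move=> pi [cpi pik]; rewrite maxpart_cons_parts//= pik.
  have -> : [forall i in J, part (tnth (cons_parts k J pi) i) 0 == k].
    by apply/forall_inP => i iJ; rewrite tnth_mktuple iJ.
  by rewrite lmonoMM mulr1 weight_cons_parts PoszD.
- move=> pi cpi nB; case: (boolP (_ && _)) => [/andP[pik /forall_inP Jk]|_].
    case: (nB (behead_parts J pi)).
      by split; [apply: cylindric_behead_parts|apply: maxpart_behead_parts].
    by apply: behead_partsK => // i /Jk/eqP.
  by apply: laurentP => n /=; case: eqP.
- by move=> pi [].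
- move=> pi cpi nB; case: (boolP (maxpart pi <= k)%N) => [pik|_]; first by case: nB.
  by rewrite lmonoMM mulr0; apply: laurentP => n /=; case: eqP.
Qed.

(** Distributing the product of x_i + 1, with x_i = -1 on K and 0 elsewhere, gives the alternating
    sum over all subsets of K; the empty set is then split off. *)
Lemma sum_sign_subsets (K : {set 'I_r}) :
  \sum_(J : {set 'I_r} | (J != finset.set0) && (J \subset K)) (-1) ^+ #|J|.-1 =
  (K != finset.set0)%:R :> int.
Proof.
have total : \sum_(J : {set 'I_r} | J \subset K) (-1) ^+ #|J| =
    (K == finset.set0)%:R :> int.
  have := @bigA_distr int 0 1 *%R +%R _ (fun i => if i \in K then -1 else 0)
    (fun=> 1).
  have -> : \prod_i ((if i \in K then -1 else 0) + 1) = (K == finset.set0)%:R :> int.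
    case: eqP => [->|/eqP/finset.set0Pn[i iK]].
      by rewrite big1// => i _; rewrite inE add0r.
    by rewrite (bigD1 i)//= iK addNr mul0r.
  move=> ->; rewrite [LHS]big_mkcond /=; apply: eq_bigr => J _.
  case: (boolP (J \subset K)) =>
      [/fintype.subsetP JK|/fintype.subsetPn[i iJ iK]]; last first.
    by rewrite (bigD1 i)//= iJ (negPf iK) mul0r.
  rewrite -prodr_const big_mkcond /=; apply: eq_bigr => i _.
  by case: ifP => // /JK ->.
rewrite (bigD1 finset.set0) ?finset.sub0set//= cards0 expr0 in total.
have -> : (K != finset.set0)%:R = 1 - (K == finset.set0)%:R :> int.
  by case: (K == finset.set0); rewrite ?subrr ?subr0.
rewrite -total opprD addrA subrr add0r -sumrN.
rewrite (eq_bigl (fun J : {set 'I_r} => (J \subset K) && (J != finset.set0))); last first.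
  by move=> J; rewrite andbC.
apply: eq_bigr => J /andP[_ J0]; rewrite -[in RHS](prednK (_ : 0 < #|J|)%N).
  by rewrite exprS mulN1r opprK.
by rewrite card_gt0.
Qed.

(** Cyclic induction: descend from i to 0, wrap around to the last index, descend again. *)
Lemma ord_pred_closed (P : 'I_r -> Prop) :
  (forall i, P i -> P (ord_pred i)) -> forall i j, P i -> P j.
Proof.
move=> Pp.
have down (i j : 'I_r) : (j <= i)%N -> P i -> P j.
  move: {2}(i - j)%N (leqnn (i - j)) => m; elim: m i => [|m IH] i ijm ji Pi.
    by have -> : j = i by apply: val_inj => /=; lia.
  case: (eqVneq i j) => [<-//|nij]; have ij : (j < i)%N by
    rewrite ltn_neqAle ji andbT; apply: contra nij => /eqP e; apply/eqP/val_inj.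
  have pE : nat_of_ord (ord_pred i) = i.-1.
    rewrite /=; have -> : (i + r).-1 = (i.-1 + r)%N by lia.
    by rewrite modnDr modn_small//; have := ltn_ord i; lia.
  by apply: (IH (ord_pred i)); [rewrite pE; lia|rewrite pE; lia|exact: Pp].
move=> i j Pi.
have r0 : (0 < r)%N by apply: leq_ltn_trans (ltn_ord i).
have P0 : P (Ordinal r0) by apply: down Pi.
have lP : P (ord_pred (Ordinal r0)) by apply: Pp.
apply: down lP; rewrite /= add0n modn_small; last by rewrite prednK.
by have := ltn_ord j; lia.
Qed.

(** If row j begins with k and its profile entry is 0, the inequality at position 0 makes the
    previous row begin with k. If no row of the support began with k, this would go round the cycle
    and reach the row [i0] of the support. *)
Lemma max_first_part c pi k : (0 < k)%N -> support c != finset.set0 ->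
  cylindric c pi -> (maxpart pi <= k)%N ->
  (maxpart pi == k) =
  ([set i in support c | part (tnth pi i) 0 == k] != finset.set0).
Proof.
move=> k0 /finset.set0Pn[i0 i0c] [pip cpi] pik; have /maxpart_leP pik' := pik.
have le0 i : (part (tnth pi i) 0 <= k)%N by apply: part_le; apply: pik'.
apply/eqP/finset.set0Pn => [mk|[i]]; last first.
  rewrite inE => /andP[_ /eqP pk]; apply/eqP; rewrite eqn_leq pik /= leqNgt.
  apply/negP => mk; have /maxpart_leP : (maxpart pi <= k.-1)%N by lia.
  move=> /(_ i)/(partition_part _ (pip i)); rewrite pk; lia.
have [i /eqP ik] : exists i, part (tnth pi i) 0 == k.
  apply/existsP; apply: contraPT mk; rewrite negb_exists => /forallP nk.
  suff : (maxpart pi <= k.-1)%N by lia.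
  apply/maxpart_leP => i; apply/(partition_part _ (pip i)).
  by have := le0 i; have := nk i; lia.
have [//|nK] := pselect (exists x, x \in [set i in support c | part (tnth pi i) 0 == k]).
suff : i0 \notin support c by rewrite i0c.
have cl j : part (tnth pi j) 0 = k -> j \notin support c.
  by move=> jk; apply/negP => jc; apply: nK; exists j; rewrite inE jc jk eqxx.
suff i0k : part (tnth pi i0) 0 = k by apply: cl.
apply: (ord_pred_closed (P := fun j => part (tnth pi j) 0 = k)) ik => j jk.
apply/eqP; rewrite eqn_leq le0 /= -{1}jk.
have := cl j jk; rewrite inE -eqn0Ngt => /eqP cj.
by have := cpi (ord_pred j) 0%N; rewrite ord_predK cj.
Qed.

(** With K the set of rows of the support that begin with k, and all parts at most k, the signs of
    the nonempty J inside K sum to 1 if the maximum is k and to 0 otherwise. *)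
Lemma zcoef_Fc c k : (0 < k)%N -> support c != finset.set0 ->
  zcoef k (Fc c) =
  \sum_(J : {set 'I_r} | (J != finset.set0) && (J \subset support c))
    (-1) ^+ #|J|.-1 * (lmono 1 (#|J| * k)%N%:Z *
      \sum_(i < k.+1) zcoef i (Fc (profile_step c J))).
Proof.
move=> k0 c0; apply: is_lsum_unique (is_lsum_zcoef_Fc c k) _.
have := is_lsum_sum_seq (index_enum {set 'I_r})
  (P := fun J => (J != finset.set0) && (J \subset support c))
  (fun J JP => is_lsumM ((-1) ^+ #|J|.-1)
     (is_lsum_first_parts k0 (proj2 (andP JP)))).
apply: eq_is_lsum => pi cpi.
have signE n : (-1) ^+ n = lmono ((-1) ^+ n) 0 :> laurent int.
  rewrite -[(-1) ^+ n in RHS]mulr1.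
  by elim: n => // n IH; rewrite exprS IH -[-1]/(- lmono 1 0) mulNr lmonoMM
     addr0 mul1r exprS -mulrA mulN1r; apply: laurentP => m /=; case: eqP; rewrite ?oppr0.
under eq_bigr => J _ do rewrite signE lmonoMM add0r.
rewrite sum_lmono; congr lmono; set K := [set i in support c | part (tnth pi i) 0 == k].
have [pik|pik] := boolP (maxpart pi <= k)%N; last first.
  rewrite big1 => [|J _]; last by rewrite mulr0.
  by case: eqP => // mk; rewrite mk leqnn in pik.
rewrite (max_first_part k0 c0 cpi pik) -/K -sum_sign_subsets [RHS]big_mkcond.
rewrite [LHS]big_mkcond; apply: eq_bigr => J _ /=.
have -> : (J \subset K) = (J \subset support c) &&
    [forall i in J, part (tnth pi i) 0 == k].
  apply/fintype.subsetP/andP => [JK|[/fintype.subsetP Jc /forall_inP Jk] i iJ].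
    split; [apply/fintype.subsetP|apply/forall_inP] => i /JK; by rewrite inE => /andP[].
  by rewrite inE Jc// Jk.
by case: (J != finset.set0); case: (J \subset support c); case: [forall i in J, _];
  rewrite //= ?mulr1 ?mulr0.
Qed.

Lemma zcoef0_Fc c : zcoef 0 (Fc c) = 1.
Proof.
pose e := [tuple nil : seq nat | i < r].
have e0 i : tnth e i = [::] by rewrite tnth_mktuple.
have ec : cylindric c e.
  by split=> [i|i j]; rewrite ?e0// /part !nth_nil.
have em : maxpart e = 0%N.
  by apply/eqP; rewrite -leqn0; apply/maxpart_leP => i x; rewrite e0.
have ew : weight e = 0%N.
  by rewrite /weight big1// => i _; rewrite e0 big_nil.
apply: is_lsum_unique (is_lsum_zcoef_Fc c 0) _; apply/is_lsumP => n.
exists [:: e]; split => //.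
- by move=> pi; rewrite inE => /eqP ->.
- move=> pi [pip cpi]; rewrite inE => pe.
  case: eqP => [m0|_]; last by move=> m _ /=; case: eqP.
  case/eqP: pe; apply: eq_from_tnth => i; rewrite e0.
  have /maxpart_leP/(_ i) := leq_trans (eq_leq m0) (leqnn 0).
  have /andP[_] := pip i; case: (tnth pi i) => // x s; rewrite inE negb_or.
  by case: x => // x _ /(_ x.+1); rewrite inE eqxx => /(_ isT).
- by rewrite big_seq1 em ew subrr.
Qed.

End Cylindric.

(** * The recurrence as a functional equation in z, for F_c and then for H_c *)

Lemma zcoef_qXM k m f : zcoef k (q ^+ m * f) = lmono 1 m%:Z * zcoef k f.
Proof.
by apply: laurentP => n; rewrite q_expE zcoefE !lmonoM !mul1r zcoefE.
Qed.

Lemma vanish_below_z : vanish_below 0 z.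
Proof. by move=> n n0 /=; rewrite lt_eqF. Qed.

Lemma vanish_below_zqX m : vanish_below 0 (z * q ^+ m).
Proof.
rewrite -[0]addr0; apply: vanish_belowM vanish_below_z _.
exact: vanish_belowW (vanish_belowX vanish_below_q).
Qed.

(** The constant term in q is 1 because the exponent of q is positive; 1 - z itself is not a unit of
    this ring. *)
Lemma subr1_zqX_unit m : 1 - z * q ^+ m.+1 \is a GRing.unit.
Proof.
have zq1 : vanish_below 1 (z * q ^+ m.+1).
  rewrite -[1]add0r; apply: vanish_belowM vanish_below_z _.
  exact: vanish_belowW (vanish_belowX vanish_below_q).
apply: lunit_coef0 => [n n0|]; first by rewrite coeflB coefl1 lt_eqF// zq1 ?subr0//; lia.
by rewrite coeflB coefl1 zq1// subr0.
Qed.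

(** Removing largest parts leaves a maximum that is at most k, hence partial sums of coefficients.
    They are generated by the quotient U, which satisfies U = f(z q^(m+1)) + z q^(m+1) U. *)
Lemma zcoef_zshift_div k m (f : laurent {poly int}) :
  zcoef k (iter m.+1 zshift f / (1 - z * q ^+ m.+1)) =
  lmono 1 (m.+1 * k)%N%:Z * \sum_(i < k.+1) zcoef i f.
Proof.
set U := _ / _; have mU := subr1_zqX_unit m.
have UE : U = iter m.+1 zshift f + z * (q ^+ m.+1 * U).
  apply/eqP; rewrite -subr_eq; apply/eqP.
  have -> : U - z * (q ^+ m.+1 * U) = U * (1 - z * q ^+ m.+1) by ring.
  by rewrite divrK.
elim: k => [|k IH].
  by rewrite UE zcoefD zcoef_iter_zshift zcoef0_mulz addr0 big_ord1.
rewrite UE zcoefD zcoef_iter_zshift zcoefS_mulz zcoef_qXM IH mulrA lmonoMM mulr1.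
rewrite -PoszD -mulnS -mulrDr; congr (_ * _).
by rewrite [RHS]big_ord_recr /= addrC.
Qed.

Lemma Fc_rec (r : nat) (c : r.-tuple nat) : support c != finset.set0 ->
  Fc c = \sum_(J : {set 'I_r} | (J != finset.set0) && (J \subset support c))
    (-1) ^+ #|J|.-1 *
      (iter #|J| zshift (Fc (profile_step c J)) / (1 - z * q ^+ #|J|)).
Proof.
move=> c0.
have zcoefZ k n (f : laurent {poly int}) :
    zcoef k ((-1) ^+ n * f) = (-1) ^+ n * zcoef k f.
  elim: n => [|n IH]; first by rewrite !mul1r.
  by rewrite !exprS !mulN1r !mulNr -IH; exact: raddfN.
have divE k (J : {set 'I_r}) (f : laurent {poly int}) : J != finset.set0 ->
    zcoef k (iter #|J| zshift f / (1 - z * q ^+ #|J|)) =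
    lmono 1 (#|J| * k)%N%:Z * \sum_(i < k.+1) zcoef i f.
  by rewrite -card_gt0; case: #|J| => // m _; apply: zcoef_zshift_div.
apply: zcoefP => k; rewrite zcoef_sum.
transitivity (\sum_(J : {set 'I_r} | (J != finset.set0) && (J \subset support c))
  (-1) ^+ #|J|.-1 * (lmono 1 (#|J| * k)%N%:Z *
      \sum_(i < k.+1) zcoef i (Fc (profile_step c J)))); last first.
  by apply: eq_bigr => J /andP[J0 _]; rewrite zcoefZ divE.
(* At k = 0 there is no largest part to remove; every coefficient involved is 1 and the signs alone
   sum to 1. *)
case: k => [|k]; last exact: zcoef_Fc.
under eq_bigr => J _ do
  rewrite big_ord1 zcoef0_Fc muln0 -[lmono 1 0]/(1 : laurent int) !mulr1.
have signE n : (-1) ^+ n = ((-1) ^+ n : int)%:~R :> laurent int.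
  by rewrite rmorphXn /= rmorphN1.
under eq_bigr => J _ do rewrite signE.
by rewrite -rmorph_sum /= sum_sign_subsets c0 zcoef0_Fc.
Qed.

Lemma qpoch_inf_zq : qpoch_inf (z * q) = (1 - z * q) * zshift (qpoch_inf (z * q)).
Proof.
have zq0 : vanish_below 0 (z * q) by have := vanish_below_zqX 1; rewrite expr1.
apply: laurentP => n.
have [N _ hN] := lcvg_qpoch zq0 n.
rewrite -(hN N.+1 (leqnSn N) n (lexx n)).
have -> : qpoch (z * q) N.+1 = (1 - z * q) * zshift (qpoch (z * q) N).
  rewrite /qpoch big_nat_recl//= expr0 mulr1 rmorph_prod /=; congr (_ * _).
  apply: eq_bigr => i _; rewrite rmorphB rmorph1 !rmorphM rmorphXn /=.
  by rewrite zshift_z zshift_q exprS; congr (1 - _); ring.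
apply/eqP; rewrite -subr_eq0 -coeflB -mulrBr; apply/eqP.
have -> : zshift (qpoch (z * q) N) - zshift (qpoch_inf (z * q)) =
  zshift (qpoch (z * q) N - qpoch_inf (z * q)) by rewrite rmorphB.
have : vanish_below (0 + (n + 1)) ((1 - z * q) *
    zshift (qpoch (z * q) N - qpoch_inf (z * q))).
  apply: vanish_belowM.
    by apply: vanish_belowB => //; apply: vanish_below1.
  apply: vanish_below_zshift => m mn; rewrite coeflB (hN N (leqnn N)) ?subrr//.
  lia.
by apply; lia.
Qed.

Lemma iter_zshiftM m (f g : laurent {poly int}) :
  iter m zshift (f * g) = iter m zshift f * iter m zshift g.
Proof. by elim: m => //= m ->; rewrite rmorphM. Qed.

Lemma iter_zshift_subr1_zq m : iter m zshift (1 - z * q) = 1 - z * q * q ^+ m.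
Proof.
elim: m => [|m IH]; first by rewrite mulr1.
rewrite iterS IH rmorphB rmorph1 !rmorphM rmorphXn /= zshift_z zshift_q exprS.
by congr (1 - _); ring.
Qed.

Lemma qpoch_inf_zq_iter m :
  qpoch_inf (z * q) = qpoch (z * q) m * iter m zshift (qpoch_inf (z * q)).
Proof.
elim: m => [|m IH]; first by rewrite /qpoch big_geq// mul1r.
rewrite {1}IH {1}qpoch_inf_zq iter_zshiftM iter_zshift_subr1_zq.
by rewrite -iterSr mulrA; congr (_ * _); rewrite qpochS mulrBr mulr1.
Qed.

Lemma zshift_qpoch_inf : zshift (qpoch_inf q) = qpoch_inf q.
Proof.
have q0 := vanish_belowW ler01 vanish_below_q.
apply: laurentP => n; have [N _ hN] := lcvg_qpoch q0 n.
rewrite -(hN N (leqnn N) n (lexx n)) -[in RHS]zshift_qpoch.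
apply/eqP; rewrite -subr_eq0 -coeflB -rmorphB; apply/eqP.
have /vanish_below_zshift : vanish_below (n + 1) (qpoch_inf q - qpoch q N).
  by move=> m mn; rewrite coeflB (hN N (leqnn N)) ?subrr//; lia.
by apply; lia.
Qed.

Lemma iter_zshift_qpoch_infV m : iter m zshift (qpoch_inf q)^-1 = (qpoch_inf q)^-1.
Proof.
elim: m => //= m ->.
by rewrite rmorphV ?qpoch_inf_unit//= zshift_qpoch_inf.
Qed.

(** With m the size of J, (zq; q)_oo is (zq; q)_m times its own value at z q^m. The last factor 1 -
    z q^m of the finite product cancels the denominator in [Fc_rec] and leaves (zq; q)_(m-1). *)
Lemma Hc_rec (r : nat) (c : r.-tuple nat) : support c != finset.set0 ->
  Hc c = \sum_(J : {set 'I_r} | (J != finset.set0) && (J \subset support c))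
    (-1) ^+ #|J|.-1 * qpoch (z * q) #|J|.-1 *
      iter #|J| zshift (Hc (profile_step c J)).
Proof.
move=> c0; rewrite {1}/Hc {1}(Fc_rec c0) mulr_sumr; apply: eq_bigr => J.
rewrite -card_gt0 => /andP[]; case: #|J| => // m _ _; rewrite [m.+1.-1]/=.
rewrite /Hc !iter_zshiftM iter_zshift_qpoch_infV.
rewrite {1}(qpoch_inf_zq_iter m.+1) qpochS.
have -> : qpoch (z * q) m - qpoch (z * q) m * (z * q * q ^+ m) =
  qpoch (z * q) m * (1 - z * q ^+ m.+1) by rewrite exprS; ring.
have mU := subr1_zqX_unit m.
move: (iter m.+1 zshift (qpoch_inf _)) (iter m.+1 zshift (Fc _)) (qpoch_inf q)^-1.
move: (qpoch _ m) (1 - z * q ^+ m.+1) mU => A B BU C F V.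
by rewrite -[RHS](mulrK BU); ring.
Qed.

Lemma ordS_inj_tuple (r : nat) (T : Type) (s t : r.-tuple T) :
  (forall i, tnth s (ordS i) = tnth t (ordS i)) -> s = t.
Proof.
by move=> st; apply: eq_from_tnth => i; rewrite -(ord_predK i); apply: st.
Qed.

Lemma Fc_rotate (r : nat) (c : r.-tuple nat) :
  Fc [tuple tnth c (ordS i) | i < r] = Fc c.
Proof.
set c' := [tuple _ | i < r].
pose h (pi : r.-tuple (seq nat)) := [tuple tnth pi (ordS i) | i < r].
pose g (pi : r.-tuple (seq nat)) := [tuple tnth pi (ord_pred i) | i < r].
have gK pi : h (g pi) = pi.
  by apply: eq_from_tnth => i; rewrite !tnth_mktuple ordSK.
have hK pi : g (h pi) = pi.
  by apply: eq_from_tnth => i; rewrite !tnth_mktuple ord_predK.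
have wh pi : weight (h pi) = weight pi.
  rewrite /weight [RHS](reindex_inj (can_inj (@ordSK r))) /=.
  by apply: eq_bigr => i _; rewrite tnth_mktuple.
have mh pi : maxpart (h pi) = maxpart pi.
  rewrite /maxpart [RHS](reindex_inj (can_inj (@ordSK r))) /=.
  by apply: eq_bigr => i _; rewrite tnth_mktuple.
apply: is_lsum_unique (Fc_summable c') _.
apply: (is_lsum_image (h := h)) (Fc_summable c).
- move=> pi [pip cpi]; split=> [i|i j]; rewrite !tnth_mktuple//; exact: cpi.
- by move=> pi pi' _ _ /(congr1 g); rewrite !hK.
- by move=> pi _; rewrite mh wh.
- move=> pi [pip cpi] np; case: (np (g pi)); last exact: gK.
  split=> [i|i j]; first by rewrite tnth_mktuple.
  have := cpi (ord_pred i) j; rewrite !tnth_mktuple ordSK.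
  by rewrite ord_predK.
Qed.

Lemma Hc_rotate (r : nat) (c : r.-tuple nat) :
  Hc [tuple tnth c (ordS i) | i < r] = Hc c.
Proof. by rewrite /Hc Fc_rotate. Qed.

(** * Formal combinations of the sums S13 *)

Definition triple := (int * int * int)%type.

(* The monomial z^i q^j S13 rho sigma is encoded by (i, j, rho, sigma). *)
Definition mono := (nat * int * triple * triple)%type.
Definition form := seq (mono * int).
(* The term c z^i q^j of a coefficient is encoded by (c, i, j). *)
Definition coef := seq (int * nat * int).

Definition cm (c : int) (i : nat) (j : int) : int * nat * int := (c, i, j).
Definition fm (c : int) (i : nat) (j : int) (rho sigma : triple) : mono * int :=
  (i, j, rho, sigma, c).
Arguments cm c%_Z i%_N j%_Z.
Arguments fm c%_Z i%_N j%_Z rho%_Z sigma%_Z.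

Definition add_triple (a b : triple) : triple :=
  (a.1.1 + b.1.1, a.1.2 + b.1.2, a.2 + b.2).

Definition mono_val (m : mono) : laurent {poly int} :=
  let: (i, j, rho, sigma) := m in z ^+ i * q ^ j * S13 rho sigma.

Definition form_val (f : form) : laurent {poly int} :=
  \sum_(x <- f) x.2%:~R * mono_val x.1.

Definition form_scale (c : coef) (f : form) : form :=
  [seq (y.1.2 + x.1.1.1.1, y.2 + x.1.1.1.2, x.1.1.2, x.1.2, y.1.1 * x.2)
  | y <- c, x <- f].

Definition coef_val (c : coef) : laurent {poly int} :=
  \sum_(y <- c) y.1.1%:~R * z ^+ y.1.2 * q ^ y.2.

(* The substitution z -> z q^n. *)
Definition form_shift (n : int) (f : form) : form :=
  [seq (x.1.1.1.1, x.1.1.1.2 + n * x.1.1.1.1%:Z,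
        add_triple x.1.1.2 (n, 0, 0), x.1.2, x.2) | x <- f].

Definition coef_shift (n : int) (c : coef) : coef :=
  [seq (y.1.1, y.1.2, y.2 + n * y.1.2%:Z) | y <- c].

Fixpoint insert_mono (x : mono * int) (f : form) : form :=
  if f is y :: f' then
    if x.1 == y.1 then (y.1, x.2 + y.2) :: f' else y :: insert_mono x f'
  else [:: x].

(** Distinct symbols are treated as independent, so this is a computable sufficient condition for
    the value 0. *)
Definition vanishing (f : form) : bool :=
  all (fun x => x.2 == 0) (foldr insert_mono [::] f).

(** The shift n ranges over all integers, negative ones included, so that an equation can be reused
    at z/q. *)
Definition null (f : form) : Prop := forall n, form_val (form_shift n f) = 0.

Lemma form_val_cat f g : form_val (f ++ g) = form_val f + form_val g.
Proof. exact: big_cat. Qed.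

Lemma sum_insert_mono (v : mono -> laurent {poly int}) x f :
  \sum_(y <- insert_mono x f) y.2%:~R * v y.1 =
  x.2%:~R * v x.1 + \sum_(y <- f) y.2%:~R * v y.1.
Proof.
elim: f => [|y f IH] /=; first by rewrite big_seq1 big_nil addr0.
case: eqP => [xy|_]; rewrite !big_cons /=.
  by rewrite rmorphD mulrDl xy addrA.
by rewrite IH addrCA.
Qed.

(** The valuation [v] of symbols is arbitrary because symbols are collected once, before any shift,
    and the result must vanish after every shift. *)
Lemma vanishing_sum (v : mono -> laurent {poly int}) f :
  vanishing f -> \sum_(x <- f) x.2%:~R * v x.1 = 0.
Proof.
rewrite /vanishing => /allP f0.
have <- : \sum_(x <- foldr insert_mono [::] f) x.2%:~R * v x.1 =
    \sum_(x <- f) x.2%:~R * v x.1.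
  elim: f {f0} => [|x f IH] /=; first by rewrite !big_nil.
  by rewrite sum_insert_mono IH big_cons.
by rewrite big1_seq// => x /f0/eqP ->; rewrite mul0r.
Qed.

Lemma vanishing_null f : vanishing f -> null f.
Proof.
move=> f0 n; rewrite /form_val big_map.
exact: (vanishing_sum (fun m => mono_val
  (m.1.1.1, m.1.1.2 + n * m.1.1.1%:Z, add_triple m.1.2 (n, 0, 0), m.2))).
Qed.

Lemma form_shift_cat n f g : form_shift n (f ++ g) = form_shift n f ++ form_shift n g.
Proof. exact: map_cat. Qed.

Lemma null_cat f g : null f -> null g -> null (f ++ g).
Proof. by move=> f0 g0 n; rewrite form_shift_cat form_val_cat f0 g0 addr0. Qed.

Lemma null_catl f g : null f -> null (f ++ g) -> null g.
Proof.
by move=> f0 gf0 n; have := gf0 n; rewrite form_shift_cat form_val_cat f0 add0r.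
Qed.

Lemma form_val_scale c f : form_val (form_scale c f) = coef_val c * form_val f.
Proof.
rewrite /form_val /form_scale big_allpairs_dep /= /coef_val mulr_suml.
apply: eq_bigr => y _; rewrite mulr_sumr; apply: eq_bigr => x _ /=.
case: x => [[[[i j] rho] sigma] k] /=; rewrite exprD q_expzD rmorphM /=; ring.
Qed.

Lemma form_shift_scale n c f :
  form_shift n (form_scale c f) = form_scale (coef_shift n c) (form_shift n f).
Proof.
rewrite /form_shift /form_scale /coef_shift map_allpairs allpairs_mapl allpairs_mapr.
apply: eq_allpairs => y x /=; congr (_, _, _, _, _); rewrite PoszD; ring.
Qed.

Lemma null_scale c f : null f -> null (form_scale c f).
Proof.
by move=> f0 n; rewrite form_shift_scale form_val_scale f0 mulr0.
Qed.

(** From f = z c f, the coefficient of z^0 in f is 0 and each later one is a combination of earlier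
    ones. This replaces division by 1 - z c, which need not be a unit. *)
Lemma subr1_zq_lreg c (f : laurent {poly int}) : (1 - z * c) * f = 0 -> f = 0.
Proof.
move/eqP; rewrite mulrBl mul1r subr_eq0 -mulrA => /eqP fE.
suff f0 k j : (j <= k)%N -> zcoef j f = 0.
  by apply: zcoefP => k; rewrite (f0 k)// [RHS]raddf0.
elim: k j => [|k IH] [|j] // jk; rewrite fE ?zcoef0_mulz// zcoefS_mulz zcoefM.
by rewrite big1// => i _; rewrite (IH (j - i)%N) ?mulr0//; lia.
Qed.

(** The shift by n turns the factor into 1 - z q^(m + n), which is regular for every integer n. *)
Lemma null_unscale (m : int) f :
  null (form_scale [:: cm 1 0 0; cm (-1) 1 m] f) -> null f.
Proof.
move=> f0 n; have := f0 n; rewrite form_shift_scale form_val_scale.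
rewrite /coef_val !big_cons big_nil /= addr0 => cf0.
apply: (@subr1_zq_lreg (q ^ (m + n))); rewrite -[RHS]cf0; congr (_ * _).
by rewrite mulr0 addr0 mulr1 expr0 mulr1 expr1 mulN1r mulNr !mulr1.
Qed.

(* The relations S13_r1, S13_r2, S13_r3, S13_s1, S13_s2, S13_s3 at (rho, sigma),
   numbered from 1 to 6. *)
Definition relation (k : nat) (rho sigma : triple) : form :=
  let: (a1, a2, a3) := rho in let: (b1, b2, b3) := sigma in
  match k with
  | 1%N => [:: (0%N, 0, (a1, a2, a3), (b1, b2, b3), 1);
      (0%N, 0, (a1 + 1, a2 - 1, a3), (b1, b2, b3), -1);
      (1%N, 1 + a1, (a1 + 2, a2, a3), (b1 - 1, b2, b3), -1)]
  | 2%N => [:: (0%N, 0, (a1, a2, a3), (b1, b2, b3), 1);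
      (0%N, 0, (a1, a2 + 1, a3 - 1), (b1, b2, b3), -1);
      (1%N, 2 + a1 + a2, (a1 + 2, a2 + 2, a3), (b1 - 1, b2 - 1, b3), -1)]
  | 3%N => [:: (0%N, 0, (a1, a2, a3), (b1, b2, b3), 1);
      (0%N, 0, (a1, a2, a3 + 1), (b1, b2, b3), -1);
      (0%N, 1, (a1, a2, a3 + 1), (b1, b2, b3 + 1), -1);
      (0%N, 1, (a1, a2, a3 + 2), (b1, b2, b3 + 1), 1);
      (1%N, 3 + a1 + a2 + a3, (a1 + 2, a2 + 2, a3 + 2),
        (b1 - 1, b2 - 1, b3 - 1), -1)]
  | 4%N => [:: (0%N, 0, (a1, a2, a3), (b1, b2, b3), 1);
      (0%N, 0, (a1, a2, a3), (b1 + 1, b2 - 1, b3), -1);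
      (0%N, 1 + b1, (a1 - 1, a2, a3), (b1 + 2, b2, b3), -1)]
  | 5%N => [:: (0%N, 0, (a1, a2, a3), (b1, b2, b3), 1);
      (0%N, 0, (a1, a2, a3), (b1, b2 + 1, b3 - 1), -1);
      (0%N, 2 + b1 + b2, (a1 - 1, a2 - 1, a3), (b1 + 2, b2 + 2, b3), -1)]
  | 6%N => [:: (0%N, 0, (a1, a2, a3), (b1, b2, b3), 1);
      (0%N, 0, (a1, a2, a3), (b1, b2, b3 + 1), -1);
      (0%N, 1, (a1, a2, a3 + 1), (b1, b2, b3 + 1), -1);
      (0%N, 1, (a1, a2, a3 + 1), (b1, b2, b3 + 2), 1);
      (0%N, 3 + b1 + b2 + b3, (a1 - 1, a2 - 1, a3 - 1),
        (b1 + 2, b2 + 2, b3 + 2), -1)]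
  | _ => [::]
  end.

Lemma form_val_relation k rho sigma : form_val (relation k rho sigma) = 0.
Proof.
case: rho sigma => [[a1 a2] a3] [[b1 b2] b3].
have v00 a b : mono_val (0%N, 0, a, b) = S13 a b.
  by rewrite /mono_val expr0 expr0z !mul1r.
have v0 e a b : mono_val (0%N, e, a, b) = q ^ e * S13 a b.
  by rewrite /mono_val expr0 mul1r.
have v1 e a b : mono_val (1%N, e, a, b) = z * q ^ e * S13 a b by [].
rewrite /form_val; case: k => [|[|[|[|[|[|[|k]]]]]]]; rewrite ?big_nil//;
  rewrite !big_cons big_nil ?v00 ?v0 ?v1 ?mulr1z ?mulrN1z ?mul1r ?mulN1r addr0.
- by rewrite -S13_r1 addrA subrr.
- by rewrite -S13_r2 addrA subrr.
- by rewrite -S13_r3 expr1z; ring.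
- by rewrite -S13_s1 addrA subrr.
- by rewrite -S13_s2 addrA subrr.
- by rewrite -S13_s3 expr1z; ring.
Qed.

Lemma null_relation k rho sigma : null (relation k rho sigma).
Proof.
move=> n.
suff -> : form_shift n (relation k rho sigma) =
    relation k (add_triple rho (n, 0, 0)) sigma by exact: form_val_relation.
case: rho sigma => [[a1 a2] a3] [[b1 b2] b3].
case: k => [|[|[|[|[|[|[|k]]]]]]] //=; rewrite /form_shift /add_triple /=;
  by do ![apply: (congr2 cons); [congr (_, _, (_, _, _), _, _); ring|]].
Qed.

(** * Three-row profiles and their equations as formal combinations *)

Definition profile := (nat * nat * nat)%type.

Definition step (c : profile) (J : bool * bool * bool) : profile :=
  let: (c1, c2, c3) := c in let: (j1, j2, j3) := J in
  (c1 + (j3 && ~~ j1) - (j1 && ~~ j3), c2 + (j1 && ~~ j2) - (j2 && ~~ j1),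
   c3 + (j2 && ~~ j3) - (j3 && ~~ j2))%N.

Definition admissible (c : profile) (J : bool * bool * bool) : bool :=
  let: (c1, c2, c3) := c in let: (j1, j2, j3) := J in
  [&& j1 ==> (0 < c1), j2 ==> (0 < c2) & j3 ==> (0 < c3)]%N.

Definition card3 (J : bool * bool * bool) : nat := (J.1.1 + J.1.2 + J.2)%N.

Definition nonempty_subsets : seq (bool * bool * bool) :=
  [:: (true, false, false); (false, true, false); (false, false, true);
      (true, true, false); (true, false, true); (false, true, true);
      (true, true, true)].

Definition rotate (c : profile) : profile := (c.1.2, c.2, c.1.1).

Definition rel_step := (coef * nat * triple * triple)%type.
Definition rs (c : coef) (k : nat) (rho sigma : triple) : rel_step :=
  (c, k, rho, sigma).
Arguments rs c k%_N rho%_Z sigma%_Z.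

Definition combine (s : seq rel_step) : form :=
  flatten [seq form_scale x.1.1.1 (relation x.1.1.2 x.1.2 x.2) | x <- s].

Lemma null_combine s : null (combine s).
Proof.
elim: s => [|x s IH]; first exact: vanishing_null.
by apply: null_cat => //; apply/null_scale/null_relation.
Qed.

(** The shape of a certificate: after collecting symbols, f is the combination [s] of contiguous
    relations plus the part [e] already known to be null. *)
Lemma null_by s e f : null e ->
  vanishing (form_scale [:: cm (-1) 0 0] (combine s ++ e) ++ f) -> null f.
Proof.
move=> e0 /vanishing_null; apply: null_catl; apply: null_scale.
by apply: null_cat => //; apply: null_combine.
Qed.

(** The right-hand sides of the theorem, multiplied out, one for each rotation class of profiles of
    sum 10. *)
Definition H_table : seq (profile * form) := [::
  ((10, 0, 0), [::
    fm 1 0 0 (1, 1, 1) (1, 1, 1)]);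
  ((9, 1, 0), [::
    fm 1 0 0 (0, 1, 1) (1, 1, 1)]);
  ((9, 0, 1), [::
    fm 1 0 0 (1, 1, 1) (0, 1, 1); fm (-1) 0 1 (2, 1, 1) (1, 1, 1);
    fm 1 1 1 (2, 1, 1) (1, 1, 1)]);
  ((8, 2, 0), [::
    fm 1 0 0 (0, 0, 1) (1, 1, 1)]);
  ((8, 1, 1), [::
    fm 1 0 0 (0, 1, 1) (0, 1, 1); fm (-1) 0 1 (1, 1, 1) (1, 1, 1)]);
  ((8, 0, 2), [::
    fm 1 0 0 (1, 1, 1) (0, 0, 1); fm (-1) 0 1 (2, 1, 1) (0, 1, 1);
    fm 1 1 1 (2, 1, 1) (0, 1, 1)]);
  ((7, 3, 0), [::
    fm 1 0 0 (0, 0, 0) (1, 1, 1)]);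
  ((7, 2, 1), [::
    fm 1 0 0 (0, 0, 1) (0, 1, 1); fm (-1) 0 1 (0, 1, 1) (1, 1, 1)]);
  ((7, 1, 2), [::
    fm 1 0 0 (0, 1, 1) (0, 0, 1); fm (-1) 0 1 (1, 1, 1) (0, 1, 1)]);
  ((7, 0, 3), [::
    fm 1 0 0 (1, 1, 1) (0, 0, 0); fm (-1) 0 1 (2, 1, 1) (0, 0, 1);
    fm 1 1 1 (2, 1, 1) (0, 0, 1)]);
  ((6, 3, 1), [::
    fm 1 0 0 (0, 0, 0) (0, 1, 1); fm (-1) 0 1 (0, 0, 1) (1, 1, 1)]);
  ((6, 2, 2), [::
    fm 1 0 0 (0, 0, 1) (0, 0, 1); fm (-1) 0 1 (0, 1, 1) (0, 1, 1)]);
  ((6, 1, 3), [::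
    fm 1 0 0 (0, 1, 1) (0, 0, 0); fm (-1) 0 1 (1, 1, 1) (0, 0, 1)]);
  ((5, 3, 2), [::
    fm 1 0 0 (0, 0, 0) (0, 0, 1); fm (-1) 0 1 (0, 0, 1) (0, 1, 1)]);
  ((5, 2, 3), [::
    fm 1 0 0 (0, 0, 1) (0, 0, 0); fm (-1) 0 1 (0, 1, 1) (0, 0, 1)]);
  ((4, 3, 3), [::
    fm 1 0 0 (0, 0, 0) (0, 0, 0); fm (-1) 0 1 (0, 0, 1) (0, 0, 1)]);
  ((6, 4, 0), [::
    fm 1 0 0 (-1, 0, 0) (1, 1, 1); fm (-1) 0 0 (0, 0, 1) (0, 1, 1);
    fm 1 0 1 (0, 1, 1) (1, 1, 1); fm 1 0 0 (1, 0, 0) (0, 1, 1);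
    fm (-1) 1 0 (1, 0, 0) (0, 1, 1); fm (-1) 0 1 (1, 0, 1) (1, 1, 1);
    fm 1 1 1 (1, 0, 1) (1, 1, 1)]);
  ((5, 5, 0), [::
    fm 1 0 0 (-2, 0, 0) (1, 1, 1); fm (-1) 0 0 (-1, 0, 1) (0, 1, 1);
    fm 1 0 1 (-1, 1, 1) (1, 1, 1); fm 1 0 0 (0, 0, 0) (0, 1, 1);
    fm (-1) 1 (-1) (0, 0, 0) (0, 1, 1); fm (-1) 1 0 (0, 0, 0) (0, 1, 1);
    fm (-1) 0 1 (0, 0, 1) (1, 1, 1); fm 1 1 0 (0, 0, 1) (1, 1, 1);
    fm 1 1 1 (0, 0, 1) (1, 1, 1); fm (-1) 1 1 (1, 0, 0) (1, 1, 1);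
    fm 1 2 1 (1, 0, 0) (1, 1, 1); fm (-1) 0 0 (1, 0, 1) (0, 0, 1);
    fm 1 1 0 (1, 0, 1) (0, 0, 1); fm 1 0 1 (1, 1, 1) (0, 1, 1);
    fm (-1) 1 1 (1, 1, 1) (0, 1, 1); fm 1 0 0 (2, 0, 0) (0, 0, 1);
    fm (-1) 1 0 (2, 0, 0) (0, 0, 1); fm (-1) 1 1 (2, 0, 0) (0, 0, 1);
    fm 1 2 1 (2, 0, 0) (0, 0, 1); fm (-1) 0 1 (2, 0, 1) (0, 1, 1);
    fm 1 1 1 (2, 0, 1) (0, 1, 1); fm 1 1 2 (2, 0, 1) (0, 1, 1);
    fm (-1) 2 2 (2, 0, 1) (0, 1, 1)]);
  ((5, 4, 1), [::
    fm 1 0 0 (-1, 0, 0) (0, 1, 1); fm (-1) 0 1 (-1, 0, 1) (1, 1, 1);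
    fm (-1) 1 0 (0, 0, 0) (1, 1, 1); fm (-1) 0 0 (0, 0, 1) (0, 0, 1);
    fm 1 0 1 (0, 1, 1) (0, 1, 1); fm 1 0 0 (1, 0, 0) (0, 0, 1);
    fm (-1) 1 0 (1, 0, 0) (0, 0, 1); fm (-1) 0 1 (1, 0, 1) (0, 1, 1);
    fm 1 1 1 (1, 0, 1) (0, 1, 1)]);
  ((4, 4, 2), [::
    fm 1 0 0 (-1, 0, 0) (0, 0, 1); fm (-1) 0 1 (-1, 0, 1) (0, 1, 1);
    fm (-1) 1 0 (0, 0, 0) (0, 1, 1); fm (-1) 0 0 (0, 0, 1) (0, 0, 0);
    fm 1 1 1 (0, 0, 1) (1, 1, 1); fm 1 0 1 (0, 1, 1) (0, 0, 1);
    fm 1 0 0 (1, 0, 0) (0, 0, 0); fm (-1) 1 0 (1, 0, 0) (0, 0, 0);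
    fm (-1) 1 1 (1, 0, 0) (1, 1, 1); fm 1 2 1 (1, 0, 0) (1, 1, 1);
    fm (-1) 0 1 (1, 0, 1) (0, 0, 1); fm 1 1 1 (1, 0, 1) (0, 0, 1)]);
  ((5, 1, 4), [::
    fm 1 0 0 (-1, 0, 1) (0, 0, 0); fm (-1) 0 1 (-1, 1, 1) (0, 0, 1);
    fm (-1) 0 0 (0, 0, 0) (0, 0, 0); fm 1 0 0 (0, 0, 0) (0, 0, 1);
    fm (-1) 1 0 (0, 0, 0) (0, 0, 1); fm (-1) 0 0 (0, 0, 1) (0, 0, 1);
    fm 1 0 1 (0, 0, 1) (0, 0, 1); fm (-1) 0 1 (0, 0, 1) (0, 1, 1);
    fm 1 1 1 (0, 0, 1) (0, 1, 1); fm 1 0 1 (0, 1, 1) (0, 1, 1);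
    fm 1 0 0 (1, 0, 0) (0, 0, 1); fm (-1) 1 0 (1, 0, 0) (0, 0, 1);
    fm (-1) 1 1 (1, 0, 0) (0, 1, 1); fm 1 2 1 (1, 0, 0) (0, 1, 1);
    fm (-1) 0 0 (1, 0, 1) (0, 0, 0); fm 1 1 0 (1, 0, 1) (0, 0, 0);
    fm (-1) 0 1 (1, 0, 1) (0, 1, 1); fm 1 1 1 (1, 0, 1) (0, 1, 1);
    fm 1 1 2 (1, 0, 1) (1, 1, 1); fm (-1) 2 2 (1, 0, 1) (1, 1, 1);
    fm 1 0 0 (1, 1, 1) (0, 0, 0); fm (-1) 1 0 (1, 1, 1) (0, 0, 0);
    fm 1 0 1 (1, 1, 1) (0, 0, 1); fm (-1) 1 1 (1, 1, 1) (0, 0, 1);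
    fm 1 0 0 (2, 0, 0) (0, 0, 0); fm (-1) 1 0 (2, 0, 0) (0, 0, 0);
    fm (-1) 1 1 (2, 0, 0) (0, 0, 0); fm 1 2 1 (2, 0, 0) (0, 0, 0);
    fm (-1) 1 2 (2, 0, 0) (1, 1, 1); fm 1 2 2 (2, 0, 0) (1, 1, 1);
    fm 1 2 3 (2, 0, 0) (1, 1, 1); fm (-1) 3 3 (2, 0, 0) (1, 1, 1);
    fm (-1) 0 0 (2, 0, 1) (0, 0, 0); fm 1 1 0 (2, 0, 1) (0, 0, 0);
    fm 1 1 1 (2, 0, 1) (0, 0, 0); fm (-1) 2 1 (2, 0, 1) (0, 0, 0);
    fm (-1) 0 1 (2, 0, 1) (0, 0, 1); fm 1 1 1 (2, 0, 1) (0, 0, 1);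
    fm 1 1 2 (2, 0, 1) (0, 0, 1); fm (-1) 2 2 (2, 0, 1) (0, 0, 1);
    fm (-1) 1 2 (2, 1, 1) (0, 0, 1); fm 1 2 2 (2, 1, 1) (0, 0, 1)]);
  ((6, 0, 4), [::
    fm 1 0 0 (0, 0, 1) (0, 0, 0); fm (-1) 0 1 (0, 1, 1) (0, 0, 1);
    fm (-1) 0 0 (1, 0, 0) (0, 0, 0); fm 1 0 0 (1, 0, 0) (0, 0, 1);
    fm (-1) 1 1 (1, 0, 0) (0, 0, 1); fm (-1) 0 0 (1, 0, 1) (0, 0, 1);
    fm 1 0 1 (1, 0, 1) (0, 0, 1); fm (-1) 0 1 (1, 0, 1) (0, 1, 1);
    fm 1 1 2 (1, 0, 1) (0, 1, 1); fm 1 0 1 (1, 1, 1) (0, 1, 1);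
    fm 1 0 0 (2, 0, 0) (0, 0, 1); fm (-1) 1 1 (2, 0, 0) (0, 0, 1);
    fm (-1) 1 2 (2, 0, 0) (0, 1, 1); fm 1 2 3 (2, 0, 0) (0, 1, 1);
    fm (-1) 0 0 (2, 0, 1) (0, 0, 0); fm 1 1 1 (2, 0, 1) (0, 0, 0);
    fm (-1) 0 1 (2, 0, 1) (0, 1, 1); fm 1 1 2 (2, 0, 1) (0, 1, 1);
    fm 1 1 3 (2, 0, 1) (1, 1, 1); fm (-1) 2 4 (2, 0, 1) (1, 1, 1);
    fm 1 0 0 (2, 1, 1) (0, 0, 0); fm 1 0 1 (2, 1, 1) (0, 0, 1);
    fm (-1) 1 2 (2, 1, 1) (0, 0, 1); fm 1 0 0 (3, 0, 0) (0, 0, 0);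
    fm (-1) 1 1 (3, 0, 0) (0, 0, 0); fm (-1) 1 2 (3, 0, 0) (0, 0, 0);
    fm 1 2 3 (3, 0, 0) (0, 0, 0); fm (-1) 1 3 (3, 0, 0) (1, 1, 1);
    fm 1 2 4 (3, 0, 0) (1, 1, 1); fm 1 2 5 (3, 0, 0) (1, 1, 1);
    fm (-1) 3 6 (3, 0, 0) (1, 1, 1); fm (-1) 0 0 (3, 0, 1) (0, 0, 0);
    fm 1 1 1 (3, 0, 1) (0, 0, 0); fm 1 1 2 (3, 0, 1) (0, 0, 0);
    fm (-1) 2 3 (3, 0, 1) (0, 0, 0); fm (-1) 0 1 (3, 0, 1) (0, 0, 1);
    fm 1 1 2 (3, 0, 1) (0, 0, 1); fm 1 1 3 (3, 0, 1) (0, 0, 1);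
    fm (-1) 2 4 (3, 0, 1) (0, 0, 1); fm (-1) 1 3 (3, 1, 1) (0, 0, 1);
    fm 1 2 4 (3, 1, 1) (0, 0, 1)])].


Definition profiles : seq profile := [seq x.1 | x <- H_table].

(** The last branch is a default; that it too lands in [profiles] whenever it is reached from a
    listed profile is checked by computation in [Hc_H_form]. *)
Definition canon (c : profile) : profile :=
  if c \in profiles then c
  else if rotate c \in profiles then rotate c else rotate (rotate c).

Definition moves (c : profile) : seq (nat * profile) :=
  [seq (card3 J, canon (step c J)) | J <- nonempty_subsets & admissible c J].

Definition H_form (c : profile) : form :=
  nth [::] [seq x.2 | x <- H_table] (index c profiles).

(** The product (-1)^(m-1) (zq; q)_(m-1) multiplied out for m = 1, 2, 3. *)
Definition move_coef (m : nat) : coef :=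
  match m with
  | 1%N => [:: cm 1 0 0]
  | 2%N => [:: cm (-1) 0 0; cm 1 1 1]
  | _ => [:: cm 1 0 0; cm (-1) 1 1; cm (-1) 1 2; cm 1 2 3]
  end.

(** Left side minus right side of the recurrence for H_c, with the claimed right-hand sides
    substituted for H. *)
Definition target (c : profile) : form :=
  H_form c ++ form_scale [:: cm (-1) 0 0] (flatten
    [seq form_scale (move_coef x.1) (form_shift x.1%:Z (H_form x.2)) | x <- moves c]).

Definition extra (t : seq (coef * profile * int)) : form :=
  flatten [seq form_scale x.1.1 (form_shift x.2 (target x.1.2)) | x <- t].

Definition ex (c : coef) (d : profile) (n : int) : coef * profile * int := (c, d, n).
Arguments ex c d%_N n%_Z.

(** * Certificates: explicit combinations of contiguous relations *)

Definition cert_910 : seq rel_step := [::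
  rs [:: cm 1 0 0] 1 (0, 1, 1) (1, 1, 1)].

Definition cert_820 : seq rel_step := [::
  rs [:: cm 1 0 0] 1 (0, 0, 1) (1, 1, 1);
  rs [:: cm (-1) 0 0] 1 (1, 1, 1) (0, 1, 1);
  rs [:: cm 1 0 0] 2 (1, -1, 1) (1, 1, 1);
  rs [:: cm (-1) 1 2] 4 (3, 1, 1) (-1, 1, 1)].

Definition cert_811 : seq rel_step := [::
  rs [:: cm 1 0 0] 1 (0, 1, 1) (0, 1, 1);
  rs [:: cm (-1) 0 0; cm 1 1 1] 1 (1, 1, 1) (1, 1, 1);
  rs [:: cm 1 1 1] 4 (2, 1, 1) (-1, 1, 1)].

Definition cert_712 : seq rel_step := [::
  rs [:: cm 1 0 0] 1 (0, 1, 1) (0, 0, 1);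
  rs [:: cm (-1) 1 2] 1 (0, 1, 1) (2, 1, 1);
  rs [:: cm (-1) 0 0; cm 1 1 1] 1 (1, 1, 1) (0, 1, 1);
  rs [:: cm (-1) 1 1] 4 (1, 1, 1) (0, 1, 1);
  rs [:: cm 1 1 1] 4 (2, 1, 1) (-1, 0, 1);
  rs [:: cm (-1) 1 2; cm 1 2 3] 4 (3, 1, 1) (-1, 1, 1);
  rs [:: cm 1 1 1] 5 (2, 1, 1) (0, -1, 1)].

Definition cert_721 : seq rel_step := [::
  rs [:: cm 1 0 0] 1 (0, 0, 1) (0, 1, 1);
  rs [:: cm (-1) 0 1] 1 (0, 1, 1) (1, 1, 1);
  rs [:: cm (-1) 0 0; cm 1 1 1] 1 (1, 0, 1) (1, 1, 1);
  rs [:: cm (-1) 0 0] 1 (1, 1, 1) (0, 0, 1);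
  rs [:: cm 1 0 0; cm (-1) 1 1] 1 (2, 1, 1) (0, 1, 1);
  rs [:: cm 1 0 0] 2 (1, -1, 1) (0, 1, 1);
  rs [:: cm (-1) 0 0; cm 1 1 1] 2 (2, -1, 1) (1, 1, 1);
  rs [:: cm 1 1 1] 4 (2, 0, 1) (-1, 1, 1);
  rs [:: cm 1 1 3; cm (-1) 2 4] 4 (4, 1, 1) (-1, 1, 1)].

Definition cert_622 : seq rel_step := [::
  rs [:: cm 1 0 0] 1 (0, 0, 1) (0, 0, 1);
  rs [:: cm (-1) 0 1] 1 (0, 1, 1) (0, 1, 1);
  rs [:: cm (-1) 0 0] 1 (1, 0, 1) (0, 1, 1);
  rs [:: cm 1 1 1] 1 (1, 0, 1) (1, 0, 1);
  rs [:: cm (-1) 0 0] 1 (1, 1, 1) (0, 0, 0);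
  rs [:: cm 1 0 1; cm (-1) 1 2] 1 (1, 1, 1) (1, 1, 1);
  rs [:: cm 1 0 0; cm (-1) 1 1] 1 (2, 1, 1) (0, 0, 1);
  rs [:: cm 1 0 0] 2 (1, -1, 1) (0, 0, 1);
  rs [:: cm (-1) 0 0; cm 1 1 1] 2 (2, -1, 1) (0, 1, 1);
  rs [:: cm (-1) 1 1] 4 (2, -1, 1) (0, 1, 1);
  rs [:: cm 1 1 1] 4 (2, 0, 1) (-1, 0, 1);
  rs [:: cm (-1) 1 2] 4 (2, 1, 1) (-1, 1, 1);
  rs [:: cm (-1) 1 2] 4 (3, 0, 1) (-1, 1, 1);
  rs [:: cm 1 1 1] 5 (2, 0, 1) (0, -1, 1);
  rs [:: cm 1 1 2] 5 (3, 1, 1) (-1, -1, 1)].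

Definition cert_433 : seq rel_step := [::
  rs [:: cm 1 0 2; cm (-1) 1 3] 1 (0, -1, 0) (2, 2, 1);
  rs [:: cm 1 0 0] 1 (0, 0, 0) (0, 0, 0);
  rs [:: cm (-1) 0 0] 1 (0, 0, 0) (0, 0, 1);
  rs [:: cm (-1) 0 1; cm 1 1 2] 1 (0, 0, 0) (2, 1, 1);
  rs [:: cm (-1) 0 1] 1 (0, 0, 1) (0, 0, 1);
  rs [:: cm 1 0 1] 1 (0, 0, 1) (0, 1, 1);
  rs [:: cm 1 1 3] 1 (0, 0, 1) (2, 1, 1);
  rs [:: cm (-1) 1 3; cm 1 2 4] 1 (1, 0, 0) (2, 1, 1);
  rs [:: cm (-1) 1 1] 1 (1, 1, 0) (0, -1, 0);
  rs [:: cm 1 0 0] 1 (1, 1, 0) (0, -1, 1);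
  rs [:: cm (-1) 0 0; cm 1 1 1] 1 (1, 1, 0) (0, 0, -1);
  rs [:: cm 1 0 1] 1 (1, 1, 1) (0, 0, 0);
  rs [:: cm (-1) 0 1] 1 (1, 1, 1) (0, 0, 1);
  rs [:: cm 1 0 2; cm (-1) 1 3] 2 (1, -2, 0) (2, 2, 1);
  rs [:: cm 1 0 0] 2 (1, -1, 0) (0, 0, 0);
  rs [:: cm (-1) 0 0] 2 (1, -1, 0) (0, 0, 1);
  rs [:: cm (-1) 0 1] 2 (1, -1, 1) (0, 0, 1);
  rs [:: cm 1 0 1] 2 (1, -1, 1) (0, 1, 1);
  rs [:: cm (-1) 0 0] 2 (1, 0, 1) (0, 0, -1);
  rs [:: cm 1 0 0] 2 (1, 0, 1) (0, 0, 0);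
  rs [:: cm 1 0 1] 2 (1, 0, 2) (0, 0, 0);
  rs [:: cm 1 0 0] 3 (1, 0, -1) (0, 0, 0);
  rs [:: cm (-1) 0 0] 3 (1, 0, -1) (0, 0, 1);
  rs [:: cm (-1) 0 0] 3 (1, 0, 0) (0, 0, 1);
  rs [:: cm (-1) 1 1] 4 (1, 0, 0) (0, 1, 0);
  rs [:: cm 1 1 1] 4 (1, 0, 0) (0, 1, 1);
  rs [:: cm 1 1 2] 4 (1, 0, 1) (0, 1, 1);
  rs [:: cm 1 1 3; cm (-1) 2 4] 4 (2, -1, 0) (1, 2, 1);
  rs [:: cm 1 1 1] 4 (2, 0, 0) (-1, 0, 0);
  rs [:: cm (-1) 1 1] 4 (2, 0, 0) (-1, 0, 1);
  rs [:: cm (-1) 1 2; cm 1 2 3] 4 (2, 0, 0) (0, 1, 1);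
  rs [:: cm (-1) 1 2] 4 (2, 0, 1) (-1, 0, 1);
  rs [:: cm 1 1 2] 4 (2, 0, 1) (-1, 1, 1);
  rs [:: cm (-1) 1 1] 5 (1, 0, 0) (0, 0, 1);
  rs [:: cm (-1) 0 1] 5 (1, 0, 0) (0, 0, 2);
  rs [:: cm 1 1 1] 5 (1, 1, 0) (0, -1, 0);
  rs [:: cm (-1) 0 0] 5 (1, 1, 0) (0, -1, 1);
  rs [:: cm 1 0 0; cm (-1) 1 1] 5 (2, 0, 0) (0, -1, 1);
  rs [:: cm (-1) 1 2; cm 1 2 3] 5 (2, 0, 0) (1, 0, 1);
  rs [:: cm (-1) 1 2] 5 (2, 0, 1) (0, -1, 1);
  rs [:: cm 1 1 2; cm (-1) 2 3] 5 (3, 1, 0) (-1, -1, 0);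
  rs [:: cm (-1) 1 3] 5 (3, 1, 1) (-1, -1, 1);
  rs [:: cm 1 0 0] 6 (1, 0, 1) (0, 0, -1);
  rs [:: cm 1 0 0] 6 (1, 0, 1) (0, 0, 0);
  rs [:: cm (-1) 0 0; cm 1 1 1] 6 (2, 0, 0) (0, 0, -1)].

Definition cert_613 : seq rel_step := [::
  rs [:: cm 1 0 0] 1 (0, 1, 1) (0, 0, 0);
  rs [:: cm 1 0 (-1); cm (-1) 1 1] 1 (1, -1, 0) (1, 0, 0);
  rs [:: cm (-1) 0 0; cm 1 1 2] 1 (1, -1, 1) (1, 0, 1);
  rs [:: cm (-1) 0 (-1); cm 1 1 1] 1 (1, 0, 0) (1, 0, 0);
  rs [:: cm (-1) 1 1] 1 (1, 0, 1) (0, 0, 0);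
  rs [:: cm 1 0 0; cm (-1) 1 2] 1 (1, 0, 1) (1, 0, 1);
  rs [:: cm (-1) 0 0; cm 1 1 2] 1 (1, 1, 1) (0, 0, 1);
  rs [:: cm 1 1 1] 1 (1, 1, 1) (1, 0, 0);
  rs [:: cm (-1) 1 3; cm 1 2 5; cm 1 2 6; cm (-1) 3 8] 1 (2, -1, 0) (2, 2, 1);
  rs [:: cm (-1) 1 1; cm 1 2 3] 1 (2, 0, 0) (0, 0, 0);
  rs [:: cm (-1) 1 2; cm 1 2 4; cm 1 2 5; cm (-1) 3 7] 1 (2, 0, 0) (2, 1, 0);
  rs [:: cm 1 1 2; cm (-1) 2 4] 1 (2, 0, 1) (0, 0, 1);
  rs [:: cm 1 1 1; cm (-1) 2 3] 1 (2, 0, 1) (1, 0, 0);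
  rs [:: cm 1 1 3; cm (-1) 2 5; cm (-1) 2 6; cm 1 3 8] 1 (2, 0, 1) (2, 1, 1);
  rs [:: cm 1 1 1] 1 (2, 1, 1) (0, -1, 0);
  rs [:: cm (-1) 1 2; cm 1 2 4] 1 (2, 1, 1) (1, 0, 1);
  rs [:: cm 1 2 6; cm (-1) 3 8; cm (-1) 3 9; cm 1 4 11] 1 (3, 0, 0) (2, 1, 1);
  rs [:: cm (-1) 1 1; cm 1 2 3] 1 (3, 1, 1) (0, 0, 0);
  rs [:: cm (-1) 1 2; cm 1 2 4] 1 (3, 2, 1) (0, -1, -1);
  rs [:: cm (-1) 0 (-1); cm 1 1 1] 2 (1, -1, 0) (1, 0, 0);
  rs [:: cm 1 0 0; cm (-1) 1 2] 2 (1, -1, 1) (1, 0, 1);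
  rs [:: cm 1 0 (-1); cm (-1) 1 1] 2 (2, -2, 0) (1, 0, 0);
  rs [:: cm (-1) 0 0; cm 1 1 2] 2 (2, -2, 1) (1, 0, 1);
  rs [:: cm (-1) 1 1] 2 (2, -1, 1) (0, 0, 0);
  rs [:: cm (-1) 1 3; cm 1 2 5; cm 1 2 6; cm (-1) 3 8] 2 (3, -2, 0) (2, 2, 1);
  rs [:: cm 1 1 1; cm (-1) 2 3] 2 (3, -1, 1) (0, 1, 0);
  rs [:: cm 1 1 1; cm (-1) 2 3] 2 (3, 0, 1) (0, 0, -1);
  rs [:: cm (-1) 0 (-1); cm 1 1 1] 3 (1, 0, -1) (1, 0, 0);
  rs [:: cm 1 0 (-1); cm (-1) 1 1] 3 (2, -1, -1) (1, 0, 0);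
  rs [:: cm 1 1 1] 4 (2, 1, 1) (-1, 0, 0);
  rs [:: cm (-1) 1 1; cm 1 2 3] 4 (3, -1, 1) (0, 1, 0);
  rs [:: cm 1 2 4; cm (-1) 3 6] 4 (3, 0, 0) (0, 1, 0);
  rs [:: cm (-1) 2 3] 4 (3, 0, 1) (-1, 0, 0);
  rs [:: cm 1 1 2; cm (-1) 2 4; cm (-1) 2 5; cm 1 3 7] 4 (3, 0, 1) (0, 1, 1);
  rs [:: cm (-1) 1 2; cm 1 2 4] 4 (3, 1, 1) (-1, 0, 1);
  rs [:: cm (-1) 2 6; cm 1 3 8; cm 1 3 9; cm (-1) 4 11] 4 (4, -1, 0) (1, 2, 1);
  rs [:: cm (-1) 2 4; cm 1 3 6] 4 (4, 0, 0) (-1, 0, 0);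
  rs [:: cm 1 2 5; cm (-1) 3 7; cm (-1) 3 8; cm 1 4 10] 4 (4, 0, 0) (0, 1, 1);
  rs [:: cm 1 2 5; cm (-1) 3 7] 4 (4, 0, 1) (-1, 0, 1);
  rs [:: cm (-1) 1 1; cm 1 2 3; cm 1 2 4; cm (-1) 3 6] 5 (3, 0, 0) (0, 0, 1);
  rs [:: cm 1 1 1; cm (-1) 2 3] 5 (3, 0, 1) (0, -1, 0);
  rs [:: cm (-1) 1 1; cm 1 2 3] 5 (3, 1, 0) (0, -1, 0);
  rs [:: cm 1 1 1; cm (-1) 2 3; cm (-1) 2 4; cm 1 3 6] 5 (4, 0, 0) (0, -1, 0);
  rs [:: cm 1 2 5; cm (-1) 3 7; cm (-1) 3 8; cm 1 4 10] 5 (4, 0, 0) (1, 0, 1);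
  rs [:: cm (-1) 1 2; cm 1 2 4; cm 1 2 5; cm (-1) 3 7] 5 (4, 0, 1) (0, -1, 1);
  rs [:: cm 1 1 1; cm (-1) 2 3; cm (-1) 2 4; cm 1 3 6] 6 (4, 0, 0) (0, 0, -1)].

Definition cert_541 : seq rel_step := [::
  rs [:: cm 1 0 0; cm (-1) 1 1] 1 (-1, 0, 0) (0, 1, 1);
  rs [:: cm (-1) 0 1; cm 1 1 2] 1 (-1, 0, 1) (1, 1, 1);
  rs [:: cm 1 0 1] 1 (-1, 1, 1) (0, 0, 0);
  rs [:: cm 1 0 0; cm (-1) 1 1] 1 (0, -1, 0) (0, 1, 1);
  rs [:: cm (-1) 0 1; cm 1 1 2] 1 (0, -1, 1) (1, 1, 1);
  rs [:: cm (-1) 0 1; cm 1 1 2] 1 (0, 0, 0) (1, 0, 2);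
  rs [:: cm 1 0 1; cm (-1) 1 1; cm (-1) 1 2; cm 1 2 2] 1 (0, 0, 0) (1, 1, 1);
  rs [:: cm (-1) 0 0] 1 (0, 0, 1) (0, 0, 0);
  rs [:: cm (-1) 0 0; cm 1 1 1] 1 (0, 0, 1) (0, 0, 1);
  rs [:: cm 1 0 0; cm (-1) 1 1] 1 (0, 0, 1) (1, 0, 0);
  rs [:: cm (-1) 0 0; cm 1 1 1] 1 (0, 0, 1) (1, 0, 1);
  rs [:: cm 1 1 2; cm (-1) 2 3] 1 (0, 0, 1) (2, 1, 1);
  rs [:: cm (-1) 0 1; cm 1 1 2] 1 (0, 0, 2) (1, 0, 1);
  rs [:: cm 1 0 1; cm (-1) 1 2] 1 (0, 0, 2) (1, 0, 2);
  rs [:: cm 1 0 1; cm (-1) 1 2] 1 (0, 1, 1) (0, 1, 1);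
  rs [:: cm 1 1 1] 1 (0, 1, 1) (1, 0, 0);
  rs [:: cm (-1) 1 1; cm 1 2 2] 1 (1, 0, 0) (0, 0, 1);
  rs [:: cm (-1) 1 2; cm 1 2 3; cm 1 2 4; cm (-1) 3 5] 1 (1, 0, 0) (2, 1, 1);
  rs [:: cm 1 0 0; cm (-1) 1 1] 1 (1, 0, 1) (0, 1, 0);
  rs [:: cm 1 1 2; cm (-1) 2 3] 1 (1, 0, 1) (0, 1, 1);
  rs [:: cm 1 1 1] 1 (1, 1, 1) (0, -1, 0);
  rs [:: cm 1 0 0; cm (-1) 1 1] 1 (1, 1, 1) (0, 0, -1);
  rs [:: cm (-1) 0 0; cm 1 1 1] 1 (1, 1, 1) (0, 0, 0);
  rs [:: cm (-1) 0 1; cm 1 1 2] 1 (1, 1, 1) (0, 1, 1);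
  rs [:: cm (-1) 0 1; cm 1 1 2] 1 (1, 1, 2) (0, 0, 0);
  rs [:: cm 1 0 1; cm (-1) 1 2] 1 (1, 1, 2) (0, 0, 1);
  rs [:: cm (-1) 0 0; cm 1 1 1] 1 (2, 1, 1) (0, 0, 0);
  rs [:: cm (-1) 0 2; cm 1 1 3] 2 (0, -2, 1) (2, 2, 1);
  rs [:: cm 1 0 2; cm (-1) 1 3] 2 (0, -1, 1) (2, 2, 1);
  rs [:: cm 1 0 0; cm (-1) 1 1] 2 (1, -2, 0) (0, 1, 1);
  rs [:: cm (-1) 0 1; cm 1 1 2] 2 (1, -2, 1) (1, 1, 1);
  rs [:: cm (-1) 0 0] 2 (1, -1, 1) (0, 0, 0);
  rs [:: cm (-1) 0 1; cm 1 1 2] 2 (1, -1, 2) (0, 1, 1);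
  rs [:: cm 1 0 0; cm (-1) 1 1] 2 (2, -1, 1) (0, 1, 0);
  rs [:: cm 1 0 0; cm (-1) 1 1] 3 (1, -1, -1) (0, 1, 1);
  rs [:: cm 1 0 0; cm (-1) 1 1] 3 (1, -1, 0) (0, 1, 1);
  rs [:: cm (-1) 0 2; cm 1 1 3] 4 (0, -1, 0) (1, 2, 2);
  rs [:: cm 1 0 1; cm (-1) 1 2] 4 (1, -1, 0) (0, 1, 2);
  rs [:: cm (-1) 0 0; cm 1 1 1] 4 (1, -1, 1) (0, 1, 0);
  rs [:: cm 1 0 0; cm (-1) 1 1] 4 (1, -1, 1) (0, 1, 1);
  rs [:: cm 1 0 1; cm (-1) 1 2] 4 (1, -1, 2) (0, 1, 1);
  rs [:: cm (-1) 0 1; cm 1 1 2] 4 (1, -1, 2) (0, 1, 2);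
  rs [:: cm 1 1 0; cm (-1) 2 1] 4 (1, 0, 0) (-1, 1, 1);
  rs [:: cm 1 0 0; cm (-1) 1 1] 4 (1, 0, 1) (-1, 0, 0);
  rs [:: cm (-1) 0 0; cm 1 1 1] 4 (1, 0, 1) (-1, 0, 1);
  rs [:: cm 1 1 1; cm (-1) 2 2] 4 (1, 0, 1) (0, 1, 1);
  rs [:: cm (-1) 0 1; cm 1 1 2] 4 (1, 0, 2) (-1, 0, 1);
  rs [:: cm 1 0 1; cm (-1) 1 2] 4 (1, 0, 2) (-1, 0, 2);
  rs [:: cm 1 1 1] 4 (1, 1, 1) (-1, 0, 0);
  rs [:: cm 1 1 1; cm (-1) 2 2] 4 (2, -1, 0) (-1, 1, 1);
  rs [:: cm (-1) 1 1; cm 1 2 2; cm 1 2 3; cm (-1) 3 4] 4 (2, 0, 0) (0, 1, 1);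
  rs [:: cm (-1) 1 1] 4 (2, 0, 1) (-1, 0, 0);
  rs [:: cm (-1) 1 1; cm 1 2 2] 4 (2, 0, 1) (-1, 0, 1);
  rs [:: cm 1 1 2; cm (-1) 2 3] 4 (2, 1, 1) (-1, 1, 1);
  rs [:: cm 1 1 1; cm (-1) 2 2; cm (-1) 2 3; cm 1 3 4] 4 (3, 0, 0) (-1, 0, 1);
  rs [:: cm 1 1 2; cm (-1) 2 3] 4 (3, 0, 1) (-1, 1, 0);
  rs [:: cm 1 2 4; cm (-1) 3 5] 4 (3, 0, 1) (-1, 1, 1);
  rs [:: cm (-1) 1 3; cm 1 2 4] 4 (3, 1, 1) (-1, 1, 1);
  rs [:: cm 1 0 1; cm (-1) 1 2] 5 (0, 0, 0) (1, 0, 2);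
  rs [:: cm (-1) 0 0; cm 1 1 1] 5 (1, -1, 1) (0, 0, 1);
  rs [:: cm 1 0 0; cm (-1) 1 1] 5 (1, 0, 1) (0, -1, 0);
  rs [:: cm (-1) 0 0; cm 1 1 1] 5 (1, 0, 1) (0, -1, 1);
  rs [:: cm 1 0 0; cm (-1) 1 1] 5 (1, 0, 1) (0, 0, 1);
  rs [:: cm (-1) 0 1; cm 1 1 2] 5 (1, 0, 2) (0, -1, 1);
  rs [:: cm 1 0 1; cm (-1) 1 2] 5 (1, 0, 2) (0, -1, 2);
  rs [:: cm (-1) 0 0; cm 1 1 1] 5 (2, 0, 0) (0, 0, 1);
  rs [:: cm (-1) 1 2; cm 1 2 3] 5 (2, 0, 0) (0, 0, 2);
  rs [:: cm (-1) 1 1; cm 1 2 2] 5 (2, 0, 1) (0, -1, 1);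
  rs [:: cm 1 1 1; cm (-1) 2 2; cm (-1) 2 3; cm 1 3 4] 5 (3, 0, 0) (0, -1, 1);
  rs [:: cm (-1) 1 2; cm 1 2 3] 5 (3, 1, 1) (-1, -1, 0);
  rs [:: cm (-1) 0 0; cm 1 1 1] 6 (1, 0, 1) (-1, 0, 0);
  rs [:: cm 1 0 0; cm (-1) 1 1] 6 (1, 0, 1) (0, 0, -1);
  rs [:: cm (-1) 0 0; cm 1 1 1] 6 (1, 1, 1) (0, 0, -1);
  rs [:: cm 1 0 0; cm (-1) 1 1] 6 (2, 0, 1) (0, 0, -1);
  rs [:: cm 1 1 1; cm (-1) 2 2] 6 (2, 0, 1) (0, 0, 0)].

Definition cert_442 : seq rel_step := [::
  rs [:: cm 1 0 0] 1 (-1, 0, 0) (0, 0, 1);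
  rs [:: cm (-1) 0 1] 1 (-1, 0, 1) (0, 1, 1);
  rs [:: cm 1 0 0] 1 (0, 0, -1) (0, 0, 1);
  rs [:: cm (-1) 1 2] 1 (0, 0, -1) (2, 1, 1);
  rs [:: cm (-1) 0 1; cm (-1) 1 0; cm (-1) 1 1] 1 (0, 0, 0) (0, 1, 1);
  rs [:: cm 1 1 0] 1 (0, 0, 0) (1, 0, 1);
  rs [:: cm (-1) 0 0] 1 (0, 0, 1) (0, 0, 0);
  rs [:: cm 1 1 2] 1 (0, 0, 1) (1, 1, 1);
  rs [:: cm 1 0 1] 1 (0, 1, 1) (0, 0, 1);
  rs [:: cm (-1) 1 3] 1 (0, 1, 1) (2, 1, 1);
  rs [:: cm (-1) 1 2; cm 1 2 3] 1 (1, 0, 0) (1, 1, 1);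
  rs [:: cm 1 1 3; cm (-1) 2 4] 1 (1, 0, 1) (2, 1, 1);
  rs [:: cm (-1) 0 0] 1 (1, 1, 0) (0, 0, 0);
  rs [:: cm 1 1 1] 1 (1, 1, 0) (0, 0, 1);
  rs [:: cm (-1) 1 1] 1 (1, 1, 0) (0, 1, 0);
  rs [:: cm 1 1 1] 1 (1, 1, 0) (1, 0, 0);
  rs [:: cm 1 1 1] 1 (1, 1, 1) (0, -1, 0);
  rs [:: cm (-1) 1 1] 1 (1, 1, 1) (0, 0, -1);
  rs [:: cm 1 0 1] 1 (1, 1, 1) (0, 0, 1);
  rs [:: cm (-1) 1 2] 1 (1, 1, 1) (1, 0, 1);
  rs [:: cm 1 1 2; cm (-1) 2 3] 1 (2, 1, 0) (1, 0, 1);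
  rs [:: cm (-1) 1 3; cm 1 2 4] 1 (2, 1, 1) (1, 1, 1);
  rs [:: cm 1 0 3] 2 (0, -2, 0) (2, 2, 2);
  rs [:: cm 1 0 0] 2 (0, -1, 0) (0, 0, 1);
  rs [:: cm (-1) 0 1] 2 (0, -1, 1) (0, 1, 1);
  rs [:: cm 1 0 0] 2 (1, -1, 0) (0, 0, 1);
  rs [:: cm (-1) 1 1] 2 (1, -1, 0) (0, 1, 1);
  rs [:: cm (-1) 0 0] 2 (1, -1, 1) (0, 0, 0);
  rs [:: cm (-1) 0 1] 2 (1, -1, 1) (0, 0, 2);
  rs [:: cm 1 1 2] 2 (1, -1, 1) (1, 1, 1);
  rs [:: cm (-1) 0 0] 2 (1, 0, 1) (0, 0, 0);
  rs [:: cm 1 1 1] 2 (1, 0, 1) (0, 0, 1);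
  rs [:: cm (-1) 1 1] 2 (1, 0, 1) (0, 1, 0);
  rs [:: cm (-1) 1 2; cm 1 2 3] 2 (2, -1, 0) (1, 1, 1);
  rs [:: cm 1 1 3; cm (-1) 2 4] 2 (2, -1, 1) (2, 1, 1);
  rs [:: cm (-1) 1 1] 2 (2, 0, 1) (0, 0, -1);
  rs [:: cm 1 1 2; cm (-1) 2 3] 2 (2, 0, 1) (1, 0, 1);
  rs [:: cm 1 2 3] 2 (2, 0, 1) (1, 1, 0);
  rs [:: cm 1 0 0] 3 (1, -1, -1) (0, 0, 1);
  rs [:: cm 1 0 0] 3 (1, 0, -1) (0, 0, 1);
  rs [:: cm 1 1 1] 3 (2, 0, -1) (0, 0, 0);
  rs [:: cm (-1) 1 2] 3 (2, 0, -1) (1, 1, 1);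
  rs [:: cm (-1) 1 0] 4 (1, -1, 0) (0, 1, 1);
  rs [:: cm (-1) 1 1] 4 (1, 0, -1) (0, 1, 1);
  rs [:: cm 1 1 0] 4 (1, 0, 0) (-1, 0, 1);
  rs [:: cm (-1) 1 1] 4 (1, 0, 1) (-1, 1, 1);
  rs [:: cm 1 1 1] 4 (1, 0, 1) (0, 1, 0);
  rs [:: cm (-1) 1 2] 4 (1, 1, 1) (0, 1, 1);
  rs [:: cm 1 1 1] 4 (2, 0, -1) (-1, 0, 1);
  rs [:: cm (-1) 1 2; cm (-1) 2 1; cm (-1) 2 2] 4 (2, 0, 0) (-1, 1, 1);
  rs [:: cm (-1) 1 1] 4 (2, 0, 0) (0, 1, 0);
  rs [:: cm (-1) 1 1] 4 (2, 0, 1) (-1, 0, 0);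
  rs [:: cm 2 1 2; cm (-1) 2 3] 4 (2, 0, 1) (0, 1, 1);
  rs [:: cm 1 1 1] 4 (2, 1, 0) (-1, 0, 0);
  rs [:: cm (-1) 1 2; cm 1 2 3] 4 (3, 0, 0) (0, 1, 1);
  rs [:: cm (-1) 2 3] 4 (3, 1, 0) (-1, 1, 0);
  rs [:: cm (-1) 2 6; cm 1 3 7] 4 (4, 1, 1) (0, 1, 1);
  rs [:: cm 1 0 1] 5 (1, -1, 0) (0, 0, 2);
  rs [:: cm 1 1 0] 5 (1, 0, 0) (0, -1, 1);
  rs [:: cm (-1) 1 1] 5 (1, 1, 1) (0, -1, 0);
  rs [:: cm 1 1 1] 5 (2, 0, -1) (0, -1, 1);
  rs [:: cm 1 1 1] 5 (2, 1, 0) (-1, -1, 1);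
  rs [:: cm 1 1 1] 5 (2, 1, 0) (0, -1, 0);
  rs [:: cm 1 1 2] 5 (3, 1, 0) (-1, -1, 1);
  rs [:: cm 1 2 3] 5 (3, 1, 1) (-1, -1, 0);
  rs [:: cm (-1) 1 3] 5 (3, 1, 1) (-1, -1, 2);
  rs [:: cm 1 2 4] 5 (3, 2, 1) (-1, -1, 1);
  rs [:: cm 1 2 6; cm (-1) 3 7] 5 (4, 2, 1) (0, -1, 1);
  rs [:: cm (-1) 0 0] 6 (1, 0, 0) (0, 0, 0)].

Definition cert_550 : seq rel_step := [::
  rs [:: cm 1 0 0] 1 (-2, 0, 0) (1, 1, 1);
  rs [:: cm 1 0 0] 1 (-1, -1, 0) (1, 1, 1);
  rs [:: cm (-1) 0 0] 1 (-1, 0, 1) (0, 1, 1);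
  rs [:: cm 1 0 1] 1 (-1, 1, 1) (1, 1, 1);
  rs [:: cm 1 0 0] 1 (0, -1, 0) (1, 1, 1);
  rs [:: cm 1 0 1] 1 (0, -1, 0) (1, 1, 2);
  rs [:: cm (-1) 0 0; cm (-1) 0 1] 1 (0, -1, 0) (2, 1, 1);
  rs [:: cm (-1) 0 1] 1 (0, -1, 1) (1, 1, 2);
  rs [:: cm 1 0 0] 1 (0, 0, -1) (2, 1, 1);
  rs [:: cm (-1) 0 0; cm (-1) 1 0; cm (-1) 1 1] 1 (0, 0, 0) (0, 1, 1);
  rs [:: cm 1 0 1; cm 1 1 1; cm 1 1 2] 1 (0, 0, 1) (1, 1, 1);
  rs [:: cm 1 0 (-1); cm (-1) 1 1] 1 (1, -1, 0) (0, 1, 1);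
  rs [:: cm (-1) 0 (-1)] 1 (1, 0, 0) (0, 1, 1);
  rs [:: cm (-1) 0 0] 1 (1, 0, 0) (0, 1, 2);
  rs [:: cm 1 1 2; cm 1 2 3] 1 (1, 0, 0) (1, 1, 1);
  rs [:: cm 1 1 1] 1 (1, 0, 1) (0, 0, 1);
  rs [:: cm 1 0 0] 1 (1, 0, 1) (0, 1, 2);
  rs [:: cm (-1) 1 2] 1 (1, 1, 1) (0, 1, 1);
  rs [:: cm (-1) 1 1] 1 (1, 1, 1) (1, 0, 1);
  rs [:: cm (-1) 1 1; cm 1 2 3] 1 (2, 0, 0) (0, 0, 1);
  rs [:: cm (-1) 1 2; cm 1 2 4; cm 1 2 5; cm (-1) 3 7] 1 (2, 0, 0) (2, 1, 1);
  rs [:: cm 1 1 2; cm (-1) 2 4] 1 (2, 0, 1) (0, 1, 1);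
  rs [:: cm (-1) 2 3] 1 (2, 1, 1) (0, -1, 1);
  rs [:: cm 1 2 3] 1 (2, 1, 1) (0, 0, 0);
  rs [:: cm (-1) 1 2] 1 (2, 2, 1) (1, 0, 0);
  rs [:: cm (-1) 1 2; cm 1 2 4] 1 (3, 1, 1) (0, 0, 1);
  rs [:: cm (-1) 1 2] 1 (3, 2, 1) (0, -1, 0);
  rs [:: cm 1 0 0] 2 (0, -2, 0) (1, 1, 1);
  rs [:: cm (-1) 0 0] 2 (0, -1, 1) (0, 1, 1);
  rs [:: cm 1 0 0] 2 (1, -2, 0) (1, 1, 1);
  rs [:: cm 1 0 1] 2 (1, -2, 0) (1, 1, 2);
  rs [:: cm (-1) 0 0; cm (-1) 0 1] 2 (1, -2, 0) (2, 1, 1);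
  rs [:: cm (-1) 0 1] 2 (1, -2, 1) (1, 1, 2);
  rs [:: cm (-1) 0 (-1); cm (-1) 0 0] 2 (1, -1, 0) (1, 0, 1);
  rs [:: cm 1 0 0] 2 (1, -1, 0) (1, 1, 0);
  rs [:: cm 1 1 1; cm 1 1 2] 2 (1, -1, 1) (1, 1, 1);
  rs [:: cm 1 0 (-1); cm (-1) 1 1] 2 (2, -2, 0) (0, 1, 1);
  rs [:: cm 1 1 1] 2 (2, -1, 1) (0, 0, 1);
  rs [:: cm 1 1 2; cm (-1) 2 4] 2 (3, -1, 1) (0, 1, 1);
  rs [:: cm 1 1 1] 2 (3, 0, 1) (0, 0, 0);
  rs [:: cm 1 0 0] 3 (0, -1, -1) (1, 1, 1);
  rs [:: cm 1 0 0] 3 (1, -1, -1) (1, 1, 1);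
  rs [:: cm (-1) 0 (-1)] 3 (1, 0, -1) (0, 1, 1);
  rs [:: cm 1 0 (-1); cm (-1) 1 1] 3 (2, -1, -1) (0, 1, 1);
  rs [:: cm 1 1 1] 3 (2, 0, -1) (1, 1, 1);
  rs [:: cm 1 0 1] 4 (1, -1, -1) (1, 2, 1);
  rs [:: cm (-1) 0 (-1); cm (-1) 0 0] 4 (1, -1, 0) (0, 1, 1);
  rs [:: cm 1 0 (-1)] 4 (1, 0, -1) (0, 1, 1);
  rs [:: cm (-1) 1 0] 4 (1, 0, 1) (-1, 1, 1);
  rs [:: cm (-1) 1 1; cm (-1) 2 1; cm (-1) 2 2] 4 (2, 0, 0) (-1, 1, 1);
  rs [:: cm 1 1 1; cm (-1) 2 3] 4 (2, 0, 1) (0, 1, 1);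
  rs [:: cm (-1) 1 1] 4 (2, 1, 1) (-1, 0, 1);
  rs [:: cm 1 1 1; cm (-1) 2 3] 4 (3, -1, 0) (-1, 1, 1);
  rs [:: cm (-1) 1 1] 4 (3, 0, 0) (-1, 1, 1);
  rs [:: cm (-1) 1 2] 4 (3, 0, 0) (-1, 1, 2);
  rs [:: cm 1 1 2; cm 1 2 3; cm 1 2 4; cm (-1) 3 6] 4 (3, 0, 0) (0, 1, 1);
  rs [:: cm 1 2 3] 4 (3, 0, 1) (-1, 0, 1);
  rs [:: cm 1 1 2] 4 (3, 0, 1) (-1, 1, 2);
  rs [:: cm (-1) 2 4] 4 (3, 1, 1) (-1, 1, 1);
  rs [:: cm (-1) 1 2] 4 (3, 2, 1) (-1, 0, 0);
  rs [:: cm 1 1 1; cm (-1) 2 3; cm (-1) 2 4; cm 1 3 6] 4 (4, 0, 0) (-1, 0, 1);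
  rs [:: cm 1 2 5; cm (-1) 3 7] 4 (4, 0, 1) (-1, 1, 1);
  rs [:: cm 1 1 2] 4 (4, 1, 1) (-1, 0, 0);
  rs [:: cm (-1) 0 0] 5 (1, 0, -1) (1, 0, 1);
  rs [:: cm 1 0 0] 5 (2, 0, 0) (-1, -1, 0);
  rs [:: cm (-1) 0 0] 5 (2, 0, 0) (-1, -1, 1);
  rs [:: cm (-1) 0 1] 5 (2, 0, 1) (-1, -1, 1);
  rs [:: cm 1 0 1] 5 (2, 0, 1) (-1, -1, 2);
  rs [:: cm (-1) 1 1; cm 1 2 3] 5 (2, 1, 1) (0, -1, 1);
  rs [:: cm (-1) 1 1; cm (-1) 1 2] 5 (3, 1, 0) (0, -1, 1);
  rs [:: cm 1 1 1; cm (-1) 2 3; cm (-1) 2 4; cm 1 3 6] 5 (4, 0, 0) (0, -1, 1);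
  rs [:: cm 1 2 4; cm (-1) 3 6] 5 (4, 1, 1) (-1, -1, 1);
  rs [:: cm (-1) 0 0] 6 (2, 0, 0) (-1, -1, 0);
  rs [:: cm 1 0 0] 6 (2, 0, 0) (-1, 0, -1)].

Definition cert_514 : seq rel_step := [::
  rs [:: cm (-1) 0 1; cm (-1) 0 2] 1 (-2, 1, 1) (0, 0, 0);
  rs [:: cm (-1) 0 2; cm 1 1 2] 1 (-1, -1, 1) (2, 2, 1);
  rs [:: cm 1 0 0; cm 1 1 1] 1 (-1, 0, 1) (0, 0, 0);
  rs [:: cm 1 0 2; cm (-1) 1 2] 1 (-1, 1, 1) (0, 0, 1);
  rs [:: cm (-1) 1 0; cm (-1) 1 1] 1 (-1, 1, 1) (1, 0, 0);
  rs [:: cm (-1) 0 0; cm 1 1 0; cm (-1) 1 1; cm 1 2 1] 1 (0, 0, 1) (0, 1, 0);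
  rs [:: cm (-1) 1 0; cm (-1) 2 1] 1 (0, 1, 1) (0, -1, 0);
  rs [:: cm (-1) 1 1; cm 1 2 1] 1 (0, 1, 1) (0, 0, -1);
  rs [:: cm 1 0 1; cm (-1) 1 1] 1 (0, 1, 1) (0, 1, 1);
  rs [:: cm 1 1 2; cm (-1) 2 2] 1 (0, 1, 1) (1, 0, 1);
  rs [:: cm (-1) 1 1; cm 1 2 1] 1 (1, 0, 1) (0, 0, 0);
  rs [:: cm (-1) 1 2; cm 1 2 2] 1 (1, 0, 2) (0, 0, 0);
  rs [:: cm 1 1 2; cm (-1) 2 2] 1 (1, 0, 2) (0, 0, 1);
  rs [:: cm 1 1 2; cm (-1) 2 2] 1 (1, 1, 1) (0, 0, 0);
  rs [:: cm 1 1 1; cm (-1) 2 1] 1 (1, 1, 1) (1, 0, 0);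
  rs [:: cm 1 1 2; cm (-1) 2 2] 1 (1, 1, 1) (1, 1, 1);
  rs [:: cm 1 1 2; cm (-1) 2 2] 1 (1, 1, 2) (1, 0, 0);
  rs [:: cm (-1) 1 2; cm 1 2 2] 1 (1, 1, 2) (1, 0, 1);
  rs [:: cm (-1) 0 (-2); cm 1 1 (-2); cm 1 1 0; cm 1 1 1; cm (-1) 2 0;
    cm (-1) 2 1; cm (-1) 2 3; cm 1 3 3] 1 (2, -1, 1) (1, 0, 1);
  rs [:: cm 1 0 (-2); cm (-1) 1 (-2); cm (-1) 1 0; cm (-1) 1 1; cm 1 2 0;
    cm 1 2 1; cm 1 2 3; cm (-1) 3 3] 1 (2, 0, 0) (1, 0, 1);
  rs [:: cm (-1) 1 1; cm 1 2 1; cm 1 2 3; cm (-1) 3 3] 1 (2, 0, 1) (0, 0, 0);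
  rs [:: cm 1 1 1; cm (-1) 2 1; cm (-1) 2 3; cm 1 3 3] 1 (2, 0, 1) (0, 1, 0);
  rs [:: cm 1 1 2; cm (-1) 2 2; cm (-1) 2 4; cm 1 3 4] 1 (2, 0, 2) (1, 0, 0);
  rs [:: cm (-1) 1 2; cm 1 2 2; cm 1 2 4; cm (-1) 3 4] 1 (2, 0, 2) (1, 0, 1);
  rs [:: cm 1 2 3; cm (-1) 3 3] 1 (2, 1, 1) (0, -1, 0);
  rs [:: cm 1 1 1; cm (-1) 2 1; cm (-1) 2 3; cm 1 3 3] 1 (2, 1, 1) (0, 0, -1);
  rs [:: cm 1 1 1; cm 1 1 2; cm (-1) 2 1; cm (-1) 2 2; cm (-1) 2 4;
    cm 1 3 4] 1 (2, 1, 1) (0, 0, 1);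
  rs [:: cm (-1) 1 2; cm 1 2 2; cm (-1) 2 3; cm 1 2 4; cm 1 3 3;
    cm (-1) 3 4] 1 (2, 1, 1) (1, 0, 0);
  rs [:: cm 1 1 2; cm (-1) 2 2] 1 (2, 1, 2) (0, -1, 0);
  rs [:: cm (-1) 1 2; cm 1 2 2] 1 (2, 1, 2) (0, -1, 1);
  rs [:: cm 1 1 1; cm (-1) 2 1; cm (-1) 2 3; cm (-1) 2 4; cm 1 3 3;
    cm 1 3 4; cm 1 3 6; cm (-1) 4 6] 1 (3, 0, 1) (1, 0, 0);
  rs [:: cm 1 1 2; cm (-1) 2 2; cm (-1) 2 4; cm (-1) 2 5; cm 1 3 4;
    cm 1 3 5; cm 1 3 7; cm (-1) 4 7] 1 (3, 0, 1) (2, 1, 1);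
  rs [:: cm 1 1 1; cm (-1) 2 1; cm (-1) 2 3; cm 1 3 3] 1 (3, 1, 1) (0, -1, 0);
  rs [:: cm (-1) 1 1; cm 1 2 1; cm 1 2 3; cm (-1) 3 3] 1 (3, 1, 1) (0, 0, 0);
  rs [:: cm (-1) 1 2; cm 1 2 2] 1 (3, 1, 1) (0, 1, 1);
  rs [:: cm 1 2 4; cm 1 2 5; cm (-1) 3 4; cm (-1) 3 5; cm (-1) 3 7;
    cm 1 4 7] 1 (3, 1, 1) (1, 0, 1);
  rs [:: cm (-1) 1 2; cm 1 2 2; cm 1 2 4; cm (-1) 3 4] 1 (3, 1, 2) (0, 0, 0);
  rs [:: cm 1 1 2; cm (-1) 2 2; cm (-1) 2 4; cm 1 3 4] 1 (3, 1, 2) (0, 0, 1);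
  rs [:: cm (-1) 0 2; cm 1 1 2] 2 (0, -2, 1) (2, 2, 1);
  rs [:: cm 1 0 0; cm 1 1 1] 2 (0, -1, 1) (0, 0, 0);
  rs [:: cm (-1) 0 0; cm 1 1 0; cm (-1) 1 1; cm 1 2 1] 2 (1, -1, 1) (0, 1, 0);
  rs [:: cm (-1) 1 2; cm 1 2 2] 2 (1, -1, 1) (1, 2, 1);
  rs [:: cm (-1) 1 1; cm 1 2 1] 2 (2, -1, 1) (0, 0, 0);
  rs [:: cm 1 0 (-2); cm (-1) 1 (-2); cm (-1) 1 0; cm (-1) 1 1; cm 1 2 0;
    cm 1 2 1; cm 1 2 3; cm (-1) 3 3] 2 (2, -1, 1) (1, 0, 1);
  rs [:: cm 1 1 3; cm (-1) 2 3] 2 (2, -1, 1) (2, 2, 1);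
  rs [:: cm (-1) 1 2; cm 1 2 2] 2 (2, -1, 2) (0, 0, 0);
  rs [:: cm 1 1 2; cm (-1) 2 2] 2 (2, -1, 2) (0, 0, 1);
  rs [:: cm (-1) 1 3; cm 1 2 3; cm 1 2 5; cm (-1) 3 5] 2 (2, -1, 2) (2, 1, 1);
  rs [:: cm (-1) 0 (-2); cm 1 1 (-2); cm 1 1 0; cm 1 1 1; cm (-1) 2 0;
    cm (-1) 2 1; cm (-1) 2 3; cm 1 3 3] 2 (3, -2, 1) (1, 0, 1);
  rs [:: cm (-1) 1 3; cm 1 2 3; cm 1 2 5; cm 1 2 6; cm (-1) 3 5;
    cm (-1) 3 6; cm (-1) 3 8; cm 1 4 8] 2 (3, -2, 1) (2, 2, 1);
  rs [:: cm (-1) 1 1; cm 1 2 1; cm 1 2 3; cm (-1) 3 3] 2 (3, -1, 1) (0, 0, 0);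
  rs [:: cm 1 1 1; cm (-1) 2 1; cm (-1) 2 3; cm 1 3 3] 2 (3, -1, 1) (0, 1, 0);
  rs [:: cm 1 1 2; cm (-1) 2 2; cm (-1) 2 4; cm 1 3 4] 2 (3, -1, 2) (0, 1, 0);
  rs [:: cm (-1) 1 2; cm 1 2 2; cm 1 2 4; cm (-1) 3 4] 2 (3, -1, 2) (1, 0, 1);
  rs [:: cm 1 1 2; cm (-1) 2 2; cm (-1) 2 4; cm 1 3 4] 2 (3, 0, 2) (0, 0, -1);
  rs [:: cm (-1) 1 1; cm 1 2 1; cm 1 2 3; cm (-1) 3 3] 3 (3, 0, 0) (0, 0, 0);
  rs [:: cm 1 1 1; cm (-1) 2 1] 4 (0, 0, 1) (0, 1, 0);
  rs [:: cm (-1) 1 0; cm (-1) 1 1] 4 (0, 1, 1) (-1, 0, 0);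
  rs [:: cm 1 1 0; cm 1 2 1] 4 (1, 0, 1) (-1, 0, 0);
  rs [:: cm (-1) 1 2; cm 1 2 2] 4 (1, 0, 1) (0, 1, 1);
  rs [:: cm 1 1 2; cm (-1) 2 2] 4 (1, 1, 1) (-1, 0, 1);
  rs [:: cm (-1) 1 1; cm 1 2 1; cm (-1) 2 2; cm 1 3 2] 4 (2, 0, 1) (-1, 1, 0);
  rs [:: cm (-1) 1 1; cm 1 2 1; cm 1 2 3; cm (-1) 3 3] 4 (2, 0, 1) (0, 1, 0);
  rs [:: cm 1 1 1; cm (-1) 2 1] 4 (2, 1, 1) (-1, 0, 0);
  rs [:: cm 1 1 2; cm (-1) 2 2] 4 (2, 1, 1) (-1, 1, 1);
  rs [:: cm 1 1 2; cm (-1) 2 2] 4 (2, 1, 2) (-1, 0, 0);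
  rs [:: cm (-1) 1 2; cm 1 2 2] 4 (2, 1, 2) (-1, 0, 1);
  rs [:: cm (-1) 1 2; cm 1 2 2; cm 1 2 4; cm (-1) 3 4] 4 (3, -1, 2) (0, 1, 0);
  rs [:: cm (-1) 2 3; cm 1 3 3] 4 (3, 0, 1) (-1, 0, 0);
  rs [:: cm 1 1 1; cm 1 1 2; cm (-1) 2 1; cm (-1) 2 2; cm (-1) 2 4;
    cm 1 3 4] 4 (3, 0, 1) (0, 1, 0);
  rs [:: cm 1 1 2; cm (-1) 2 2; cm (-1) 2 4; cm 1 3 4] 4 (3, 0, 1) (0, 1, 1);
  rs [:: cm (-1) 2 4; cm 1 3 4] 4 (3, 0, 2) (-1, 0, 0);
  rs [:: cm 1 2 4; cm (-1) 3 4] 4 (3, 0, 2) (-1, 0, 1);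
  rs [:: cm (-1) 1 2; cm 1 2 2; cm (-1) 2 3; cm 1 2 4; cm 1 3 3;
    cm (-1) 3 4] 4 (3, 1, 1) (-1, 0, 0);
  rs [:: cm (-1) 1 1; cm 1 2 1; cm 1 2 3; cm 1 2 4; cm (-1) 3 3;
    cm (-1) 3 4; cm (-1) 3 6; cm 1 4 6] 4 (4, -1, 1) (0, 1, 0);
  rs [:: cm (-1) 2 4; cm 1 3 4; cm 1 3 6; cm (-1) 4 6] 4 (4, 0, 1) (-1, 0, 0);
  rs [:: cm 1 2 4; cm (-1) 3 4; cm (-1) 3 6; cm 1 4 6] 4 (4, 0, 1) (-1, 1, 0);
  rs [:: cm (-1) 2 4; cm (-1) 2 5; cm 1 3 4; cm 1 3 5; cm 1 3 7;
    cm (-1) 4 7] 4 (4, 0, 1) (0, 1, 1);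
  rs [:: cm 1 2 4; cm 1 2 5; cm (-1) 3 4; cm (-1) 3 5; cm (-1) 3 7;
    cm 1 4 7] 4 (4, 1, 1) (-1, 0, 1);
  rs [:: cm (-1) 2 6; cm 1 3 6] 4 (5, 1, 1) (-1, 1, 1);
  rs [:: cm 1 2 6; cm (-1) 3 6; cm (-1) 3 8; cm 1 4 8] 4 (5, 1, 2) (-1, 0, 1);
  rs [:: cm (-1) 0 0; cm 1 1 0] 5 (0, 0, 1) (0, 0, 1);
  rs [:: cm (-1) 1 1; cm 1 2 1] 5 (0, 1, 1) (0, -1, 0);
  rs [:: cm 1 0 0; cm (-1) 1 0; cm 1 1 1; cm (-1) 2 1] 5 (1, 0, 0) (0, 0, 1);
  rs [:: cm 1 1 2; cm (-1) 2 2] 5 (1, 1, 1) (0, -1, 1);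
  rs [:: cm 1 1 1; cm (-1) 2 1; cm 1 2 2; cm (-1) 3 2] 5 (2, 1, 1) (-1, -1, 0);
  rs [:: cm 1 1 1; cm (-1) 2 1; cm (-1) 2 3; cm 1 3 3] 5 (2, 1, 1) (0, -1, 0);
  rs [:: cm (-1) 1 1; cm 1 2 1; cm 1 2 3; cm (-1) 3 3] 5 (3, 0, 0) (0, 0, 1);
  rs [:: cm 1 1 1; cm (-1) 2 1] 5 (3, 0, 1) (0, 0, 1);
  rs [:: cm 1 1 2; cm (-1) 2 2; cm (-1) 2 4; cm 1 3 4] 5 (3, 0, 2) (0, -1, 0);
  rs [:: cm (-1) 1 2; cm 1 2 2; cm 1 2 4; cm (-1) 3 4] 5 (3, 0, 2) (0, -1, 1);
  rs [:: cm (-1) 1 1; cm (-1) 1 2; cm 1 2 1; cm 1 2 2; cm 1 2 4;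
    cm (-1) 3 4] 5 (3, 1, 1) (0, -1, 0);
  rs [:: cm (-1) 1 1; cm 1 2 1; cm 1 2 3; cm 1 2 4; cm (-1) 3 3;
    cm (-1) 3 4; cm (-1) 3 6; cm 1 4 6] 5 (4, -1, 1) (0, 0, 1);
  rs [:: cm 1 1 1; cm (-1) 2 1; cm (-1) 2 3; cm (-1) 2 4; cm 1 3 3;
    cm 1 3 4; cm 1 3 6; cm (-1) 4 6] 5 (4, 0, 1) (0, -1, 0);
  rs [:: cm (-1) 2 4; cm 1 3 4; cm 1 3 6; cm (-1) 4 6] 5 (4, 1, 1) (-1, -1, 0);
  rs [:: cm 1 1 1; cm (-1) 2 1; cm (-1) 2 3; cm 1 2 5; cm 1 3 3;
    cm (-1) 3 5; cm 1 3 6; cm (-1) 3 7; cm (-1) 4 6;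
    cm 1 4 7] 5 (4, 1, 1) (0, -1, 1);
  rs [:: cm (-1) 1 1; cm 1 2 1; cm 1 2 3; cm 1 2 4; cm (-1) 3 3;
    cm (-1) 3 4; cm (-1) 3 6; cm 1 4 6] 5 (5, 0, 1) (0, -1, 1);
  rs [:: cm (-1) 1 1; cm 1 2 1] 6 (1, 0, 1) (0, 0, -1);
  rs [:: cm 1 1 1; cm (-1) 2 1] 6 (2, 1, 1) (-1, 0, -1);
  rs [:: cm 1 1 1; cm (-1) 2 1; cm (-1) 2 3; cm 1 3 3] 6 (3, 0, 1) (0, 0, -1);
  rs [:: cm (-1) 1 1; cm 1 2 1] 6 (3, 1, 1) (0, 0, -1);
  rs [:: cm 1 1 1; cm (-1) 2 1; cm (-1) 2 3; cm (-1) 2 4; cm 1 3 3;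
    cm 1 3 4; cm 1 3 6; cm (-1) 4 6] 6 (4, 0, 1) (0, 0, -1)].

(** * Verification of the certificates by computation *)

Lemma check_910 : vanishing (form_scale [:: cm (-1) 0 0]
  (combine cert_910 ++ [::]) ++ (target (9, 1, 0)%N)).
Proof. by vm_compute. Qed.

Lemma check_820 : vanishing (form_scale [:: cm (-1) 0 0]
  (combine cert_820 ++ [::]) ++ (target (8, 2, 0)%N)).
Proof. by vm_compute. Qed.

Lemma check_811 : vanishing (form_scale [:: cm (-1) 0 0]
  (combine cert_811 ++ [::]) ++ (target (8, 1, 1)%N)).
Proof. by vm_compute. Qed.

Lemma check_712 : vanishing (form_scale [:: cm (-1) 0 0]
  (combine cert_712 ++ [::]) ++ (target (7, 1, 2)%N)).
Proof. by vm_compute. Qed.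

Lemma check_721 : vanishing (form_scale [:: cm (-1) 0 0]
  (combine cert_721 ++ [::]) ++ (target (7, 2, 1)%N)).
Proof. by vm_compute. Qed.

Lemma check_622 : vanishing (form_scale [:: cm (-1) 0 0]
  (combine cert_622 ++ [::]) ++ (target (6, 2, 2)%N)).
Proof. by vm_compute. Qed.

Lemma check_433 : vanishing (form_scale [:: cm (-1) 0 0]
  (combine cert_433 ++ [::]) ++ (target (4, 3, 3)%N)).
Proof. by vm_compute. Qed.

(** The multiplier of the equation of (4,3,3), taken at z q^2, is zq(1 - z q^2). *)
Definition extra_613 := extra [:: ex [:: cm 1 1 1; cm (-1) 2 3] (4, 3, 3) 2].
Lemma check_613 : vanishing (form_scale [:: cm (-1) 0 0]
  (combine cert_613 ++ extra_613) ++ (target (6, 1, 3)%N)).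
Proof. by vm_compute. Qed.

(** The equation of (6,1,3) enters at z/q, a shift available only for formal combinations. What is
    certified is 1 - zq times the equation of (5,4,1). *)
Definition extra_541 := extra [:: ex [:: cm (-1) 0 1] (6, 1, 3) (-1)].
Lemma check_541 : vanishing (form_scale [:: cm (-1) 0 0]
  (combine cert_541 ++ extra_541) ++ (form_scale [:: cm 1 0 0;
    cm (-1) 1 1] (target (5, 4, 1)%N))).
Proof. by vm_compute. Qed.

Definition extra_442 := extra [:: ex [:: cm (-1) 0 0; cm 1 1 1] (5, 4, 1) 1].
Lemma check_442 : vanishing (form_scale [:: cm (-1) 0 0]
  (combine cert_442 ++ extra_442) ++ (target (4, 4, 2)%N)).
Proof. by vm_compute. Qed.

Definition extra_550 := extra [:: ex [:: cm 1 1 1] (5, 4, 1) 1].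
Lemma check_550 : vanishing (form_scale [:: cm (-1) 0 0]
  (combine cert_550 ++ extra_550) ++ (target (5, 5, 0)%N)).
Proof. by vm_compute. Qed.

(** The equation of (6,1,3) enters twice, at z/q^2 and at zq; what is certified is 1 - z times the
    equation of (5,1,4). *)
Definition extra_514 := extra [::
  ex [:: cm 1 1 1; cm (-1) 2 1] (4, 4, 2) 1; ex [:: cm (-1) 0 0;
    cm 1 1 0] (5, 5, 0) 1;
  ex [:: cm 1 0 1; cm 1 0 2] (6, 1, 3) (-2); ex [:: cm 1 1 1;
    cm (-1) 2 1] (6, 1, 3) 1].
Lemma check_514 : vanishing (form_scale [:: cm (-1) 0 0]
  (combine cert_514 ++ extra_514) ++ (form_scale [:: cm 1 0 0;
    cm (-1) 1 0] (target (5, 1, 4)%N))).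
Proof. by vm_compute. Qed.

(** * The coefficient of z^0 *)

Lemma vanish_below_qX n : vanish_below n%:Z (q ^+ n).
Proof. exact: vanish_belowX vanish_below_q. Qed.

Lemma vanish_below0_qpoch n : vanish_below 0 (qpoch q n).
Proof. exact: vanish_below_qpoch (vanish_belowW ler01 vanish_below_q). Qed.

Lemma vanish_below0_qpochV n : vanish_below 0 ((qpoch q n)^-1)%R.
Proof.
apply: vanish_belowV; first exact: vanish_below0_qpoch.
exact: coefl0_qpoch vanish_below_q.
Qed.

Lemma vanish_below0M (f g : laurent {poly int}) n :
  vanish_below n f -> vanish_below 0 g -> vanish_below n (f * g).
Proof. by move=> fn g0; rewrite -[n]addr0; apply: vanish_belowM. Qed.

Lemma qpoch_q_stable (N L : nat) : (N <= L)%N ->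
  vanish_below (N + 1)%:Z (qpoch q L - qpoch q N).
Proof.
elim: L => [|L IH]; first by rewrite leqn0 => /eqP ->; rewrite subrr.
rewrite leq_eqVlt => /predU1P[->|NL]; first by rewrite subrr.
have -> : qpoch q L.+1 - qpoch q N = (qpoch q L - qpoch q N)
    - q ^+ L.+1 * qpoch q L by rewrite qpoch_qS; ring.
apply: vanish_belowB; first exact: IH.
apply: vanish_below0M (vanish_below0_qpoch _).
apply: vanish_belowW (vanish_below_qX (n := L.+1)); lia.
Qed.

Lemma qpoch_inf_q_stable N : vanish_below (N + 1)%:Z (qpoch_inf q - qpoch q N).
Proof.
move=> m mN; have q0 := vanish_belowW ler01 vanish_below_q.
have [L _ hL] := lcvg_qpoch q0 m.
have := qpoch_q_stable (leq_maxl N L) mN; rewrite !coeflB.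
by rewrite (hL (maxn N L) (leq_maxr N L)).
Qed.

(** Gaussian binomial coefficient, given by the q-Pascal rule rather than as a quotient because the
    induction in [sum_qbinom] runs on that rule. *)
Fixpoint qbinom (N s : nat) : laurent {poly int} :=
  match N, s with
  | _, 0 => 1
  | 0, _.+1 => 0
  | N'.+1, s'.+1 => qbinom N' s'.+1 + q ^+ (N' - s') * qbinom N' s'
  end.

Lemma qbinom_small N s : (N < s)%N -> qbinom N s = 0.
Proof.
elim: N s => [|N IH] [|s] //= Ns; rewrite !IH ?mulr0 ?addr0//; lia.
Qed.

Lemma qbinom_qpoch N s : (s <= N)%N ->
  qbinom N s * (qpoch q s * qpoch q (N - s)) = qpoch q N.
Proof.
elim: N s => [|N IH] [|s] //.
- by rewrite /qpoch !big_geq// !mulr1.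
- by move=> _; rewrite subn0 {1}/qpoch big_geq// !mul1r.
rewrite ltnS subSS => sN; rewrite [qbinom _ _]/=.
have := IH s sN; case: (ltnP s N) => [s1N|Ns] IHs.
  have := IH s.+1 s1N.
  have -> : (N - s = (N - s.+1).+1)%N by lia.
  have NsE : q ^+ N.+1 = q ^+ (N - s.+1).+1 * q ^+ s.+1.
    by rewrite -exprD; congr (_ ^+ _); lia.
  move=> IHs1; rewrite [RHS]qpoch_qS NsE mulrDl.
  rewrite [X in X + _](_ : _ = qpoch q N * (1 - q ^+ (N - s.+1).+1)).
    rewrite [X in _ + X](_ : _ =
      q ^+ (N - s.+1).+1 * qpoch q N * (1 - q ^+ s.+1)); first by ring.
    rewrite -[in RHS]IHs (_ : (N - s = (N - s.+1).+1)%N); last lia.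
    by rewrite [qpoch q s.+1]qpoch_qS; ring.
  by rewrite -[in RHS]IHs1 [qpoch q (N - s.+1).+1]qpoch_qS; ring.
have -> : s = N by lia.
rewrite qbinom_small// add0r subnn expr0 mul1r.
have := IHs; have -> : s = N by lia.
by rewrite subnn => IHN; rewrite !qpoch_qS -[in RHS]IHN; ring.
Qed.

(** A limiting case of the q-Vandermonde summation. The q-Pascal rule splits the sum for N + 1 into
    the sum for (N, a) and, after s -> s + 1, q^(N+a+1) times the sum for (N, a + 1). *)
Lemma sum_qbinom N a :
  \sum_(s < N.+1) q ^+ (s * s + a * s) * qbinom N s / qpoch q (s + a) =
  (qpoch q (N + a))^-1.
Proof.
elim: N a => [|N IH] a.
  by rewrite big_ord1 /= ?mul0n muln0 ?addn0 expr0 !mul1r.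
have QU n := qpoch_unit n.
have first_sum : \sum_(s < N.+2) q ^+ (s * s + a * s) *
    (if s : nat is s'.+1 then qbinom N s else 1) / qpoch q (s + a) =
    (qpoch q (N + a))^-1.
  rewrite big_ord_recr /= qbinom_small// mulr0 mul0r addr0 -IH.
  by apply: eq_bigr => -[[|s] sN] _ //=; case: N {IH sN}.
have second_sum : \sum_(s < N.+2) q ^+ (s * s + a * s) *
    (if s : nat is s'.+1 then q ^+ (N - s') * qbinom N s' else 0) /
      qpoch q (s + a) = q ^+ (N + a).+1 / qpoch q (N + a).+1.
  rewrite big_ord_recl /= mulr0 mul0r add0r -addnS -IH mulr_sumr.
  apply: eq_bigr => -[s sN] _ /=; rewrite /bump /= add1n addSnnS.
  (* The exponents agree because (s+1)^2 + a(s+1) + N - s = (N + a + 1) + s^2 + (a+1)s; the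
     truncated subtraction is exact as s <= N. *)
  have eE : q ^+ (s.+1 * s.+1 + a * s.+1) * q ^+ (N - s) =
      q ^+ (N + a).+1 * q ^+ (s * s + a.+1 * s).
    by rewrite -(exprD q) -(exprD q); congr (q ^+ _); rewrite ltnS in sN; nia.
  move: (qbinom N s) (qpoch q (s + a.+1))^-1 => B V; rewrite addnS.
  by rewrite [_ * (_ * B)]mulrA eE !mulrA.
transitivity ((qpoch q (N + a))^-1 + q ^+ (N + a).+1 / qpoch q (N + a).+1).
  rewrite -first_sum -second_sum -big_split; apply: eq_bigr => -[[|s] sN] _ /=.
    by rewrite mulr0 mul0r addr0.
  by rewrite mulrDr mulrDl.
rewrite addSn qpoch_qS invrM ?subr1_exprq_unit//.
have uU := subr1_exprq_unit (N + a).
move: (qpoch q (N + a))^-1 (q ^+ _) uU => V u uU.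
rewrite -{1}[V](mulKr uU); ring.
Qed.

(** Up to the constant (q; q)_a, the beta sequence of the Bailey pair relative to q^a whose alpha
    sequence is concentrated at 0. *)
Definition bailey (a s : nat) : laurent {poly int} :=
  (qpoch q s * qpoch q (s + a))^-1.

(** One step of the Bailey chain, under which this sequence is fixed: it is [sum_qbinom] divided by
    (q; q)_N. *)
Lemma bailey_sum a N :
  \sum_(s < N.+1) q ^+ (s * s + a * s) / qpoch q (N - s) * bailey a s =
  bailey a N.
Proof.
have QU n := qpoch_unit n.
rewrite /bailey invrM// -(sum_qbinom N a) mulr_suml; apply: eq_bigr => -[s sN] _.
rewrite -(qbinom_qpoch (sN : s <= N)%N) !invrM ?unitrM ?QU//=.
  have := qpoch_unit N; rewrite -(qbinom_qpoch (sN : s <= N)%N) unitrM => /andP[bU _].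
  rewrite -[LHS]mulr1 -(divrr bU); ring.
have := qpoch_unit N; rewrite -(qbinom_qpoch (sN : s <= N)%N) unitrM => /andP[].
by [].
Qed.

(** Passage from parameter 1 to parameter 0; the factor 1 - q^(s+1) is what the differences S - qS
    of the theorem provide at z = 0. *)
Lemma bailey0 s : bailey 0 s = (1 - q ^+ s.+1) * bailey 1 s.
Proof.
have QU n := qpoch_unit n; have uU := subr1_exprq_unit s.
rewrite /bailey addn0 addn1 qpoch_qS !invrM ?unitrM ?QU ?uU//.
by rewrite !mulrA divrr// mul1r.
Qed.

Lemma subrVV (A : comUnitRingType) (x y : A) :
  x \is a GRing.unit -> y \is a GRing.unit ->
  x^-1 - y^-1 = - (x - y) * x^-1 * y^-1.
Proof.
move=> xU yU.
have -> : - (x - y) * x^-1 * y^-1 = y / y * x^-1 - x / x * y^-1 by ring.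
by rewrite !divrr// !mul1r.
Qed.

(** The limit N -> oo of [sum_qbinom]. The Gaussian binomial differs from 1/(q; q)_s only from order
    N - s + 1 on, and q^(s^2 + as) has order at least s, so the error has order at least N. *)
Lemma is_lsum_bailey a : is_lsum [set: nat]%classic
  (fun s => q ^+ (s * s + a * s) * bailey a s) (qpoch_inf q)^-1.
Proof.
have QU n := qpoch_unit n.
apply/is_lsumP => n; pose N := `|n|%N; exists (iota 0 N.+1); split => //.
- exact: iota_uniq.
- move=> s _; rewrite mem_iota /= add0n -leqNgt => Ns.
  apply: (@vanish_belowW _ _ (s * s + a * s)%N%:Z).
    by have : (s <= s * s + a * s)%N; [nia|lia].
  apply: vanish_below0M; first exact: vanish_below_qX.
  rewrite /bailey invrM//.
  exact: vanish_below0M (vanish_below0_qpochV _) (vanish_below0_qpochV _).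
have -> : \sum_(s <- iota 0 N.+1) q ^+ (s * s + a * s) * bailey a s =
    \sum_(s < N.+1) q ^+ (s * s + a * s) * bailey a s.
  by rewrite -(big_mkord xpredT (fun s => q ^+ (s * s + a * s) * bailey a s)).
apply: (@vanish_belowW _ _ N%:Z); first by rewrite /N; lia.
(* The intermediate value 1/(q; q)_(N+a) is that of the finite sum with Gaussian binomials, and it
   agrees with the limit up to order N + a. *)
rewrite -[(qpoch_inf q)^-1](subrK (qpoch q (N + a))^-1) -addrA.
apply: vanish_belowD.
  have -> : (qpoch_inf q)^-1 - (qpoch q (N + a))^-1 =
      - (qpoch_inf q - qpoch q (N + a)) * (qpoch_inf q)^-1
        * (qpoch q (N + a))^-1.
    by apply: subrVV => //; exact: qpoch_inf_unit.
  apply: vanish_below0M (vanish_below0_qpochV _); apply: vanish_below0M.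
    apply: vanish_belowN; apply: vanish_belowW (qpoch_inf_q_stable (N := N + a)).
    lia.
  have Q0 : vanish_below 1 (qpoch_inf q - qpoch q 0) := @qpoch_inf_q_stable 0.
  apply: vanish_belowV => [m m0|].
    have := Q0 m (lt_trans m0 ltr01).
    by rewrite coeflB [qpoch q 0 m]vanish_below0_qpoch// subr0.
  have := Q0 0 ltr01; rewrite coeflB (coefl0_qpoch _ vanish_below_q).
  by move/eqP; rewrite subr_eq0 => /eqP.
rewrite -sum_qbinom -sumrB; apply: vanish_below_sum => i _ _.
move: (nat_of_ord i) (ltn_ord i) => s sN {i}.
have -> : q ^+ (s * s + a * s) * qbinom N s / qpoch q (s + a) -
    q ^+ (s * s + a * s) * bailey a s =
    q ^+ (s * s + a * s) * (qpoch q N - qpoch q (N - s)) *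
      ((qpoch q (N - s))^-1 * (qpoch q s)^-1 * (qpoch q (s + a))^-1).
  rewrite -(qbinom_qpoch (sN : s <= N)%N) /bailey invrM//.
  move: (qpoch q s) (qpoch q (N - s)) (QU s) (QU (N - s)%N) => u v uU vU.
  move: (q ^+ _) (qbinom N s) (qpoch q (s + a))^-1 => x b w.
  have -> : x * (b * (u * v) - v) * (v^-1 * u^-1 * w) =
    x * b * (u / u) * (v / v) * w - x * (v / v) * (w * u^-1) by ring.
  by rewrite !divrr// !mulr1.
apply: vanish_below0M; last first.
  apply: vanish_below0M (vanish_below0_qpochV _).
  exact: vanish_below0M (vanish_below0_qpochV _) (vanish_below0_qpochV _).
apply: (@vanish_belowW _ _ ((s * s + a * s)%N%:Z + (N - s + 1)%N%:Z)).
  by have : (s <= s * s + a * s)%N; [nia|lia].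
apply: vanish_belowM; first exact: vanish_below_qX.
by apply: qpoch_q_stable; lia.
Qed.

Definition qsquare (a s : nat) : laurent {poly int} := q ^+ (s * s + a * s).

Lemma qsquare_diff s : qsquare 0 s - q * qsquare 1 s = qsquare 0 s * (1 - q ^+ s.+1).
Proof.
rewrite /qsquare mul0n mul1n addn0 -exprS -addnS (exprD q); ring.
Qed.

(** The sums are evaluated from s_3 outwards by [bailey_sum], F_i changing the parameter a_(i+1)
    into a_i, with a_4 = 1. In the applications F_i either is a plain power of q and keeps the
    parameter, or carries 1 - q^(s+1) and drops it from 1 to 0. *)
Lemma bailey_chain (a1 a2 a3 : nat) (F1 F2 F3 : nat -> laurent {poly int}) s1 :
  (forall s, F1 s * bailey a2 s = qsquare a1 s * bailey a1 s) ->
  (forall s, F2 s * bailey a3 s = qsquare a2 s * bailey a2 s) ->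
  (forall s, F3 s * bailey 1 s = qsquare a3 s * bailey a3 s) ->
  \sum_(s2 < s1.+1) \sum_(s3 < s2.+1) F1 s1 * F2 s2 * F3 s3 /
    qpoch q (s1 - s2) / qpoch q (s2 - s3) * bailey 1 s3 =
  qsquare a1 s1 * bailey a1 s1.
Proof.
move=> F1E F2E F3E; rewrite -F1E -(bailey_sum a2 s1) mulr_sumr.
apply: eq_bigr => s2 _; transitivity (F1 s1 / qpoch q (s1 - s2) *
    (F2 s2 * bailey a3 s2)); last first.
  rewrite F2E -/(qsquare a2 s2).
  by move: (F1 s1) (qpoch q _)^-1 (qsquare _ _) (bailey _ _) => *; ring.
rewrite -(bailey_sum a3 s2) 2!mulr_sumr; apply: eq_bigr => s3 _.
rewrite -/(qsquare a3 s3).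
transitivity (F1 s1 / qpoch q (s1 - s2) * (F2 s2 *
   ((F3 s3 * bailey 1 s3) / qpoch q (s2 - s3)))).
  by move: (qpoch q _)^-1 (qpoch q (s2 - s3))^-1 => *; ring.
by rewrite F3E; move: (qpoch q _)^-1 (qpoch q (s2 - s3))^-1 => *; ring.
Qed.

(** At z = 0 only r_1 = 0 survives, hence all r_i = 0. The terms with given s_1 form a finite fibre,
    summed by [bailey_chain]; the remaining sum over s_1 is [is_lsum_bailey]. *)
Lemma zcoef0_chain (a1 a2 a3 : nat) (F1 F2 F3 : nat -> laurent {poly int})
    (f : nat * nat * nat * nat * nat * nat -> laurent {poly int}) l :
  (forall s, F1 s * bailey a2 s = qsquare a1 s * bailey a1 s) ->
  (forall s, F2 s * bailey a3 s = qsquare a2 s * bailey a2 s) ->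
  (forall s, F3 s * bailey 1 s = qsquare a3 s * bailey a3 s) ->
  (forall r1 r2 r3 s1 s2 s3, zcoef 0 (f (r1.+1, r2, r3, s1, s2, s3)) = 0) ->
  (forall s1 s2 s3, f (0, 0, 0, s1, s2, s3)%N = F1 s1 * F2 s2 * F3 s3 /
    qpoch q (s1 - s2) / qpoch q (s2 - s3) * bailey 1 s3) ->
  is_lsum S13_index f l -> zcoef 0 l = zcoef 0 (qpoch_inf q)^-1.
Proof.
move=> F1E F2E F3E f0 fE.
move=> /(is_lsum_map (@zcoef_is_zmod_morphism _ 0) (@zcoef_continuous _ 0)).
pose B (t : nat * nat * nat * nat * nat * nat) :=
  S13_index t /\ t.1.1.1.1.1 = 0%N.
move=> /(is_lsum_restrict (B := B))-/(_ _ _)/Wrap[].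
- by move=> t [].
- by case=> [[[[[[|r1] r2] r3] s1] s2] s3] // t nB; case: nB.
pose fib s1 := [seq (0, 0, 0, s1, s2, s3)%N |
    s2 <- index_iota 0 s1.+1, s3 <- index_iota 0 s2.+1].
move=> /(is_lsum_fibers (B := [set: nat]%classic) (p := fun t => t.1.1.2)
  (fib := fib))-/(_ _ _ _)/Wrap[] //.
- move=> s1; apply: allpairs_uniq_dep => [|s2 _|]; rewrite ?iota_uniq//.
  by move=> [s2 s3] [s2' s3'] _ _ /= [-> ->].
- move=> [[[[[r1 r2] r3] s1] s2] s3] s _; split.
    move=> /allpairsPdep[s2' [s3' []]]; rewrite !mem_index_iota =>
      s2s s3s [-> -> -> -> -> ->].
    by split => //; split => //; apply/and4P; split => //; lia.
  move=> [[/and4P[r12 r23 s12 s23] /= r10] ss]; apply/allpairsPdep.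
  exists s2, s3; rewrite !mem_index_iota; split; [lia|lia|].
  by congr (_, _, _, _, _, _); lia.
move=> /is_lsum_unique; apply.
have := is_lsum_map (@zcoef_is_zmod_morphism _ 0) (@zcoef_continuous _ 0)
  (is_lsum_bailey a1).
apply: eq_is_lsum => s1 _; rewrite -/(qsquare a1 s1) -(bailey_chain s1 F1E F2E F3E).
rewrite zcoef_sum [RHS]big_allpairs_dep big_mkord; apply: eq_bigr => s2 _.
by rewrite zcoef_sum [RHS]big_mkord; apply: eq_bigr => s3 _; rewrite fE.
Qed.

(** At r_3 = 0 the denominators (q; q)_(s_3) and (q; q)_(s_3 + 1) form [bailey 1]: the + 1 in the
    definition of S13 is why the chain starts at parameter 1. *)
Lemma S13_term_r0 rho (b1 b2 b3 s1 s2 s3 : nat) :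
  S13_term rho (b1%:Z, b2%:Z, b3%:Z) (0, 0, 0, s1, s2, s3)%N =
  qsquare b1 s1 * qsquare b2 s2 * qsquare b3 s3 / qpoch q (s1 - s2)
    / qpoch q (s2 - s3) * bailey 1 s3.
Proof.
rewrite S13_termE; case: rho => [[a1 a2] a3].
have -> : S13_exponent (a1, a2, a3) (b1%:Z, b2%:Z, b3%:Z)
    (0, 0, 0, s1, s2, s3)%N =
    ((s1 * s1 + b1 * s1) + (s2 * s2 + b2 * s2) + (s3 * s3 + b3 * s3))%N%:Z.
  by rewrite /S13_exponent; ring.
rewrite -exprnP expr0 mul1r 2!(exprD q) -/(qsquare b1 s1) -/(qsquare b2 s2)
  -/(qsquare b3 s3).
have q0 : qpoch q 0 = 1 by rewrite /qpoch big_geq.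
have -> : S13_denom (0, 0, 0, s1, s2, s3)%N = qpoch q (s1 - s2) *
    (qpoch q (s2 - s3) * (qpoch q s3 * qpoch q (s3 + 1))).
  by rewrite /S13_denom !subn0 add0n q0; ring.
rewrite /bailey.
move: (qpoch q _) (qpoch_unit (s1 - s2)) (qpoch q (s2 - s3)) (qpoch_unit (s2 - s3)).
move=> u uU v vU; have wU := unitrM (qpoch q s3) (qpoch q (s3 + 1)).
rewrite !qpoch_unit in wU; move: (qpoch q s3 * _) wU => w wU.
by rewrite !invrM ?unitrM ?vU ?wU//; ring.
Qed.

Lemma zcoef0_S13_term rho sigma (r1 r2 r3 s1 s2 s3 : nat) :
  zcoef 0 (S13_term rho sigma (r1.+1, r2, r3, s1, s2, s3)) = 0.
Proof. by rewrite S13_termE (exprS z) -2!mulrA zcoef0_mulz. Qed.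

Lemma zcoef0_qM e f : zcoef 0 (q ^ e * f) = zcoef 0 (q ^ e) * zcoef 0 f.
Proof. by rewrite zcoefM big_ord1. Qed.

Lemma zcoef0_S13_111 rho :
  zcoef 0 (S13 rho (1, 1, 1)) = zcoef 0 (qpoch_inf q)^-1.
Proof.
apply: (zcoef0_chain (a1 := 1) (a2 := 1) (a3 := 1)) (S13_summable _ _) => //.
- by move=> *; apply: zcoef0_S13_term.
- by move=> *; rewrite (S13_term_r0 _ 1 1 1).
Qed.

Lemma zcoef0_S13_diff rho (s s' : int * int * int)
    (F1 F2 F3 : nat -> laurent {poly int}) a1 a2 a3 :
  (forall s, F1 s * bailey a2 s = qsquare a1 s * bailey a1 s) ->
  (forall s, F2 s * bailey a3 s = qsquare a2 s * bailey a2 s) ->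
  (forall s, F3 s * bailey 1 s = qsquare a3 s * bailey a3 s) ->
  (forall s1 s2 s3, S13_term rho s (0, 0, 0, s1, s2, s3)%N -
    q * S13_term rho s' (0, 0, 0, s1, s2, s3)%N = F1 s1 * F2 s2 * F3 s3 /
    qpoch q (s1 - s2) / qpoch q (s2 - s3) * bailey 1 s3) ->
  zcoef 0 (S13 rho s - q * S13 rho s') = zcoef 0 (qpoch_inf q)^-1.
Proof.
move=> F1E F2E F3E fE.
apply: (zcoef0_chain F1E F2E F3E _ fE) (is_lsumB (S13_summable _ _)
  (is_lsumM q (S13_summable _ _))) => r1 r2 r3 s1 s2 s3.
rewrite zcoefB zcoef0_S13_term sub0r -[q]/(q ^ 1) zcoef0_qM zcoef0_S13_term.
by rewrite mulr0 oppr0.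
Qed.

Lemma bailey_diff s : (qsquare 0 s - q * qsquare 1 s) * bailey 1 s =
  qsquare 0 s * bailey 0 s.
Proof. by rewrite qsquare_diff -mulrA -bailey0. Qed.

Lemma zcoef0_S13_011 rho : zcoef 0 (S13 rho (0, 1, 1) - q * S13 rho (1, 1, 1)) =
  zcoef 0 (qpoch_inf q)^-1.
Proof.
apply: (zcoef0_S13_diff (F2 := qsquare 1) (F3 := qsquare 1) bailey_diff) => //.
by move=> s1 s2 s3; rewrite (S13_term_r0 _ 0 1 1) (S13_term_r0 _ 1 1 1); ring.
Qed.

Lemma zcoef0_S13_001 rho : zcoef 0 (S13 rho (0, 0, 1) - q * S13 rho (0, 1, 1)) =
  zcoef 0 (qpoch_inf q)^-1.
Proof.
apply: (zcoef0_S13_diff (F1 := qsquare 0) (F3 := qsquare 1) _ bailey_diff) => //.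
by move=> s1 s2 s3; rewrite (S13_term_r0 _ 0 0 1) (S13_term_r0 _ 0 1 1); ring.
Qed.

Lemma zcoef0_S13_000 rho : zcoef 0 (S13 rho (0, 0, 0) - q * S13 rho (0, 0, 1)) =
  zcoef 0 (qpoch_inf q)^-1.
Proof.
apply: (zcoef0_S13_diff (F1 := qsquare 0) (F2 := qsquare 0) _ _ bailey_diff) => //.
by move=> s1 s2 s3; rewrite (S13_term_r0 _ 0 0 0) (S13_term_r0 _ 0 0 1); ring.
Qed.

(** Only r_1 = r_2 = r_3 = 0 contributes at z^0, and there rho is multiplied by 0. This allows
    [form_at_z0] to reset rho before collecting symbols. *)
Lemma zcoef0_S13_rho rho rho' sigma :
  zcoef 0 (S13 rho sigma) = zcoef 0 (S13 rho' sigma).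
Proof.
have s r := is_lsum_map (@zcoef_is_zmod_morphism _ 0) (@zcoef_continuous _ 0)
  (S13_summable r sigma).
apply: is_lsum_unique (s rho) _; apply: eq_is_lsum (s rho').
case=> [[[[[[|r1] r2] r3] s1] s2] s3] /and4P[r12 r23 s12 s23]; last first.
  by rewrite !zcoef0_S13_term.
congr zcoef; apply: eq_S13_term; case: rho rho' sigma {s} =>
  [[? ?] ?] [[? ?] ?] [[? ?] ?].
have [-> ->] : r2 = 0%N /\ r3 = 0%N by lia.
by rewrite /S13_exponent; ring.
Qed.

(** * The q-difference system *)

Lemma null_val f : null f -> form_val f = 0.
Proof.
move=> /(_ 0); rewrite /form_shift map_id_in// => -[[[[i j] rho] sigma] c] _ /=.
by rewrite mul0r addr0 /add_triple /= !addr0; case: rho => [[? ?] ?].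
Qed.

Lemma form_shift_add m n f : form_shift m (form_shift n f) = form_shift (n + m) f.
Proof.
rewrite /form_shift -map_comp; apply: eq_map => -[[[[i j] rho] sigma] c] /=.
by rewrite /add_triple /= mulrDl !addrA !addr0.
Qed.

Lemma null_shift m f : null f -> null (form_shift m f).
Proof. by move=> f0 n; rewrite form_shift_add f0. Qed.

Lemma null_extra t : (forall x, x \in t -> null (target x.1.2)) -> null (extra t).
Proof.
elim: t => [_|x t IH tx]; first exact: vanishing_null.
apply: null_cat; first by apply/null_scale/null_shift/tx; rewrite inE eqxx.
by apply: IH => y yt; apply: tx; rewrite inE yt orbT.
Qed.

Lemma zshift_form_val f : zshift (form_val f) = form_val (form_shift 1 f).
Proof.
rewrite /form_val big_map rmorph_sum; apply: eq_bigr => -[[[[i j] rho] sigma] c] _.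
case: rho => [[a1 a2] a3]; rewrite /mono_val /add_triple /= !addr0.
rewrite [LHS]zshiftM rmorph_int; congr (_ * _).
rewrite zshiftM zshift_S13; congr (_ * _).
rewrite zshiftM (zshift_expz j) rmorphXn /= zshift_z exprMn mul1r q_expzD.
by rewrite -mulrA [q ^+ i * _]mulrC.
Qed.

Lemma iter_zshift_form_val m f :
  iter m zshift (form_val f) = form_val (form_shift m%:Z f).
Proof.
elim: m => [|m IH] /=; last first.
  by rewrite IH zshift_form_val form_shift_add -addn1 PoszD.
rewrite /form_shift map_id_in// => -[[[[i j] rho] sigma] c] _ /=.
by rewrite mul0r addr0 /add_triple /= !addr0; case: rho => [[? ?] ?].
Qed.

(** Order of dependence: (4,3,3), then (6,1,3), then (5,4,1), then (4,4,2) and (5,5,0), then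
    (5,1,4). The other six certificates use contiguous relations only, and the equations of
    [trivial_profiles] vanish on collection. *)
Lemma null_target c : c \in profiles -> null (target c).
Proof.
have by_cert s d : vanishing (form_scale [:: cm (-1) 0 0] (combine s ++ [::])
    ++ target d) -> null (target d).
  by apply: null_by; apply: vanishing_null.
have T433 : null (target (4, 3, 3)%N) := by_cert _ _ check_433.
have T613 : null (target (6, 1, 3)%N).
  apply: null_by check_613; apply: null_extra => x.
  rewrite !inE => /eqP ->; exact: T433.
have T541 : null (target (5, 4, 1)%N).
  apply: (@null_unscale 1); apply: null_by check_541; apply: null_extra => x.
  rewrite !inE => /eqP ->; exact: T613.
have T442 : null (target (4, 4, 2)%N).
  apply: null_by check_442; apply: null_extra => x.
  rewrite !inE => /eqP ->; exact: T541.
have T550 : null (target (5, 5, 0)%N).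
  apply: null_by check_550; apply: null_extra => x.
  rewrite !inE => /eqP ->; exact: T541.
have T514 : null (target (5, 1, 4)%N).
  (* Exponent 0 selects the factor 1 - z, as exponent 1 selected 1 - zq for (5,4,1). *)
  apply: (@null_unscale 0); apply: null_by check_514; apply: null_extra => x.
  rewrite !inE => /or4P[] /eqP ->; [exact: T442|exact: T550|exact: T613|exact: T613].
have T910 := by_cert _ _ check_910; have T820 := by_cert _ _ check_820.
have T811 := by_cert _ _ check_811; have T712 := by_cert _ _ check_712.
have T721 := by_cert _ _ check_721; have T622 := by_cert _ _ check_622.
pose trivial_profiles := [:: (10, 0, 0); (9, 0, 1); (8, 0, 2); (7, 3, 0);
  (7, 0, 3); (6, 3, 1); (5, 3, 2); (5, 2, 3); (6, 4, 0); (6, 0, 4)]%N.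
have trivialP : all (fun d => vanishing (target d)) trivial_profiles by vm_compute.
have split_profiles : all (fun d => (d \in trivial_profiles) || (d \in
    [:: (4, 3, 3); (6, 1, 3); (5, 4, 1); (4, 4, 2); (5, 5, 0); (5, 1, 4);
        (9, 1, 0); (8, 2, 0); (8, 1, 1); (7, 1, 2); (7, 2, 1); (6, 2, 2)]%N))
    profiles by vm_compute.
move=> /(allP split_profiles)/orP[/(allP trivialP)/vanishing_null//|].
rewrite inE => /predU1P[->|]; first exact: T433.
rewrite inE => /predU1P[->|]; first exact: T613.
rewrite inE => /predU1P[->|]; first exact: T541.
rewrite inE => /predU1P[->|]; first exact: T442.
rewrite inE => /predU1P[->|]; first exact: T550.
rewrite inE => /predU1P[->|]; first exact: T514.
rewrite inE => /predU1P[->|]; first exact: T910.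
rewrite inE => /predU1P[->|]; first exact: T820.
rewrite inE => /predU1P[->|]; first exact: T811.
rewrite inE => /predU1P[->|]; first exact: T712.
rewrite inE => /predU1P[->|]; first exact: T721.
rewrite inE => /eqP ->; exact: T622.
Qed.

Definition move_weight (m : nat) : laurent {poly int} :=
  (-1) ^+ m.-1 * qpoch (z * q) m.-1.

Lemma coef_val_move m : (0 < m <= 3)%N -> coef_val (move_coef m) = move_weight m.
Proof.
have cmE c i j : coef_val [:: cm c i j] = c%:~R * z ^+ i * q ^ j.
  by rewrite /coef_val big_seq1.
have catE (s t : coef) : coef_val (s ++ t) = coef_val s + coef_val t.
  exact: big_cat.
have qE n : q ^ n%:Z = q ^+ n by [].
case: m => [|[|[|[|m]]]] // _; rewrite /move_weight /qpoch.
- by rewrite cmE big_geq// qE !expr0 !mulr1.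
- rewrite -[move_coef _]/([:: cm (-1) 0 0] ++ [:: cm 1 1 1]) catE !cmE !qE.
  by rewrite big_nat1 rmorphN1 !expr0 !expr1; ring.
- rewrite -[move_coef _]/([:: cm 1 0 0] ++ ([:: cm (-1) 1 1] ++ ([:: cm (-1) 1 2]
    ++ [:: cm 1 2 3]))) !catE !cmE !qE /= big_nat_recr//= big_nat1 rmorphN1.
  ring.
Qed.

Lemma coef_val_opp : coef_val [:: cm (-1) 0 0] = -1.
Proof. by rewrite /coef_val big_seq1 /= expr0 expr0z !mulr1. Qed.

Lemma form_val_H_form c : c \in profiles -> form_val (H_form c) =
  \sum_(x <- moves c) move_weight x.1 * iter x.1 zshift (form_val (H_form x.2)).
Proof.
move=> /null_target/null_val; rewrite form_val_cat form_val_scale coef_val_opp.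
rewrite mulN1r => /subr0_eq cE; apply: etrans cE _.
have movesP x : x \in moves c -> (0 < x.1 <= 3)%N.
  by move=> /mapP[J]; rewrite mem_filter => /andP[_ +] ->;
    move: J; apply/allP.
elim: (moves c) movesP => [|x s IH] sP; first by rewrite /form_val !big_nil.
rewrite big_cons [flatten _]/= form_val_cat IH => [|y ys]; last first.
  by apply: sP; rewrite inE ys orbT.
congr (_ + _); rewrite form_val_scale iter_zshift_form_val coef_val_move//.
by apply: sP; rewrite inE eqxx.
Qed.

Definition form_at_z0 (f : form) : form :=
  [seq (0%N, x.1.1.1.2, (0, 0, 0), x.1.2, x.2) | x <- f & x.1.1.1.1 == 0%N].

Lemma zcoef0_form_val f :
  zcoef 0 (form_val f) = zcoef 0 (form_val (form_at_z0 f)).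
Proof.
rewrite /form_val big_map big_filter !zcoef_sum [RHS]big_mkcond.
apply: eq_bigr => -[[[[i j] rho] sigma] c] _ /=.
rewrite zcoefM big_ord1 [in RHS]zcoefM big_ord1 /=; case: i => [|i] /=; last first.
  by rewrite (exprS z) -2!mulrA zcoef0_mulz mulr0.
congr (_ * _); rewrite !zcoefM !big_ord1; congr (_ * _).
exact: zcoef0_S13_rho.
Qed.

(** The four possibilities for the place where the parameter of the Bailey chain drops from 1 to 0:
    nowhere, at s_1, at s_2, at s_3. *)
Definition z0_forms : seq form :=
  [:: [:: fm 1 0 0 (0, 0, 0) (1, 1, 1)];
      [:: fm 1 0 0 (0, 0, 0) (0, 1, 1); fm (-1) 0 1 (0, 0, 0) (1, 1, 1)];
      [:: fm 1 0 0 (0, 0, 0) (0, 0, 1); fm (-1) 0 1 (0, 0, 0) (0, 1, 1)];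
      [:: fm 1 0 0 (0, 0, 0) (0, 0, 0); fm (-1) 0 1 (0, 0, 0) (0, 0, 1)]].

Lemma zcoef0_z0_forms f : f \in z0_forms ->
  zcoef 0 (form_val f) = zcoef 0 (qpoch_inf q)^-1.
Proof.
have v1 s : form_val [:: fm 1 0 0 (0, 0, 0) s] = S13 (0, 0, 0) s.
  by rewrite /form_val big_seq1 /= expr0 expr0z !mul1r.
have v2 s t : form_val [:: fm 1 0 0 (0, 0, 0) s; fm (-1) 0 1 (0, 0, 0) t] =
    S13 (0, 0, 0) s - q * S13 (0, 0, 0) t.
  rewrite -cat1s form_val_cat v1; congr (_ + _).
  by rewrite /form_val big_seq1 /= expr0 expr1z mul1r rmorphN1 mulN1r.
rewrite !inE => /or4P[] /eqP ->; rewrite ?v1 ?v2.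
- exact: zcoef0_S13_111.
- exact: zcoef0_S13_011.
- exact: zcoef0_S13_001.
- exact: zcoef0_S13_000.
Qed.

(** Each right-hand side of the theorem collapses at z = 0 to one of the forms in [z0_forms]; the
    computation finds which. *)
Lemma zcoef0_H_form c : c \in profiles ->
  zcoef 0 (form_val (H_form c)) = zcoef 0 (qpoch_inf q)^-1.
Proof.
have : all (fun d => has (fun f => vanishing (form_scale [:: cm (-1) 0 0] f ++
  form_at_z0 (H_form d))) z0_forms) profiles by vm_compute.
move=> /allP chk /chk/hasP[f fz /vanishing_null/null_val].
rewrite form_val_cat form_val_scale.
rewrite coef_val_opp mulN1r addrC => /subr0_eq fE.
by rewrite zcoef0_form_val fE zcoef0_z0_forms.
Qed.

(* Once the coefficients of z^0, ..., z^k of g - h vanish, the system expresses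
   those of z^(k+1) through each other with factors q^(m (k+1)), m > 0, which
   raises the order in q indefinitely. *)
Lemma zshift_system_unique (T : choiceType) (cs : seq T) (mv : T -> seq (nat * T))
    (w : nat -> laurent {poly int}) (g h : T -> laurent {poly int}) :
  (forall m, vanish_below 0 (w m)) ->
  (forall c x, c \in cs -> x \in mv c -> (0 < x.1)%N /\ x.2 \in cs) ->
  (forall c, c \in cs -> g c = \sum_(x <- mv c) w x.1 * iter x.1 zshift (g x.2)) ->
  (forall c, c \in cs -> h c = \sum_(x <- mv c) w x.1 * iter x.1 zshift (h x.2)) ->
  (forall c, c \in cs -> zcoef 0 (g c) = zcoef 0 (h c)) ->
  forall c, c \in cs -> g c = h c.
Proof.
move=> w0 mvP gE hE gh0.
suff D0 k c : c \in cs -> forall j, (j <= k)%N -> zcoef j (g c - h c) = 0.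
  move=> c cc; apply/eqP; rewrite -subr_eq0; apply/eqP/zcoefP => k.
  by rewrite (D0 k c cc k (leqnn k)) [RHS]raddf0.
elim: k c => [|k IH] c cc j; first by rewrite leqn0 => /eqP ->; rewrite zcoefB gh0 ?subrr.
rewrite leq_eqVlt => /predU1P[->|]; last by rewrite ltnS; apply: IH.
have DE d : d \in cs -> zcoef k.+1 (g d - h d) = \sum_(x <- mv d)
    zcoef 0 (w x.1) * (lmono 1 (x.1 * k.+1)%N%:Z * zcoef k.+1 (g x.2 - h x.2)).
  move=> dc; rewrite gE// hE// -sumrB zcoef_sum big_seq [RHS]big_seq.
  apply: eq_bigr => x xd; have [x0 xc] := mvP d x dc xd.
  have iB m (u v : laurent {poly int}) :
      iter m zshift u - iter m zshift v = iter m zshift (u - v).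
    by elim: m => //= m IHm; rewrite -rmorphB IHm.
  rewrite -mulrBr iB zcoefM big_ord_recl subn0 zcoef_iter_zshift big1 ?addr0//.
  move=> i _; rewrite zcoef_iter_zshift IH ?mulr0//; rewrite /= /bump /=; lia.
(* A common lower bound in q exists because [cs] is finite; it is the starting point from which the
   order is raised. *)
have [a Da] : exists a, forall d, d \in cs -> vanish_below a (zcoef k.+1 (g d - h d)).
  elim: {mvP gE hE gh0 IH cc DE} (cs) => [|d s [a sa]]; first by exists 0.
  have [b db] := laurent_bound (zcoef k.+1 (g d - h d)).
  exists (Num.min a b) => e; rewrite inE => /predU1P[->|es].
    by apply: vanish_belowW db; rewrite ge_min lexx orbT.
  by apply: vanish_belowW (sa e es); rewrite ge_min lexx.
have Dall N d : d \in cs -> vanish_below (a + N%:Z) (zcoef k.+1 (g d - h d)).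
  elim: N d => [|N IHN] d dc; first by rewrite addr0; apply: Da.
  rewrite DE//; apply: vanish_below_sum => x xd _; have [x0 xc] := mvP d x dc xd.
  rewrite -[a + _]add0r; apply: vanish_belowM.
    exact: vanish_below_zcoef.
  move=> n nN; rewrite lmonoM mul1r (IHN x.2 xc)//.
  have : (0 < x.1 * k.+1)%N by rewrite muln_gt0 x0.
  by move: (x.1 * k.+1)%N nN => y nN y0; lia.
apply: laurentP => n; rewrite coefl0 (Dall (`|n - a|%N.+1) c cc)//; lia.
Qed.

(** * Translation between tuples and triples, and comparison of the two solutions *)

Definition profile_tuple (c : profile) : 3.-tuple nat := [tuple c.1.1; c.1.2; c.2].

Definition Hc3 (c : profile) : laurent {poly int} := Hc (profile_tuple c).

Lemma Hc3_rotate c : Hc3 (rotate c) = Hc3 c.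
Proof.
rewrite /Hc3 -[RHS]Hc_rotate; congr Hc; apply: eq_from_tnth => -[[|[|[|i]]] iP] //;
  by rewrite tnth_mktuple !(tnth_nth 0%N).
Qed.

Lemma Hc3_canon c : Hc3 (canon c) = Hc3 c.
Proof.
by rewrite /canon; case: ifP => // _; case: ifP => _; rewrite ?Hc3_rotate.
Qed.

Definition subset3 (J : bool * bool * bool) : {set 'I_3} :=
  [set i : 'I_3 | nth false [:: J.1.1; J.1.2; J.2] i].

(** The recurrence sums over sets of rows and [moves] over triples of booleans; [subset3] is a
    bijection between them, with inverse given by membership of the three indices. *)
Lemma sum_subset3 (A : nmodType) (F : {set 'I_3} -> A) :
  \sum_J F J = F (subset3 (false, false, false)) +
    \sum_(J <- nonempty_subsets) F (subset3 J).
Proof.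
pose g (J : {set 'I_3}) : bool * bool * bool :=
  (inord 0 \in J, inord 1 \in J, inord 2 \in J).
have sK : cancel subset3 g.
  by case=> [[j1 j2] j3]; rewrite /g !inE !inordK.
have gK : cancel g subset3.
  move=> J; apply/setP => -[[|[|[|i]]] iP] //; rewrite inE /=;
  by congr (_ \in J); apply: val_inj; rewrite /= inordK.
rewrite (reindex subset3); last by exists g => J _; [apply: sK|apply: gK].
rewrite -[RHS](big_cons _ _ (false, false, false) _ xpredT (F \o subset3)).
apply: perm_big; apply: uniq_perm; rewrite ?index_enum_uniq//.
by move=> [[[] []] []]; rewrite mem_index_enum.
Qed.

Lemma card_subset3 J : #|subset3 J| = card3 J.
Proof.
case: J => [[j1 j2] j3]; rewrite -sum1_card big_mkcond !big_ord_recl big_ord0 /=.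
by rewrite !inE /card3 /=; case: j1 j2 j3 => [] [] [].
Qed.

Lemma subset3_support c J :
  (subset3 J \subset support (profile_tuple c)) = admissible c J.
Proof.
case: c J => [[c1 c2] c3] [[j1 j2] j3].
apply/fintype.subsetP/and3P => [Js|[a1 a2 a3] i].
  split; apply/implyP => j.
  - by have := Js (inord 0); rewrite !inE !(tnth_nth 0%N) inordK//= => /(_ j).
  - by have := Js (inord 1); rewrite !inE !(tnth_nth 0%N) inordK//= => /(_ j).
  - by have := Js (inord 2); rewrite !inE !(tnth_nth 0%N) inordK//= => /(_ j).
rewrite !inE (tnth_nth 0%N); case: i => [[|[|[|i]]] iP] //=;
  exact/implyP.
Qed.

Lemma profile_step3 c J :
  profile_step (profile_tuple c) (subset3 J) = profile_tuple (step c J).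
Proof.
apply: ordS_inj_tuple => i; rewrite tnth_profile_step !(tnth_nth 0%N) !inE.
by case: c J => [[c1 c2] c3] [[j1 j2] j3]; case: i => [[|[|[|i]]] iP].
Qed.

(** The hypothesis is the nonempty support required by [Hc_rec]; replacing each c(J) by its
    representative is harmless by rotation invariance. *)
Lemma Hc3_moves c : c != (0, 0, 0)%N ->
  Hc3 c = \sum_(x <- moves c) move_weight x.1 * iter x.1 zshift (Hc3 x.2).
Proof.
move=> c0; rewrite {1}/Hc3 Hc_rec; last first.
  apply: contra c0; case: c => [[c1 c2] c3] /eqP/setP s0.
  have := s0 (inord 0); have := s0 (inord 1); have := s0 (inord 2).
  by rewrite !inE !(tnth_nth 0%N) !inordK//= => /negbT + /negbT + /negbT;
     rewrite -!eqn0Ngt => /eqP -> /eqP -> /eqP ->.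
rewrite big_mkcond sum_subset3 /= -cards_eq0 card_subset3 add0r.
rewrite big_map big_filter [RHS]big_mkcond big_seq [RHS]big_seq.
apply: eq_bigr => J JJ; rewrite -cards_eq0 card_subset3 subset3_support.
have /allP/(_ J JJ) -> /= : all (fun K => card3 K != 0%N) nonempty_subsets by [].
by rewrite profile_step3 -/(Hc3 _) Hc3_canon.
Qed.

Lemma Hc_H_form c : c \in profiles -> Hc (profile_tuple c) = form_val (H_form c).
Proof.
apply: (zshift_system_unique (w := move_weight) (mv := moves)
  (g := Hc3) (h := form_val \o H_form)).
- move=> m; rewrite /move_weight -[0]addr0; apply: vanish_belowM.
    elim: m.-1 => [|n IH]; first exact: vanish_below1.
    by rewrite exprS mulN1r; apply: vanish_belowN.
  apply: vanish_below_qpoch; have := vanish_below_zqX 1; by rewrite expr1.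
(* Closure of the list of profiles under the recurrence; this also verifies the default branch of
   [canon]. *)
- have : all (fun c => all (fun x => (0 < x.1)%N && (x.2 \in profiles)) (moves c))
    profiles by vm_compute.
  by move=> /allP chk d x /chk/allP cx /cx/andP[].
- move=> d dP; apply: Hc3_moves; apply: contraTneq dP => ->.
  by vm_compute.
- exact: form_val_H_form.
(* F_c and (zq; q)_oo both have coefficient 1 at z^0, so 1/(q; q)_oo remains. *)
- move=> d dP; rewrite [RHS]zcoef0_H_form// /Hc3 /Hc zcoefM big_ord1.
  rewrite zcoef0_Fc mulr1 zcoefM big_ord1.
  suff -> : zcoef 0 (qpoch_inf (z * q)) = 1 by rewrite mul1r.
  have zq0 : vanish_below 0 (z * q) by have := vanish_below_zqX 1; rewrite expr1.
  apply: laurentP => n; have [N _ hN] := lcvg_qpoch zq0 n.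
  rewrite zcoefE -(hN N (leqnn N) n (lexx n)) -zcoefE.
  suff -> : zcoef 0 (qpoch (z * q) N) = 1 by [].
  elim: N {hN} => [|N IH].
    rewrite /qpoch big_geq// zcoef_lmono coef1 //.
  have zE : qpoch (z * q) N * (z * q * q ^+ N) = z * (qpoch (z * q) N * (q * q ^+ N)).
    by ring.
  by rewrite qpochS zE zcoefB IH zcoef0_mulz subr0.
Qed.

(** With the two lemmas that follow it, reads an entry of [H_table] term by term: the coefficients
    there are all 1 or -1, and [Negz 0] is -1. *)
Lemma form_val_pos (i j : nat) rho sigma f :
  form_val ((i, Posz j, rho, sigma, Posz 1) :: f) =
  z ^+ i * q ^+ j * S13 rho sigma + form_val f.
Proof. by rewrite /form_val big_cons mul1r. Qed.

Lemma form_val_neg (i j : nat) rho sigma f :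
  form_val ((i, Posz j, rho, sigma, Negz 0) :: f) =
  - (z ^+ i * q ^+ j * S13 rho sigma) + form_val f.
Proof. by rewrite /form_val big_cons mulN1r. Qed.

(** Serves the single term with a negative power of q, the z/q in the formula for (5,5,0). *)
Lemma form_val_negV (i : nat) rho sigma f :
  form_val ((i, Negz 0, rho, sigma, Negz 0) :: f) =
  - (z ^+ i / q * S13 rho sigma) + form_val f.
Proof. by rewrite /form_val big_cons mulN1r. Qed.

Lemma form_val_nil : form_val [::] = 0.
Proof. exact: big_nil. Qed.

Theorem theorem5p3 :
  Hc [tuple 10; 0; 0]%N =
    S13 (1, 1, 1) (1, 1, 1) /\
  Hc [tuple 9; 1; 0]%N =
    S13 (0, 1, 1) (1, 1, 1) /\
  Hc [tuple 9; 0; 1]%N =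
    S13 (1, 1, 1) (0, 1, 1) - q * (1 - z) * S13 (2, 1, 1) (1, 1, 1) /\
  Hc [tuple 8; 2; 0]%N =
    S13 (0, 0, 1) (1, 1, 1) /\
  Hc [tuple 8; 1; 1]%N =
    S13 (0, 1, 1) (0, 1, 1) - q * S13 (1, 1, 1) (1, 1, 1) /\
  Hc [tuple 8; 0; 2]%N =
    S13 (1, 1, 1) (0, 0, 1) - q * (1 - z) * S13 (2, 1, 1) (0, 1, 1) /\
  Hc [tuple 7; 3; 0]%N =
    S13 (0, 0, 0) (1, 1, 1) /\
  Hc [tuple 7; 2; 1]%N =
    S13 (0, 0, 1) (0, 1, 1) - q * S13 (0, 1, 1) (1, 1, 1) /\
  Hc [tuple 7; 1; 2]%N =
    S13 (0, 1, 1) (0, 0, 1) - q * S13 (1, 1, 1) (0, 1, 1) /\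
  Hc [tuple 7; 0; 3]%N =
    S13 (1, 1, 1) (0, 0, 0) - q * (1 - z) * S13 (2, 1, 1) (0, 0, 1) /\
  Hc [tuple 6; 3; 1]%N =
    S13 (0, 0, 0) (0, 1, 1) - q * S13 (0, 0, 1) (1, 1, 1) /\
  Hc [tuple 6; 2; 2]%N =
    S13 (0, 0, 1) (0, 0, 1) - q * S13 (0, 1, 1) (0, 1, 1) /\
  Hc [tuple 6; 1; 3]%N =
    S13 (0, 1, 1) (0, 0, 0) - q * S13 (1, 1, 1) (0, 0, 1) /\
  Hc [tuple 5; 3; 2]%N =
    S13 (0, 0, 0) (0, 0, 1) - q * S13 (0, 0, 1) (0, 1, 1) /\
  Hc [tuple 5; 2; 3]%N =
    S13 (0, 0, 1) (0, 0, 0) - q * S13 (0, 1, 1) (0, 0, 1) /\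
  Hc [tuple 4; 3; 3]%N =
    S13 (0, 0, 0) (0, 0, 0) - q * S13 (0, 0, 1) (0, 0, 1) /\
  Hc [tuple 6; 4; 0]%N =
    S13 (-1, 0, 0) (1, 1, 1) - S13 (0, 0, 1) (0, 1, 1)
    + q * S13 (0, 1, 1) (1, 1, 1) + (1 - z) * S13 (1, 0, 0) (0, 1, 1)
    - q * (1 - z) * S13 (1, 0, 1) (1, 1, 1) /\
  Hc [tuple 5; 5; 0]%N =
    S13 (-2, 0, 0) (1, 1, 1) - S13 (-1, 0, 1) (0, 1, 1)
    + q * S13 (-1, 1, 1) (1, 1, 1)
    + (1 - z / q - z) * S13 (0, 0, 0) (0, 1, 1)
    - (q - z - q * z) * S13 (0, 0, 1) (1, 1, 1)
    - q * (1 - z) * z * S13 (1, 0, 0) (1, 1, 1)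
    - (1 - z) * S13 (1, 0, 1) (0, 0, 1)
    + q * (1 - z) * S13 (1, 1, 1) (0, 1, 1)
    + (1 - z) * (1 - q * z) * S13 (2, 0, 0) (0, 0, 1)
    - q * (1 - z) * (1 - q * z) * S13 (2, 0, 1) (0, 1, 1) /\
  Hc [tuple 5; 4; 1]%N =
    S13 (-1, 0, 0) (0, 1, 1) - q * S13 (-1, 0, 1) (1, 1, 1)
    - z * S13 (0, 0, 0) (1, 1, 1) - S13 (0, 0, 1) (0, 0, 1)
    + q * S13 (0, 1, 1) (0, 1, 1) + (1 - z) * S13 (1, 0, 0) (0, 0, 1)
    - q * (1 - z) * S13 (1, 0, 1) (0, 1, 1) /\
  Hc [tuple 4; 4; 2]%N =
    S13 (-1, 0, 0) (0, 0, 1) - q * S13 (-1, 0, 1) (0, 1, 1)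
    - z * S13 (0, 0, 0) (0, 1, 1) - S13 (0, 0, 1) (0, 0, 0)
    + q * z * S13 (0, 0, 1) (1, 1, 1) + q * S13 (0, 1, 1) (0, 0, 1)
    + (1 - z) * S13 (1, 0, 0) (0, 0, 0)
    - q * z * (1 - z) * S13 (1, 0, 0) (1, 1, 1)
    - q * (1 - z) * S13 (1, 0, 1) (0, 0, 1) /\
  Hc [tuple 5; 1; 4]%N =
    S13 (-1, 0, 1) (0, 0, 0) - q * S13 (-1, 1, 1) (0, 0, 1)
    - S13 (0, 0, 0) (0, 0, 0) + (1 - z) * S13 (0, 0, 0) (0, 0, 1)
    - (1 - q) * S13 (0, 0, 1) (0, 0, 1)
    - q * (1 - z) * S13 (0, 0, 1) (0, 1, 1) + q * S13 (0, 1, 1) (0, 1, 1)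
    + (1 - z) * S13 (1, 0, 0) (0, 0, 1)
    - q * (1 - z) * z * S13 (1, 0, 0) (0, 1, 1)
    - (1 - z) * S13 (1, 0, 1) (0, 0, 0)
    - q * (1 - z) * S13 (1, 0, 1) (0, 1, 1)
    + q ^+ 2 * (1 - z) * z * S13 (1, 0, 1) (1, 1, 1)
    + (1 - z) * S13 (1, 1, 1) (0, 0, 0)
    + q * (1 - z) * S13 (1, 1, 1) (0, 0, 1)
    + (1 - z) * (1 - q * z) * S13 (2, 0, 0) (0, 0, 0)
    - q ^+ 2 * z * (1 - z) * (1 - q * z) * S13 (2, 0, 0) (1, 1, 1)
    - (1 - z) * (1 - q * z) * S13 (2, 0, 1) (0, 0, 0)
    - q * (1 - z) * (1 - q * z) * S13 (2, 0, 1) (0, 0, 1)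
    - q ^+ 2 * z * (1 - z) * S13 (2, 1, 1) (0, 0, 1) /\
  Hc [tuple 6; 0; 4]%N =
    S13 (0, 0, 1) (0, 0, 0) - q * S13 (0, 1, 1) (0, 0, 1)
    - S13 (1, 0, 0) (0, 0, 0) + (1 - q * z) * S13 (1, 0, 0) (0, 0, 1)
    - (1 - q) * S13 (1, 0, 1) (0, 0, 1)
    - q * (1 - q * z) * S13 (1, 0, 1) (0, 1, 1)
    + q * S13 (1, 1, 1) (0, 1, 1) + (1 - q * z) * S13 (2, 0, 0) (0, 0, 1)
    - q ^+ 2 * z * (1 - q * z) * S13 (2, 0, 0) (0, 1, 1)
    - (1 - q * z) * S13 (2, 0, 1) (0, 0, 0)
    - q * (1 - q * z) * S13 (2, 0, 1) (0, 1, 1)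
    + q ^+ 3 * z * (1 - q * z) * S13 (2, 0, 1) (1, 1, 1)
    + S13 (2, 1, 1) (0, 0, 0) + q * (1 - q * z) * S13 (2, 1, 1) (0, 0, 1)
    + (1 - q * z) * (1 - q ^+ 2 * z) * S13 (3, 0, 0) (0, 0, 0)
    - q ^+ 3 * z * (1 - q * z) * (1 - q ^+ 2 * z) * S13 (3, 0, 0) (1, 1, 1)
    - (1 - q * z) * (1 - q ^+ 2 * z) * S13 (3, 0, 1) (0, 0, 0)
    - q * (1 - q * z) * (1 - q ^+ 2 * z) * S13 (3, 0, 1) (0, 0, 1)
    - q ^+ 3 * z * (1 - q * z) * S13 (3, 1, 1) (0, 0, 1).
Proof.
(* Evaluation of the table shows integers through [Posz] and [Negz]; the numerals of the statement
   are brought to the same shape so that [ring] sees identical S13 atoms on both sides. *)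
have im2 : -2 = Negz 1 by []. have im1 : -1 = Negz 0 by [].
have i3 : 3 = Posz 3 by []. have i2 : 2 = Posz 2 by [].
have i1 : 1 = Posz 1 by []. have i0 : 0 = Posz 0 by [].
do 21?[split]; rewrite [LHS](Hc_H_form (c := (_, _, _)%N)) //; rewrite /H_form /=.
all: rewrite ?(form_val_pos, form_val_neg, form_val_negV) form_val_nil.
all: rewrite ?(im2, im1, i3, i2, i1, i0).
all: ring.
Qed.
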